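(* Let $X,Z$ be Hausdorff spaces and let $p:X\times X\to\mathbb{C}$ and $q:Z\times Z\to\mathbb{C}$ be bounded continuous positive definite kernels. Suppose that $p$ is SPD (respectively universal, ISPD). Then a measure $\lambda\in\mathcal{M}_{\delta}(X\times Z)$ (respectively $\lambda\in\mathcal{M}_{c}(X\times Z)$, $\lambda\in\mathcal{M}(X\times Z)$) satisfies $$\int_{X\times Z}\int_{X\times Z}p(x,y)q(u,v)\,d\lambda(x,u)\,d\overline{\lambda}(y,v)=0$$ if and only if $$\int_{Z}\int_{Z}q(u,v)\,d\lambda_{A}(u)\,d\overline{\lambda_{A}}(v)=0\quad\text{for every Borel set }A\subset X,$$ where $\lambda_{A}$ is the measure in $\mathcal{M}_{\delta}(Z)$ (respectively $\mathcal{M}_{c}(Z)$, $\mathcal{M}(Z)$) given by $\lambda_{A}(B):=\lambda(A\times B)$ for Borel $B\subset Z$. In particular, the kernel $(p\otimes q)((x,u),(y,v)):=p(x,y)q(u,v)$ on $X\times Z$ is SPD (respectively universal, ISPD) if and only if both kernels $p$ and $q$ are SPD (respectively universal, ISPD).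
   Context: $X$ and $Z$ are nonempty and $X\times Z$ carries the product topology. A kernel $K:Y\times Y\to\mathbb{C}$ is positive definite if $\sum_{\mu,\nu=1}^{n}c_{\mu}\overline{c_{\nu}}K(x_{\mu},x_{\nu})\ge 0$ for all finitely many distinct points $x_{\mu}\in Y$ and scalars $c_{\mu}\in\mathbb{C}$, and strictly positive definite (SPD) if moreover the sum vanishes only when all $c_{\mu}=0$. Its reproducing kernel Hilbert space $\mathcal{H}_{K}$ is the Hilbert space of functions $F:Y\to\mathbb{C}$ that contains $K_{y}:=K(\cdot,y)$ for every $y\in Y$, satisfies $\langle F,K_{y}\rangle_{\mathcal{H}_{K}}=F(y)$, and in which $\mathrm{span}\{K_{y}:y\in Y\}$ is dense. For a Hausdorff space $Y$, $\mathcal{M}(Y)$ denotes the finite complex-valued Radon measures on $Y$ (complex Borel measures $\lambda$ with $|\lambda|$ finite and, for every Borel $E$, $|\lambda|(E)=\sup\{|\lambda|(K):K\subset E\text{ compact}\}=\inf\{|\lambda|(U):U\supset E\text{ open}\}$); $\mathcal{M}_{c}(Y)\subset\mathcal{M}(Y)$ those of compact support; $\mathcal{M}_{\delta}(Y)$ the finite combinations $\sum_{\mu}c_{\mu}\delta_{x_{\mu}}$. A positive definite kernel $K$ on $Y$ is universal if $\mathcal{H}_{K}\subset C(Y)$ and for every compact $\mathcal{C}\subset Y$ the restrictions to $\mathcal{C}$ of functions of $\mathcal{H}_{K}$ are uniformly dense in $C(\mathcal{C})$; when $\mathcal{H}_{K}\subset C(Y)$, this is equivalent to: the only $\lambda\in\mathcal{M}_{c}(Y)$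 with $\int_{Y}\int_{Y}K\,d\lambda\,d\overline{\lambda}=0$ is zero. A bounded positive definite kernel $K$ with $\mathcal{H}_{K}\subset C(Y)$ is ISPD if the only $\lambda\in\mathcal{M}(Y)$ with $\int_{Y}\int_{Y}K(x,y)\,d\lambda(x)\,d\overline{\lambda}(y)=0$ is the zero measure. *)

(* Defs.v *)
From HB Require Import structures.
From mathcomp Require Import all_boot all_order all_algebra.
From mathcomp Require Import complex.
From mathcomp Require Import all_classical all_reals all_analysis.

Set Implicit Arguments.
Unset Strict Implicit.
Unset Printing Implicit Defensive.

Import Order.TTheory GRing.Theory Num.Theory.
Import numFieldNormedType.Exports.

Local Open Scope classical_set_scope.
Local Open Scope ring_scope.

(* R[i] seen as a numClosedFieldType, so that it carries the topology given by
   its norm. *)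
Definition Cplx (R : realType) : numClosedFieldType := R[i].

(* The R-valued modulus; on R[i] the generic norm `|z| is R[i]-valued. *)
Definition cabs (R : realType) (z : Cplx R) : R := ComplexField.Normc.normc z.

(* Y with the sigma-algebra generated by its open sets. For Y = X * Z this is
   the Borel sigma-algebra of the product topology, which may be larger than
   the product of the Borel sigma-algebras. *)
Notation borel Y := (g_sigma_algebraType (@open Y)).

(* registers the pointed topological structure of products *)
HB.saturate prod.

Section complex_measure.
Context d (T : measurableType d) (R : realType).

(* Charges of the library are finite-valued signed measures. They are functions
   on all sets, specified on the measurable ones only: equality of complex
   measures is to be tested on measurable sets. *)
Record cmeasure := CMeasure {
  cm_re : {charge set T -> \bar R} ;
  cm_im : {charge set T -> \bar R} }.

Definition cm_val (lam : cmeasure) (E : set T) : Cplx R :=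
  Complex (fine (cm_re lam E)) (fine (cm_im lam E)).

Definition cm_conj (lam : cmeasure) : cmeasure :=
  CMeasure (cm_re lam) (copp (cm_im lam)).

Definition cm_null (lam : cmeasure) : Prop :=
  forall E, measurable E -> cm_val lam E = 0.

(* |lam|(E), over countable measurable partitions of E *)
Definition total_variation (lam : cmeasure) (E : set T) : \bar R :=
  ereal_sup [set (\sum_(0 <= n <oo) (cabs (cm_val lam (F n)))%:E)%E
    | F in [set F : (set T)^nat |
        [/\ forall n, measurable (F n), trivIset setT F
          & \bigcup_n F n = E]]].

Definition hahn_sets (nu : {charge set T -> \bar R}) :
    {PN : set T * set T | hahn_decomposition nu PN.1 PN.2}.
Proof.
by apply: cid; have [P [N h]] := Hahn_decomposition nu; exists (P, N).
Defined.

(* The Jordan decomposition does not depend on the choice of the Hahn sets. *)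
Definition charge_integral (nu : {charge set T -> \bar R}) (f : T -> R) : R :=
  \int[jordan_pos (svalP (hahn_sets nu))]_x f x
  - \int[jordan_neg (svalP (hahn_sets nu))]_x f x.

Definition cintegral (lam : cmeasure) (f : T -> Cplx R) : Cplx R :=
  let u x := complex.Re (f x) in
  let v x := complex.Im (f x) in
  Complex
    (charge_integral (cm_re lam) u - charge_integral (cm_im lam) v)
    (charge_integral (cm_re lam) v + charge_integral (cm_im lam) u).

(* the iterated integral of K x y, first in d lam(x), then in d (conj lam)(y) *)
Definition double_integral (K : T -> T -> Cplx R) (lam : cmeasure) : Cplx R :=
  cintegral (cm_conj lam) (fun y => cintegral lam (fun x => K x y)).

End complex_measure.

Section radon.
Context (R : realType) (Y : ptopologicalType).
Implicit Type lam : cmeasure (borel Y) R.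

Definition radon lam : Prop :=
  (total_variation lam setT < +oo)%E /\
  forall E : set (borel Y), measurable E ->
    total_variation lam E = ereal_sup [set total_variation lam C
      | C in [set C : set Y | compact C /\ C `<=` E]] /\
    total_variation lam E = ereal_inf [set total_variation lam U
      | U in [set U : set Y | open U /\ E `<=` U]].

Definition support lam : set Y :=
  [set y | forall U : set Y, open U -> U y -> (0 < total_variation lam U)%E].

Definition radon_compact lam : Prop := radon lam /\ compact (support lam).

Definition discrete_measure lam : Prop :=
  exists (n : nat) (c : 'I_n -> Cplx R) (x : 'I_n -> Y),
  forall E : set (borel Y), measurable E ->
    cm_val lam E = \sum_(i < n) c i * \1_E (x i).

End radon.

Section kernel.
Context (R : realType) (Y : ptopologicalType).
Local Notation C := (Cplx R).
Implicit Type K : Y -> Y -> C.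

Definition kernel_form K n (x : 'I_n -> Y) (c : 'I_n -> C) : C :=
  \sum_(i < n) \sum_(j < n) c i * (c j)^* * K (x i) (x j).

Definition positive_definite K : Prop :=
  forall n (x : 'I_n -> Y) (c : 'I_n -> C), injective x ->
    0 <= kernel_form K x c.

Definition SPD K : Prop :=
  positive_definite K /\
  forall n (x : 'I_n -> Y) (c : 'I_n -> C), injective x ->
    kernel_form K x c = 0 -> forall i, c i = 0.

Definition bounded_kernel K : Prop :=
  exists M : R, forall x y, cabs (K x y) <= M.

Definition continuous_kernel K : Prop :=
  continuous (fun xy : Y * Y => K xy.1 xy.2).

Definition ip_norm (ip : (Y -> C) -> (Y -> C) -> C) (F : Y -> C) : R :=
  Num.sqrt (complex.Re (ip F F)).

(* H with the inner product ip (linear on the left, meaningful on H only) is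
   the reproducing kernel Hilbert space of K. *)
Record is_rkhs K (H : set (Y -> C)) (ip : (Y -> C) -> (Y -> C) -> C) : Prop := {
  rkhs_zero : H (fun=> 0) ;
  rkhs_comb : forall (a : C) F G, H F -> H G -> H (fun y => a * F y + G y) ;
  rkhs_ip_lin : forall (a : C) F G L, H F -> H G -> H L ->
    ip (fun y => a * F y + G y) L = a * ip F L + ip G L ;
  rkhs_ip_conj : forall F G, H F -> H G -> ip G F = (ip F G)^* ;
  rkhs_ip_ge0 : forall F, H F -> 0 <= ip F F ;
  rkhs_ip_def : forall F, H F -> ip F F = 0 -> forall y, F y = 0 ;
  rkhs_complete : forall u : nat -> Y -> C, (forall n, H (u n)) ->
    (forall e : R, 0 < e -> exists N, forall m n, (N <= m)%N -> (N <= n)%N ->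
      ip_norm ip (fun y => u m y - u n y) < e) ->
    exists F, H F /\ ip_norm ip (fun y => u n y - F y) @[n --> \oo] --> (0 : R) ;
  rkhs_section : forall y, H (K ^~ y) ;
  rkhs_reproducing : forall F y, H F -> ip F (K ^~ y) = F y ;
  rkhs_dense : forall F (e : R), H F -> 0 < e ->
    exists n (c : 'I_n -> C) (x : 'I_n -> Y),
      ip_norm ip (fun y => F y - \sum_(i < n) c i * K y (x i)) < e }.

(* For positive definite K there is exactly one H with is_rkhs K H ip for some
   ip (Moore-Aronszajn), so the union below has a single member. *)
Definition rkhs K : set (Y -> C) :=
  [set F | exists H ip, is_rkhs K H ip /\ H F].

Definition rkhs_continuous K : Prop := forall F, rkhs K F -> continuous F.

Definition universal K : Prop :=
  [/\ positive_definite K, rkhs_continuous K &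
    forall (A : set Y) (f : Y -> C) (e : R),
      compact A -> {within A, continuous f} -> 0 < e ->
      exists2 F, rkhs K F & forall x, A x -> cabs (F x - f x) < e].

Definition ISPD K : Prop :=
  [/\ bounded_kernel K, positive_definite K, rkhs_continuous K &
    forall lam : cmeasure (borel Y) R, radon lam ->
      double_integral (K : borel Y -> borel Y -> C) lam = 0 -> cm_null lam].

End kernel.

Section product.
Context (R : realType) (X Z : ptopologicalType).

Definition tensor_kernel (p : X -> X -> Cplx R) (q : Z -> Z -> Cplx R) :
    X * Z -> X * Z -> Cplx R :=
  fun s t => p s.1 t.1 * q s.2 t.2.

Lemma borel_continuous (S T : ptopologicalType) (f : S -> T) (A : set T) :
  continuous f -> measurable (A : set (borel T)) ->
  measurable (f @^-1` A : set (borel S)).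
Proof.
move=> cf mA; rewrite -[X in measurable X]setTI.
have mf : measurable_fun setT (f : borel S -> borel T).
  apply: (@measurability _ _ (borel S) (borel T) setT f (@open T)) => //.
  move=> _ [B oB <-]; rewrite setTI; apply: sub_sigma_algebra.
  by move: cf => /continuousP; apply.
exact: mf.
Qed.

Lemma borel_setX (A : set (borel X)) (B : set (borel Z)) :
  measurable A -> measurable B -> measurable (A `*` B : set (borel (X * Z)%type)).
Proof.
move=> mA mB.
have -> : A `*` B = (fst @^-1` A) `&` (snd @^-1` B) by [].
apply: measurableI.
- by apply: (borel_continuous _ mA) => x; exact: cvg_fst.
- by apply: (borel_continuous _ mB) => x; exact: cvg_snd.
Qed.

Definition slice_charge (nu : {charge set (borel (X * Z)%type) -> \bar R})
    (A : set (borel X)) (mA : measurable A) : set (borel Z) -> \bar R :=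
  fun B => nu (A `*` B).

Section slice_charge.
Variables (nu : {charge set (borel (X * Z)%type) -> \bar R}).
Variables (A : set (borel X)) (mA : measurable A).

Let slice0 : slice_charge nu mA set0 = 0%E.
Proof. by rewrite /slice_charge setX0 charge0. Qed.

Let slice_fin B : measurable B -> slice_charge nu mA B \is a fin_num.
Proof. by move=> mB; apply: fin_num_measure; exact: borel_setX. Qed.

Let slice_sigma_additive : semi_sigma_additive (slice_charge nu mA).
Proof.
move=> F mF tF mUF; rewrite /slice_charge.
have -> : A `*` (\bigcup_n F n) = \bigcup_n (A `*` F n).
  by apply/seteqP; split=> [[x z] [/= Ax [n _ Fz]]|[x z] [n _ [/= Ax Fz]]];
    [exists n | split => //; exists n].
apply: charge_semi_sigma_additive.
- by move=> n; exact: borel_setX.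
- apply/trivIsetP => i j _ _ ij.
  move/trivIsetP : tF => /(_ i j Logic.I Logic.I ij) Fij.
  rewrite -subset0 => -[x z] [[/= _ Fiz] [/= _ Fjz]].
  by have : set0 z by rewrite -Fij.
- by apply: bigcup_measurable => n _; exact: borel_setX.
Qed.

HB.instance Definition _ := isCharge.Build _ _ _ (slice_charge nu mA)
  slice0 slice_fin slice_sigma_additive.

End slice_charge.

(* lam_A(B) := lam(A * B) *)
Definition slice (lam : cmeasure (borel (X * Z)%type) R) (A : set (borel X))
    (mA : measurable A) : cmeasure (borel Z) R :=
  CMeasure (slice_charge (cm_re lam) mA) (slice_charge (cm_im lam) mA).

End product.

(* Main.v *)
(** For a Radon measure [lam] and a bounded continuous positive definite kernel
    [K], cutting a large compact set into finitely many Borel pieces on which [K]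
    varies little turns the double integral of [K] into a Gram form, and the
    Cauchy-Schwarz inequality shows that it vanishes iff
    [\int K(x, y) d lam(x) = 0] for all [y]. For [p (x) q] this says that, for
    every [v], the measure [nu_v (A) = \int_(A * Z) q(u, v) d lam(x, u)] satisfies
    [\int p(x, y) d nu_v(x) = 0] for all [y]. If [p] is SPD, universal or ISPD this
    forces [nu_v = 0], and [nu_v (A)] is the integral of [q(., v)] against the slice
    [lam_A]; so all [nu_v] vanish iff all double integrals of [q] against slices do.
    For universality of the tensor kernel, bump functions built from the kernels
    give partitions of unity made of finite sums of products. *)
From HB Require Import structures.
From mathcomp Require Import all_boot all_order all_algebra.
From mathcomp Require Import complex.
From mathcomp Require Import all_classical all_reals all_analysis.
From mathcomp Require Import measurable_realfun.
From mathcomp Require Import ring lra.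
Require Import Defs.

Set Implicit Arguments.
Unset Strict Implicit.
Unset Printing Implicit Defensive.

Import Order.TTheory GRing.Theory Num.Theory.
Import numFieldNormedType.Exports.

Local Open Scope classical_set_scope.
Local Open Scope ring_scope.

(** Integrals against two measures are never interchanged; the only swaps are of an integral with a
    finite sum, which is why double integrals are reduced to Gram forms. Identities between
    integrals come from [cintegral_unique], which compares linear functionals that agree on
    indicators and are bounded in the sup norm. Estimates use [mass], the sum of the variations of
    the real and imaginary parts: it is a genuine measure, comparable with the partition-based
    [total_variation], and tightness with respect to it carries regularity over to slices and image
    measures. Duality is avoided. For universal kernels only the passage from density of the span to
    vanishing of measures is proved ([span_dense_null]), so universality of the tensor kernel is not
    read off the equivalence on measures but obtained by direct approximation. Since membership in
    [rkhs] means existence of a suitable space, combinations of sections are known to lie in it only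
    after the Moore-Aronszajn construction. *)

Local Notation "x %:C" := (real_complex _ x) (format "x %:C") : ring_scope.

(** * Modulus and topology of the complex numbers *)

Section modulus.
Context (R : realType).
Local Notation C := (Cplx R).
Implicit Types z w : C.

Lemma normE z : `|z| = (cabs z)%:C :> C.
Proof. by case: z. Qed.

Lemma complexD (a b : R) : ((a + b)%:C : C) = a%:C + b%:C.
Proof. exact: rmorphD. Qed.

Lemma complexN (a : R) : ((- a)%:C : C) = - a%:C.
Proof. exact: rmorphN. Qed.

Lemma complexM (a b : R) : ((a * b)%:C : C) = a%:C * b%:C.
Proof. exact: rmorphM. Qed.

Lemma conjCD z w : (z + w)^* = z^* + w^*.
Proof. exact: rmorphD. Qed.

Lemma conjCM z w : (z * w)^* = z^* * w^*.
Proof. exact: rmorphM. Qed.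

Lemma conjCN z : (- z)^* = - z^*.
Proof. exact: rmorphN. Qed.

Lemma conjC_real (a : R) : (a%:C : C)^* = a%:C.
Proof. by apply/eqP; rewrite eq_complex /= oppr0 !eqxx. Qed.

Lemma cabs_ge0 z : 0 <= cabs z.
Proof. by case: z => a b; exact: sqrtr_ge0. Qed.

Lemma cabsD z w : cabs (z + w) <= cabs z + cabs w.
Proof. by rewrite -lecR rmorphD/= -!normE ler_normD. Qed.

Lemma cabsM z w : cabs (z * w) = cabs z * cabs w.
Proof. exact: ComplexField.Normc.normcM. Qed.

Lemma cabsN z : cabs (- z) = cabs z.
Proof. by apply: complexI; rewrite -!normE normrN. Qed.

Lemma cabsBC z w : cabs (z - w) = cabs (w - z).
Proof. by rewrite -cabsN opprB. Qed.

Lemma cabs0 : cabs (0 : C) = 0.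
Proof. by apply: complexI; rewrite -normE normr0. Qed.

Lemma cabs1 : cabs (1 : C) = 1.
Proof. by apply: complexI; rewrite -normE normr1. Qed.

Lemma cabs_conj z : cabs z^* = cabs z.
Proof. by apply: complexI; rewrite -!normE norm_conjC. Qed.

Lemma cabs_real (a : R) : cabs (a%:C : C) = `|a|.
Proof. by rewrite /cabs /= expr0n addr0 sqrtr_sqr. Qed.

Lemma cabs_eq0 z : cabs z = 0 -> z = 0.
Proof. by move=> h; apply/eqP; rewrite -normr_eq0 normE h. Qed.

Lemma cabsB_trans w z t : cabs (z - t) <= cabs (z - w) + cabs (w - t).
Proof. by rewrite -[z - t](subrKA w); exact: cabsD. Qed.

Lemma cabs_sum (I : Type) (r : seq I) (P : pred I) (F : I -> C) :
  cabs (\sum_(i <- r | P i) F i) <= \sum_(i <- r | P i) cabs (F i).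
Proof.
elim/big_rec2: _ => [|i y1 y2 _ h]; first by rewrite cabs0.
by apply: le_trans (cabsD _ _) _; rewrite lerD2l.
Qed.

Lemma le_Re_cabs z : `|complex.Re z| <= cabs z.
Proof.
by case: z => a b; rewrite /cabs /= -sqrtr_sqr ler_wsqrtr // lerDl sqr_ge0.
Qed.

Lemma le_Im_cabs z : `|complex.Im z| <= cabs z.
Proof.
by case: z => a b; rewrite /cabs /= -sqrtr_sqr ler_wsqrtr // lerDr sqr_ge0.
Qed.

Lemma complex_split z : z = (complex.Re z)%:C + 'i * (complex.Im z)%:C.
Proof. by case: z => a b; apply/eqP; rewrite eq_complex /=; apply/andP; split; apply/eqP; ring. Qed.

Lemma cabs_le_ReIm z : cabs z <= `|complex.Re z| + `|complex.Im z|.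
Proof.
rewrite {1}(complex_split z); apply: le_trans (cabsD _ _) _.
by rewrite cabsM !cabs_real /cabs /= expr0n /= add0r expr1n sqrtr1 mul1r.
Qed.

Lemma cabs_sqr z : ((cabs z ^+ 2)%:C : C) = z * z^*.
Proof. by rewrite -normCK normE rmorphXn. Qed.

Lemma complex_ge0E z : 0 <= z -> z = (complex.Re z)%:C.
Proof. by case: z => a b; rewrite lecE /= => /andP[/eqP -> _]. Qed.

Lemma Re_ge0 z : 0 <= z -> 0 <= complex.Re z.
Proof. by case: z => a b; rewrite lecE /= => /andP[_]. Qed.

Lemma real_complex_ge0 (a : R) : ((0 : C) <= a%:C) = (0 <= a).
Proof. by rewrite -lecR. Qed.

Lemma cabs_small0 z : (forall e : R, 0 < e -> cabs z <= e) -> z = 0.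
Proof.
move=> h; apply: cabs_eq0; apply/eqP; rewrite eq_le cabs_ge0 andbT.
by apply/ler_addgt0Pr => e e0; rewrite add0r; exact: h.
Qed.

End modulus.

Section complex_topology.
Context (R : realType).
Local Notation C := (Cplx R).

(** The norm on [Cplx R] is complex-valued, so the epsilons of its topology are positive complex
    numbers. These are real, which leads back to [cabs] and real epsilons. *)
Lemma complex_cvgP (T : Type) (F : set_system T) (f : T -> C) (l : C) :
  Filter F ->
  f @ F --> l <-> forall e : R, 0 < e -> \forall x \near F, cabs (f x - l) < e.
Proof.
move=> FF; split.
  move=> /cvgrPdist_lt h e e0.
  have e0' : (0 : C) < e%:C by rewrite ltcR.
  move: (h _ e0'); apply: filterS => x.
  by rewrite normE ltcR cabsBC.
move=> h; apply/cvgrPdist_lt => e e0.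
have ee : e = (complex.Re e)%:C by apply: complex_ge0E; exact: ltW.
have e0' : 0 < complex.Re e by rewrite -ltcR -ee.
move: (h _ e0'); apply: filterS => x.
by rewrite normE ee ltcR cabsBC.
Qed.

End complex_topology.

(** * Integration against complex measures *)

Section charge_integral.
Context d (T : measurableType d) (R : realType).
Implicit Types (nu : {charge set T -> \bar R}) (f g : T -> R).

(** All charges here are finite, so such functions are integrable against every one of them, and
    they are stable under sums and products. *)
Definition bounded_measurable f :=
  measurable_fun setT f /\ exists b, forall x, `|f x| <= b.

Lemma bounded_measurable_integrable (m : {measure set T -> \bar R}) f :
  (m setT < +oo)%E -> bounded_measurable f -> m.-integrable setT (EFin \o f).
Proof.
move=> mfin [mf [b fb]]; apply: measurable_bounded_integrable => //.
exists b; split; first exact: num_real.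
by move=> x bx y _; apply: le_trans (fb y) (ltW bx).
Qed.

Lemma bounded_measurable_cst a : bounded_measurable (fun=> a).
Proof. by split; [exact: measurable_cst|exists `|a|]. Qed.

Lemma bounded_measurableD f g : bounded_measurable f -> bounded_measurable g ->
  bounded_measurable (fun x => f x + g x).
Proof.
move=> [mf [a fa]] [mg [b gb]]; split; first exact: measurable_funD.
by exists (a + b) => x; apply: le_trans (ler_normD _ _) (lerD _ _).
Qed.

Lemma bounded_measurableM f g : bounded_measurable f -> bounded_measurable g ->
  bounded_measurable (fun x => f x * g x).
Proof.
move=> [mf [a fa]] [mg [b gb]]; split; first exact: measurable_funM.
by exists (a * b) => x; rewrite normrM ler_pM.
Qed.

Lemma bounded_measurable_indic (E : set T) : measurable E ->
  bounded_measurable (\1_E : T -> R).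
Proof.
move=> mE; split; first exact: measurable_indic.
by exists 1 => x; rewrite indicE; case: (_ \in _); rewrite ?normr1 ?normr0.
Qed.

Lemma bounded_measurable_norm f : bounded_measurable f ->
  bounded_measurable (fun x => `|f x|).
Proof.
move=> [mf [a fa]]; split; first exact: measurableT_comp.
by exists a => x; rewrite normr_id.
Qed.

(** The shape of most later estimates: the integrand is at most [a], except on a set [E] of small
    mass where only a crude bound is at hand. *)
Lemma Rintegral_bound (m : {measure set T -> \bar R}) f a b (E : set T) :
  (m setT < +oo)%E -> bounded_measurable f -> measurable E ->
  (forall x, `|f x| <= a + b * \1_E x) ->
  `|\int[m]_x f x| <= a * fine (m setT) + b * fine (m E).
Proof.
move=> mfin bf mE fab.
have bE := bounded_measurable_indic mE.
have bbE := bounded_measurableM (bounded_measurable_cst b) bE.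
have bI := @bounded_measurable_integrable m.
apply: le_trans (le_normr_Rintegral measurableT (bI _ mfin bf)) _.
have bn := bI _ mfin (bounded_measurable_norm bf).
have bd := bI _ mfin (bounded_measurableD (bounded_measurable_cst a) bbE).
apply: le_trans (le_Rintegral measurableT bn bd (fun x _ => fab x)) _.
rewrite RintegralD ?RintegralZl //; [|exact: bI|
  exact: bI (bounded_measurable_cst a)|exact: bI].
by rewrite Rintegral_cst // /Rintegral integral_indic // setIT.
Qed.

Lemma jordan_fin nu : ((jordan_pos (svalP (hahn_sets nu))) setT < +oo)%E /\
  ((jordan_neg (svalP (hahn_sets nu))) setT < +oo)%E.
Proof. by split; rewrite -ge0_fin_numE // fin_num_measure. Qed.

Lemma charge_integralD nu f g : bounded_measurable f -> bounded_measurable g ->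
  charge_integral nu (fun x => f x + g x) =
  charge_integral nu f + charge_integral nu g.
Proof.
move=> bf bg; have [h1 h2] := jordan_fin nu.
rewrite /charge_integral !RintegralD //; try exact: bounded_measurable_integrable.
by ring.
Qed.

Lemma charge_integralZ nu a f : bounded_measurable f ->
  charge_integral nu (fun x => a * f x) = a * charge_integral nu f.
Proof.
move=> bf; have [h1 h2] := jordan_fin nu.
rewrite /charge_integral !RintegralZl //; try exact: bounded_measurable_integrable.
by ring.
Qed.

Lemma charge_integral_indic nu (E : set T) : measurable E ->
  charge_integral nu \1_E = fine (nu E).
Proof.
move=> mE; rewrite /charge_integral /Rintegral !integral_indic // setIT.
rewrite [in RHS](jordan_decomp (svalP (hahn_sets nu)) mE).
rewrite [cadd _ _ _](_ : _ = jordan_pos (svalP (hahn_sets nu)) E -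
  jordan_neg (svalP (hahn_sets nu)) E)%E; last first.
  rewrite /cadd /=; congr (_ + _)%E.
  by rewrite /cscale EFinN mulN1e.
by rewrite fineB ?fin_num_measure.
Qed.

Lemma charge_integral_bound nu f a b (E : set T) :
  bounded_measurable f -> measurable E ->
  (forall x, `|f x| <= a + b * \1_E x) ->
  `|charge_integral nu f| <=
  a * fine (charge_variation (svalP (hahn_sets nu)) setT) +
  b * fine (charge_variation (svalP (hahn_sets nu)) E).
Proof.
move=> bf mE fab; have [h1 h2] := jordan_fin nu.
rewrite /charge_variation !fineD ?fin_num_measure //.
apply: le_trans (ler_normB _ _) _.
rewrite !mulrDr addrACA; apply: lerD; exact: Rintegral_bound.
Qed.

End charge_integral.

(** * A finite measure dominating a complex measure *)

Section mass.
Context d (T : measurableType d) (R : realType).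
Implicit Types (lam : cmeasure T R).

(** Larger than the total variation by a factor of at most 4, but with countable additivity at once,
    as a sum of four Jordan parts. *)
Definition mass lam : {measure set T -> \bar R} :=
  measure_add (charge_variation (svalP (hahn_sets (cm_re lam))))
              (charge_variation (svalP (hahn_sets (cm_im lam)))).

Definition massr lam (E : set T) : R := fine (mass lam E).

Lemma massE lam E : mass lam E =
  (charge_variation (svalP (hahn_sets (cm_re lam))) E +
   charge_variation (svalP (hahn_sets (cm_im lam))) E)%E.
Proof. exact: measure_addE. Qed.

Lemma mass_fin_num lam E : measurable E -> mass lam E \is a fin_num.
Proof. by move=> mE; rewrite massE fin_numD !fin_num_measure. Qed.

Lemma EFin_massr lam E : measurable E -> (massr lam E)%:E = mass lam E.
Proof. by move=> mE; rewrite fineK // mass_fin_num. Qed.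

Lemma massrE lam E : measurable E -> massr lam E =
  fine (charge_variation (svalP (hahn_sets (cm_re lam))) E) +
  fine (charge_variation (svalP (hahn_sets (cm_im lam))) E).
Proof. by move=> mE; rewrite /massr massE fineD ?fin_num_measure. Qed.

Lemma massr_ge0 lam E : 0 <= massr lam E.
Proof. by rewrite fine_ge0. Qed.

Lemma le_massr lam A B : measurable A -> measurable B -> A `<=` B ->
  massr lam A <= massr lam B.
Proof.
by move=> mA mB AB; rewrite -lee_fin !EFin_massr // le_measure // inE.
Qed.

Lemma massrD lam A B : measurable A -> measurable B ->
  massr lam (A `&` B) + massr lam (A `\` B) = massr lam A.
Proof.
move=> mA mB; apply: EFin_inj.
have mAB := measurableI _ _ mA mB; have mD := measurableD mA mB.
rewrite EFinD !EFin_massr // -measureU //; first by rewrite setUIDK.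
by rewrite -subset0 => x [[_ Bx] [_ nBx]].
Qed.

Lemma le_cm_val_massr lam E : measurable E ->
  cabs (cm_val lam E) <= massr lam E.
Proof.
move=> mE; apply: le_trans (cabs_le_ReIm _) _; rewrite massrE //=.
apply: lerD; rewrite -lee_fin fineK ?fin_num_measure // -fine_abse
  ?fin_num_measure // fineK ?abse_fin_num ?fin_num_measure //;
  exact: abse_charge_variation.
Qed.

Lemma cm_val0 lam : cm_val lam set0 = 0.
Proof. by rewrite /cm_val !charge0. Qed.

Lemma cm_valU lam A B : measurable A -> measurable B -> A `&` B = set0 ->
  cm_val lam (A `|` B) = cm_val lam A + cm_val lam B.
Proof.
by move=> mA mB AB; rewrite /cm_val !chargeU // !fineD ?fin_num_measure.
Qed.

Lemma cm_valDI lam A B : measurable A -> measurable B ->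
  cm_val lam A = cm_val lam (A `\` B) + cm_val lam (A `&` B).
Proof.
move=> mA mB; rewrite -cm_valU; [|exact: measurableD|exact: measurableI|].
- by rewrite setUC setUIDK.
- by rewrite -subset0 => x [[_ nBx] [_ Bx]].
Qed.

End mass.

(** * Integrals of bounded complex functions *)

Section cintegral.
Context d (T : measurableType d) (R : realType).
Local Notation C := (Cplx R).
Implicit Types (lam : cmeasure T R) (f g : T -> C).

Definition bmeas f :=
  bounded_measurable (fun x => complex.Re (f x)) /\
  bounded_measurable (fun x => complex.Im (f x)).

Lemma bmeas_bounded f : bmeas f ->
  exists2 b : R, 0 <= b & forall x, cabs (f x) <= b.
Proof.
move=> [[_ [a fa]] [_ [b fb]]].
have ab x : cabs (f x) <= a + b.
  by apply: le_trans (cabs_le_ReIm _) _; exact: lerD.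
by exists (a + b) => //; apply: le_trans (ab point); exact: cabs_ge0.
Qed.

Lemma bmeas_cst (a : C) : bmeas (fun=> a).
Proof. by split; exact: bounded_measurable_cst. Qed.

Lemma bmeasD f g : bmeas f -> bmeas g -> bmeas (fun x => f x + g x).
Proof.
move=> [a b] [c e]; split.
- under eq_fun do rewrite raddfD /=; exact: bounded_measurableD.
- under eq_fun do rewrite raddfD /=; exact: bounded_measurableD.
Qed.

Lemma bmeasM f g : bmeas f -> bmeas g -> bmeas (fun x => f x * g x).
Proof.
have N (h : T -> R) : bounded_measurable h -> bounded_measurable (fun x : T => - h x).
  move=> bh; have := bounded_measurableM (bounded_measurable_cst T (-1 : R)) bh.
  by under eq_fun do rewrite mulN1r.
move=> [a b] [c e]; split.
- rewrite (_ : (fun x => _) = (fun x => complex.Re (f x) * complex.Re (g x) +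
    - (complex.Im (f x) * complex.Im (g x)))); last first.
    by apply/funext => x; case: (f x) (g x) => ? ? [].
  by apply: bounded_measurableD; [|apply: N]; exact: bounded_measurableM.
- rewrite (_ : (fun x => _) = (fun x => complex.Re (f x) * complex.Im (g x) +
    complex.Im (f x) * complex.Re (g x))); last first.
    by apply/funext => x; case: (f x) (g x) => ? ? [].
  by apply: bounded_measurableD; exact: bounded_measurableM.
Qed.

Lemma bmeas_conj f : bmeas f -> bmeas (fun x => (f x)^*).
Proof.
move=> [a b]; split.
  by rewrite (_ : (fun x => _) = (fun x => complex.Re (f x))) //; apply/funext => x; case: (f x).
rewrite (_ : (fun x => _) = (fun x => -1 * complex.Im (f x))).
  by apply: bounded_measurableM => //; exact: bounded_measurable_cst.
by apply/funext => x; case: (f x) => u v /=; rewrite mulN1r.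
Qed.

Lemma bmeas_real (u : T -> R) : bounded_measurable u ->
  bmeas (fun x => (u x)%:C).
Proof. by move=> bu; split => //=; exact: bounded_measurable_cst. Qed.

Lemma indic_real (E : set T) x : \1_E x = (\1_E x : R)%:C :> C.
Proof. by rewrite !indicE; case: (_ \in _). Qed.

Lemma bmeas_indic (E : set T) : measurable E -> bmeas (\1_E : T -> C).
Proof.
move=> mE; rewrite (_ : \1_E = (fun x => (\1_E x : R)%:C)); last first.
  by apply/funext => x; exact: indic_real.
exact/bmeas_real/bounded_measurable_indic.
Qed.

Lemma bmeas_sum (I : eqType) (r : seq I) (F : I -> T -> C) :
  (forall i, i \in r -> bmeas (F i)) -> bmeas (fun x => \sum_(i <- r) F i x).
Proof.
elim: r => [_|i r IH bF].
  by under eq_fun do rewrite big_nil; exact: bmeas_cst.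
under eq_fun do rewrite big_cons; apply: bmeasD; first exact: bF (mem_head _ _).
by apply: IH => j jr; apply: bF; rewrite inE jr orbT.
Qed.

Lemma cintegral_lin lam (a : C) f g : bmeas f -> bmeas g ->
  cintegral lam (fun x => a * f x + g x) = a * cintegral lam f + cintegral lam g.
Proof.
case: a => a1 a2 [f1 f2] [g1 g2]; rewrite /cintegral.
have -> : (fun x => complex.Re ((Complex a1 a2 : C) * f x + g x)) =
   (fun x => (a1 * complex.Re (f x) + (- a2) * complex.Im (f x)) + complex.Re (g x)).
  by apply/funext => x; case: (f x) (g x) => ? ? [? ?] /=; ring.
have -> : (fun x => complex.Im ((Complex a1 a2 : C) * f x + g x)) =
   (fun x => (a1 * complex.Im (f x) + a2 * complex.Re (f x)) + complex.Im (g x)).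
  by apply/funext => x; case: (f x) (g x) => ? ? [? ?] /=; ring.
have B := @bounded_measurableM _ T R; have D := @bounded_measurableD _ T R.
have K := @bounded_measurable_cst _ T R.
rewrite !charge_integralD ?charge_integralZ //; do ?[exact: B|apply: D].
by apply/eqP; rewrite eq_complex /=; apply/andP; split; apply/eqP; ring.
Qed.

Lemma cintegral0 lam : cintegral lam (fun=> 0) = 0.
Proof.
have b0 := bmeas_cst (0 : C).
have := cintegral_lin lam (-1) b0 b0.
under eq_fun do rewrite mulr0 addr0.
by rewrite mulN1r addNr.
Qed.

Lemma cintegralZ lam (a : C) f : bmeas f ->
  cintegral lam (fun x => a * f x) = a * cintegral lam f.
Proof.
move=> bf; have := cintegral_lin lam a bf (bmeas_cst 0).
by rewrite cintegral0 addr0 => <-; under [in RHS]eq_fun do rewrite addr0.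
Qed.

Lemma cintegralD lam f g : bmeas f -> bmeas g ->
  cintegral lam (fun x => f x + g x) = cintegral lam f + cintegral lam g.
Proof.
move=> bf bg; have := cintegral_lin lam 1 bf bg; rewrite mul1r => <-.
by under [in RHS]eq_fun do rewrite mul1r.
Qed.

Lemma cintegralB lam f g : bmeas f -> bmeas g ->
  cintegral lam (fun x => f x - g x) = cintegral lam f - cintegral lam g.
Proof.
move=> bf bg; have := cintegral_lin lam (-1) bg bf.
rewrite mulN1r addrC => <-.
by congr cintegral; apply/funext => x; rewrite mulN1r addrC.
Qed.

Lemma cintegral_sum lam (I : eqType) (r : seq I) (F : I -> T -> C) :
  (forall i, i \in r -> bmeas (F i)) ->
  cintegral lam (fun x => \sum_(i <- r) F i x) =
  \sum_(i <- r) cintegral lam (F i).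
Proof.
elim: r => [_|i r IH bF].
  by rewrite big_nil -[RHS](cintegral0 lam); under eq_fun do rewrite big_nil.
have bF' j : j \in r -> bmeas (F j) by move=> jr; apply: bF; rewrite inE jr orbT.
rewrite big_cons -(IH bF') -cintegralD; last exact: bmeas_sum.
  by under eq_fun do rewrite big_cons.
exact: bF (mem_head _ _).
Qed.

Lemma cintegral_indic lam (E : set T) : measurable E ->
  cintegral lam \1_E = cm_val lam E.
Proof.
move=> mE; rewrite /cintegral.
have -> : (fun x => complex.Re (\1_E x : C)) = \1_E.
  by apply/funext => x; rewrite indic_real.
have -> : (fun x => complex.Im (\1_E x : C)) = (fun x => 0 * \1_E x).
  by apply/funext => x; rewrite indic_real mul0r.
have bE := @bounded_measurable_indic _ T R _ mE.
by rewrite !charge_integralZ // !charge_integral_indic // !mul0r subr0 add0r.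
Qed.

(** The factor 2 appears because the real and the imaginary part of [f] are each integrated against
    both charges. *)
Lemma cintegral_bound lam f a b (E : set T) : bmeas f -> measurable E ->
  (forall x, cabs (f x) <= a + b * \1_E x) ->
  cabs (cintegral lam f) <= 2 * (a * massr lam setT + b * massr lam E).
Proof.
move=> [f1 f2] mE fab; apply: le_trans (cabs_le_ReIm _) _ => /=.
have r1 x : `|complex.Re (f x)| <= a + b * \1_E x.
  exact: le_trans (le_Re_cabs _) (fab x).
have r2 x : `|complex.Im (f x)| <= a + b * \1_E x.
  exact: le_trans (le_Im_cabs _) (fab x).
have B (nu : {charge set T -> \bar R}) := @charge_integral_bound _ _ _ nu _ a b E.
apply: le_trans (lerD (ler_normB _ _) (ler_normD _ _)) _.
apply: le_trans (lerD (lerD (B _ _ f1 mE r1) (B _ _ f2 mE r2))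
                      (lerD (B _ _ f2 mE r2) (B _ _ f1 mE r1))) _.
rewrite !massrE //; lra.
Qed.

Lemma cintegral_sup lam f b : bmeas f -> (forall x, cabs (f x) <= b) ->
  cabs (cintegral lam f) <= 2 * b * massr lam setT.
Proof.
move=> bf fb.
have := @cintegral_bound lam f b 0 set0 bf measurable0.
by rewrite mul0r addr0 mulrA; apply => x; rewrite mul0r addr0.
Qed.

(* Halving: a function bounded by [b] differs by a combination of two
   indicators from one bounded by [b / 2], so [L] is bounded by [c * b / 2^n]. *)
Lemma bmeas_functional_eq0 (L : (T -> C) -> C) (c : R) :
  (forall a f g, bmeas f -> bmeas g ->
    L (fun x => a * f x + g x) = a * L f + L g) ->
  (forall E, measurable E -> L \1_E = 0) ->
  (forall f (b : R), bmeas f -> 0 <= b -> (forall x, cabs (f x) <= b) ->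
    cabs (L f) <= c * b) ->
  forall f, bmeas f -> L f = 0.
Proof.
move=> Llin Lind Lb.
have real n (u : T -> R) (b : R) : bounded_measurable u -> 0 <= b ->
    (forall x, `|u x| <= b) ->
    cabs (L (fun x => (u x)%:C)) <= c * (b / 2 ^+ n).
  elim: n u b => [|n IH] u b bu b0 ub.
    rewrite expr0 divr1; apply: Lb => //; first exact: bmeas_real.
    by move=> x; rewrite cabs_real.
  have mE : measurable [set x | 0 <= u x].
    rewrite (_ : [set x | _] = u @^-1` `[0, +oo[); last first.
      by apply/seteqP; split => x /=; rewrite in_itv /= andbT.
    by rewrite -[X in measurable X]setTI; apply: bu.1.
  set E := [set x | 0 <= u x] in mE.
  have bE := @bounded_measurable_indic _ T R _ mE.
  (* Moving [u] down by [b / 2] where it is nonnegative and up by [b / 2] elsewhere brings it from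
     [[-b, b]] into [[-b / 2, b / 2]]. *)
  pose w x := (b / 2) + (- b) * \1_E x + u x.
  have bw : bounded_measurable w.
    apply: bounded_measurableD => //; apply: bounded_measurableD.
      exact: bounded_measurable_cst.
    by apply: bounded_measurableM => //; exact: bounded_measurable_cst.
  have wb x : `|w x| <= b / 2.
    rewrite /w indicE; have := ub x; rewrite !ler_norml.
    case: (boolP (x \in E)) => [|]; rewrite ?inE ?notin_setE /E /= => h /andP[h1 h2].
      by rewrite mulr1; apply/andP; split; lra.
    move/negP : h; rewrite -ltNge => h.
    by rewrite mulr0; apply/andP; split; lra.
  have -> : L (fun x => (u x)%:C) = L (fun x => (w x)%:C).
    have -> : (fun x => (w x)%:C) = (fun x => ((b / 2)%:C : C) * \1_setT x +
         ((- b)%:C * \1_E x + (u x)%:C)).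
      apply/funext => x; rewrite indicT mulr1 addrA indic_real.
      by rewrite /w !complexD (complexM (- b)) -complexM.
    rewrite Llin ?Llin ?Lind //; do ?[exact: bmeas_indic|exact: bmeas_real].
    - by rewrite !mulr0 !add0r.
    - apply: bmeasD; last exact: bmeas_real.
      by apply: bmeasM; [exact: bmeas_cst|exact: bmeas_indic].
  apply: le_trans (IH w (b / 2) bw _ wb) _; first lra.
  by rewrite exprS invfM -mulrA.
have real0 (u : T -> R) : bounded_measurable u -> L (fun x => (u x)%:C) = 0.
  move=> bu; have [_ [b ub]] := bu.
  have b0 : 0 <= b by apply: le_trans (ub point).
  apply: cabs_small0 => e e0.
  have c0 : 0 <= `|c| * b by rewrite mulr_ge0.
  pose n := Num.bound (`|c| * b / e).
  have hn : `|c| * b / e < 2 ^+ n.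
    apply: lt_trans (archi_boundP _) _; first by rewrite divr_ge0 // ltW.
    by rewrite -natrX ltr_nat ltn_expl.
  apply: le_trans (real n u b bu b0 ub) _.
  have -> : c * (b / 2 ^+ n) = c * b / 2 ^+ n by rewrite mulrA.
  rewrite ler_pdivrMr ?exprn_gt0 //.
  apply: le_trans (ler_wpM2r b0 (ler_norm c)) _.
  by move: hn; rewrite ltr_pdivrMr // [e * _]mulrC => /ltW.
move=> f [f1 f2].
have -> : f = (fun x => 'i * (complex.Im (f x))%:C + (complex.Re (f x))%:C).
  by apply/funext => x; rewrite addrC; exact: complex_split.
by rewrite Llin ?real0 ?mulr0 ?addr0 //; exact: bmeas_real.
Qed.

(** The difference of both sides is linear, vanishes on indicators and is bounded in the sup norm.
    Conjugation, image measures, discrete measures and slices all get their integral formulas in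
    this way. *)
Lemma cintegral_unique lam (L : (T -> C) -> C) (c : R) :
  (forall a f g, bmeas f -> bmeas g ->
    L (fun x => a * f x + g x) = a * L f + L g) ->
  (forall E, measurable E -> L \1_E = cm_val lam E) ->
  (forall f (b : R), bmeas f -> 0 <= b -> (forall x, cabs (f x) <= b) ->
    cabs (L f) <= c * b) ->
  forall f, bmeas f -> cintegral lam f = L f.
Proof.
move=> Llin Lind Lb f bf; apply/eqP; rewrite -subr_eq0; apply/eqP.
apply: (@bmeas_functional_eq0 (fun f => cintegral lam f - L f)
  (2 * massr lam setT + c)) => // [a g h bg bh|E mE|g b bg b0 gb].
- by rewrite cintegral_lin // Llin //; ring.
- by rewrite cintegral_indic // Lind // subrr.
- apply: le_trans (cabsD _ _) _; rewrite cabsN mulrDl mulrAC.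
  by apply: lerD; [exact: cintegral_sup|exact: Lb].
Qed.

Lemma cintegral_null lam f : cm_null lam -> bmeas f -> cintegral lam f = 0.
Proof.
move=> l0 bf; apply: (@cintegral_unique lam (fun=> 0) 0) => //.
- by move=> *; rewrite mulr0 addr0.
- by move=> E mE; rewrite l0.
- by move=> *; rewrite cabs0 mul0r.
Qed.

Lemma cm_val_conj lam E : measurable E ->
  cm_val (cm_conj lam) E = (cm_val lam E)^*.
Proof. by move=> mE; rewrite /cm_val /= /copp /= fineN. Qed.

Lemma cintegral_conj lam f : bmeas f ->
  cintegral (cm_conj lam) f = (cintegral lam (fun x => (f x)^*))^*.
Proof.
apply: (@cintegral_unique _ (fun f => (cintegral lam (fun x => (f x)^*))^*)
  (2 * massr lam setT)) => [a {}f g bf bg|E mE|{}f b bf b0 fb].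
- rewrite (_ : (fun x => _) = (fun x => a^* * (f x)^* + (g x)^*)); last first.
    by apply/funext => x; rewrite rmorphD rmorphM.
  by rewrite cintegral_lin ?rmorphD ?rmorphM /= ?conjCK //; exact: bmeas_conj.
- rewrite cm_val_conj //; congr (_^*); rewrite -cintegral_indic //.
  congr cintegral; apply/funext => x; rewrite indicE; exact: rmorph_nat.
- rewrite cabs_conj -mulrA [_ * b]mulrC mulrA.
  apply: cintegral_sup; first exact: bmeas_conj.
  by move=> x; rewrite cabs_conj.
Qed.

End cintegral.

(** * Image measures *)

Section charge_of_dominated.
Context d d' (T : measurableType d) (T' : measurableType d') (R : realType).
Variables (m : {measure set T -> \bar R}) (pi : T -> T').
Variables (mpi : measurable_fun setT pi) (mfin : (m setT < +oo)%E).
Variables (N : set T' -> R) (c : R).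
Hypothesis NU : forall A B, measurable A -> measurable B -> A `&` B = set0 ->
  N (A `|` B) = N A + N B.
Hypothesis Nle : forall A, measurable A -> `|N A| <= c * fine (m (pi @^-1` A)).

Let mpre A : measurable A -> measurable (pi @^-1` A).
Proof. by move=> mA; rewrite -[X in measurable X]setTI; exact: mpi. Qed.

Let mpre_fin A : measurable A -> m (pi @^-1` A) \is a fin_num.
Proof.
move=> mA; rewrite ge0_fin_numE //; apply: le_lt_trans mfin.
by apply: le_measure; rewrite ?inE //; exact: mpre.
Qed.

Let N0 : N set0 = 0.
Proof.
have /eqP := NU measurable0 measurable0 (setI0 _).
by rewrite setU0 -subr_eq0 opprD addrA subrr sub0r oppr_eq0 => /eqP.
Qed.

Let tail (F : (set T')^nat) n := \bigcup_(i in [set i | (n <= i)%N]) F i.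

Let additive_tail (M : set T' -> R) (F : (set T')^nat) n :
  (forall A B, measurable A -> measurable B -> A `&` B = set0 ->
    M (A `|` B) = M A + M B) ->
  (forall n, measurable (F n)) -> trivIset setT F ->
  M (\bigcup_n F n) = \sum_(0 <= i < n) M (F i) + M (tail F n).
Proof.
move=> MU mF tF; have mt k : measurable (tail F k).
  by apply: bigcup_measurable => i _.
elim: n => [|n IH].
  by rewrite big_geq // add0r; congr M; apply: eq_bigcupl; split.
rewrite IH big_nat_recr //= -addrA -MU //.
  congr (_ + M _); apply/seteqP; split => [x [i /= ni Fx]|x [Fx|[i /= ni Fx]]].
  - by move: ni; rewrite leq_eqVlt => /predU1P[->|ni]; [left|right; exists i].
  - by exists n => /=.
  - by exists i => //=; exact: ltnW.
rewrite -subset0 => x [Fn [i /= ni Fi]].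
by have := tF n i Logic.I Logic.I (ex_intro _ x (conj Fn Fi)) => e; rewrite e ltnn in ni.
Qed.

(** Finite additivity together with domination by a finite measure gives countable additivity: what
    a partial sum misses is the value on a tail of the union, and the tails have vanishing
    [m]-mass. *)
Lemma charge_of_dominated :
  exists nu : {charge set T' -> \bar R}, forall A, nu A = (N A)%:E.
Proof.
pose nu A := (N A)%:E.
have nu0 : nu set0 = 0%E by rewrite /nu N0.
have nufin A : measurable A -> nu A \is a fin_num by [].
have nus : semi_sigma_additive nu.
  move=> F mF tF mUF.
  rewrite (_ : (fun n => _) = (EFin \o (fun n => \sum_(0 <= i < n) N (F i)))); last first.
    by apply/funext => n /=; rewrite sumEFin.
  apply: cvg_EFin; first by near=> n.
  pose M A := fine (m (pi @^-1` A)).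
  have MU A B : measurable A -> measurable B -> A `&` B = set0 ->
      M (A `|` B) = M A + M B.
    move=> mA mB AB; rewrite /M preimage_setU measureU ?fineD //;
      do ?[exact: mpre|exact: mpre_fin].
    by rewrite -preimage_setI AB preimage_set0.
  have cM : (fun n => \sum_(0 <= i < n) M (F i)) @ \oo --> M (\bigcup_n F n).
    rewrite (_ : (fun n => _) = (fun n => fine (\sum_(0 <= i < n) m (pi @^-1` F i))%E)).
      rewrite /M; apply: fine_cvg; rewrite fineK; last exact: mpre_fin.
      rewrite preimage_bigcup; apply: measure_semi_sigma_additive.
      - by move=> n; exact: mpre.
      - apply/trivIsetP => i j _ _ ij; rewrite -preimage_setI.
        by move/trivIsetP : tF => /(_ _ _ Logic.I Logic.I ij) ->; rewrite preimage_set0.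
      - by rewrite -preimage_bigcup; exact: mpre.
    apply/funext => n; rewrite sum_fine // => i _; exact: mpre_fin.
  (* [c] carries no sign and may be 0, hence the division by [|c| + 1]. *)
  have c0 : 0 <= `|c| + 1 by rewrite addr_ge0.
  apply/cvgrPdist_lt => e e0.
  have e1 : 0 < e / (`|c| + 1) by rewrite divr_gt0 // ltr_wpDl.
  move/cvgrPdist_lt : cM => /(_ _ e1); apply: filterS => n.
  rewrite (additive_tail n MU mF tF) (additive_tail n NU mF tF).
  rewrite addrAC subrr add0r [X in `|X| < e]addrAC subrr add0r => h.
  have mt : measurable (tail F n) by apply: bigcup_measurable => i _.
  apply: le_lt_trans (Nle mt) _.
  have Mt0 : 0 <= M (tail F n) by rewrite fine_ge0.
  move: h; rewrite ger0_norm // ltr_pdivlMr ?ltr_wpDl // => h.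
  apply: le_lt_trans h; rewrite mulrC ler_wpM2l //.
  by apply: le_trans (ler_norm c) _; rewrite lerDl.
pose nuM := isCharge.Build _ _ _ nu nu0 nufin nus.
pose nuC : {charge set T' -> \bar R} := HB.pack nu nuM.
by exists nuC.
Unshelve. all: by end_near. Qed.

End charge_of_dominated.

Section image_cmeasure.
Context d d' (T : measurableType d) (T' : measurableType d') (R : realType).
Local Notation C := (Cplx R).
Variables (lam : cmeasure T R) (pi : T -> T') (g : T -> C).
Variables (mpi : measurable_fun setT pi) (bg : bmeas g).

Let mpre A : measurable A -> measurable (pi @^-1` A).
Proof. by move=> mA; rewrite -[X in measurable X]setTI; exact: mpi. Qed.

Lemma bmeas_comp (f : T' -> C) : bmeas f -> bmeas (f \o pi).
Proof.
move=> [[mu [a ua]] [mv [b vb]]]; split; split.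
- exact: measurableT_comp mu mpi.
- by exists a => x; exact: ua.
- exact: measurableT_comp mv mpi.
- by exists b => x; exact: vb.
Qed.

Let image_val (A : set T') := cintegral lam (fun x => g x * \1_A (pi x)).

Let bgA A : measurable A -> bmeas (fun x => g x * \1_A (pi x) : C).
Proof.
by move=> mA; apply: bmeasM => //; apply: bmeas_comp; exact: bmeas_indic.
Qed.

Let image_le b A : (forall x, cabs (g x) <= b) ->
  measurable A -> cabs (image_val A) <= 2 * b * massr lam (pi @^-1` A).
Proof.
move=> gb mA.
have := @cintegral_bound _ _ _ lam _ 0 b _ (bgA mA) (mpre mA).
rewrite mul0r add0r mulrA; apply => x; rewrite add0r cabsM !indicE.
have -> : (x \in pi @^-1` A) = (pi x \in A) by apply/idP/idP; rewrite !inE.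
by case: (_ \in A); rewrite ?cabs1 ?cabs0 ?mulr1 ?mulr0.
Qed.

(** The image under [pi] of the measure with density [g] against [lam], its real and imaginary parts
    built separately by [charge_of_dominated]. The last clause is kept because regularity and
    compact support are transferred through it. *)
Lemma image_cmeasure : exists nu : cmeasure T' R,
  [/\ forall A, measurable A ->
        cm_val nu A = cintegral lam (fun x => g x * \1_A (pi x)),
      forall f, bmeas f ->
        cintegral nu f = cintegral lam (fun x => g x * f (pi x)) &
      exists2 c : R, 0 <= c & forall A, measurable A ->
        cabs (cm_val nu A) <= c * massr lam (pi @^-1` A)].
Proof.
have [b b0 gb] := bmeas_bounded bg.
have vU A B : measurable A -> measurable B -> A `&` B = set0 ->
    image_val (A `|` B) = image_val A + image_val B.
  move=> mA mB AB; rewrite /image_val -cintegralD; do ?exact: bgA.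
  congr cintegral; apply/funext => x; rewrite -mulrDr; congr (_ * _).
  rewrite !indicE in_setU.
  case: (boolP (pi x \in A)) (boolP (pi x \in B)) => hA [hB|hB] //=;
    rewrite ?addr0 ?add0r //.
  have : (A `&` B) (pi x) by split; exact: set_mem.
  by rewrite AB.
have lfin : (mass lam setT < +oo)%E by rewrite -ge0_fin_numE // mass_fin_num.
have [nr nrE] := @charge_of_dominated _ _ _ _ _ (mass lam) pi mpi lfin
  (fun A => complex.Re (image_val A)) (2 * b)
  (fun A B mA mB AB => etrans (congr1 _ (vU A B mA mB AB)) (raddfD _ _ _))
  (fun A mA => le_trans (le_Re_cabs _) (image_le gb mA)).
have [ni niE] := @charge_of_dominated _ _ _ _ _ (mass lam) pi mpi lfin
  (fun A => complex.Im (image_val A)) (2 * b)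
  (fun A B mA mB AB => etrans (congr1 _ (vU A B mA mB AB)) (raddfD _ _ _))
  (fun A mA => le_trans (le_Im_cabs _) (image_le gb mA)).
have vE A : cm_val (CMeasure nr ni) A = image_val A.
  by rewrite /cm_val /= nrE niE.
exists (CMeasure nr ni); split=> //.
- apply: (@cintegral_unique _ _ _ _ _ (2 * b * massr lam setT))
    => [a f h bf bh|E mE|f a bf a0 fa].
  + rewrite -cintegral_lin; do ?[exact: bmeasM bg (bmeas_comp _)].
    by congr cintegral; apply/funext => x /=; ring.
  + by rewrite vE.
  + have := @cintegral_sup _ _ _ lam _ (b * a) (bmeasM bg (bmeas_comp bf)).
    rewrite (_ : 2 * b * _ * a = 2 * (b * a) * massr lam setT); last by ring.
    by apply => x; rewrite cabsM; apply: ler_pM; rewrite ?cabs_ge0 //; exact: fa.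
- exists (2 * b); first by rewrite mulr_ge0.
  by move=> A mA; rewrite vE; exact: image_le.
Qed.

End image_cmeasure.

(** * Total variation and Radon measures *)

Section total_variation.
Context d (T : measurableType d) (R : realType).
Implicit Types (lam : cmeasure T R).
Local Open Scope ereal_scope.

Let a lam (F : (set T)^nat) n := (cabs (cm_val lam (F n)))%:E.

Let a_ge0 lam F n : 0 <= a lam F n.
Proof. by rewrite lee_fin cabs_ge0. Qed.

Lemma total_variation_ub lam (E : set T) (F : (set T)^nat) :
  (forall n, measurable (F n)) -> trivIset setT F -> \bigcup_n F n = E ->
  \sum_(0 <= n <oo) (cabs (cm_val lam (F n)))%:E <= total_variation lam E.
Proof. by move=> mF tF FE; apply: ereal_sup_ubound; exists F. Qed.

(** The bound is summed over the cells of a partition of [E]; their preimages partition the preimage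
    of [E], on which [mass] is countably additive. *)
Lemma total_variation_le_dominated d' (T' : measurableType d')
    (nu : cmeasure T' R) lam (pi : T -> T') (c : R) (E : set T') :
  measurable_fun setT pi -> (0 <= c)%R ->
  (forall A, measurable A ->
    (cabs (cm_val nu A) <= c * massr lam (pi @^-1` A))%R) ->
  measurable E -> total_variation nu E <= (c * massr lam (pi @^-1` E))%:E.
Proof.
move=> mpi c0 dom mE.
have mpre A : measurable A -> measurable (pi @^-1` A).
  by move=> mA; rewrite -[X in measurable X]setTI; exact: mpi.
apply: ge_ereal_sup => _ [F [mF tF FE] <-].
apply: (@le_trans _ _ (\sum_(0 <= n <oo) c%:E * mass lam (pi @^-1` (F n)))).
  apply: lee_nneseries => [n _ _|n _]; first by rewrite lee_fin cabs_ge0.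
  by rewrite -EFin_massr; [rewrite lee_fin; exact: dom|exact: mpre].
rewrite nneseriesZl // EFinM EFin_massr ?mpre // -FE preimage_bigcup.
rewrite (@measure_semi_bigcup _ _ _ (mass lam)) //.
- by move=> n; exact: mpre.
- apply/trivIsetP => i j _ _ ij; rewrite -preimage_setI.
  by move/trivIsetP : tF => /(_ _ _ Logic.I Logic.I ij) ->; rewrite preimage_set0.
- by rewrite -preimage_bigcup FE; exact: mpre.
- by rewrite -preimage_bigcup FE; exact: mpre.
Qed.

Lemma total_variation_le_massr lam E : measurable E ->
  total_variation lam E <= (massr lam E)%:E.
Proof.
move=> mE; rewrite -[massr lam E]mul1r.
apply: (total_variation_le_dominated (@measurable_id _ _ setT)) => // A mA.
by rewrite mul1r; exact: le_cm_val_massr.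
Qed.

Lemma cabs_le_total_variation lam A E : measurable A -> measurable E ->
  A `<=` E -> (cabs (cm_val lam A))%:E <= total_variation lam E.
Proof.
move=> mA mE AE.
have AD : A `&` (E `\` A) = set0 by rewrite -subset0 => x [Ax [_ nAx]].
apply: le_trans (@total_variation_ub lam E (bigcup2 A (E `\` A)) _ _ _).
- apply: le_trans (@nneseries_lim_ge R (a lam (bigcup2 A (E `\` A))) xpredT 0 1 _).
    by rewrite big_nat1.
  by [].
- by move=> [|[|n]] //=; exact: measurableD.
- by rewrite -trivIset_bigcup2.
- by rewrite bigcup2E setDUK.
Qed.

Lemma total_variation_ge0 lam E : measurable E -> 0 <= total_variation lam E.
Proof.
move=> mE; apply: le_trans (cabs_le_total_variation lam mE mE _) => //.
by rewrite lee_fin cabs_ge0.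
Qed.

Lemma total_variation_fin_num lam E : measurable E ->
  total_variation lam E \is a fin_num.
Proof.
move=> mE; rewrite ge0_fin_numE ?total_variation_ge0 //.
by apply: le_lt_trans (total_variation_le_massr lam mE) _; exact: ltry.
Qed.

(* Refining a partition of [A] and one of [B] to the interleaved partition of
   the union. *)
Lemma total_variation_superadd lam A B : measurable A -> measurable B ->
  A `&` B = set0 ->
  total_variation lam A + total_variation lam B <= total_variation lam (A `|` B).
Proof.
move=> mA mB AB.
have main F G : (forall n, measurable (F n)) -> trivIset setT F ->
    \bigcup_n F n = A -> (forall n, measurable (G n)) -> trivIset setT G ->
    \bigcup_n G n = B ->
    \sum_(0 <= n <oo) a lam F n + \sum_(0 <= n <oo) a lam G n <=
    total_variation lam (A `|` B).
  move=> mF tF FA mG tG GB.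
  pose H n := if odd n then G n./2 else F n./2.
  have FG i j x : F i x -> G j x -> False.
    move=> Fx Gx; have : (A `&` B) x by split; [rewrite -FA; exists i|rewrite -GB; exists j].
    by rewrite AB.
  have HAB : \bigcup_n H n = A `|` B.
    rewrite -FA -GB; apply/seteqP; split => [x [n _]|x [[n _ Fx]|[n _ Gx]]].
    - by rewrite /H; case: ifPn => _ Hx; [right|left]; exists n./2.
    - by exists n.*2 => //; rewrite /H odd_double doubleK.
    - by exists n.*2.+1 => //; rewrite /H /= odd_double /= uphalf_double.
  have tH : trivIset setT H.
    move=> i j _ _ [x []]; rewrite /H.
    case: ifPn => oi; case: ifPn => oj h1 h2.
    - rewrite -(odd_double_half i) -(odd_double_half j) oi oj.
      by rewrite (tG _ _ Logic.I Logic.I (ex_intro _ x (conj h1 h2))).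
    - by have := FG _ _ _ h2 h1.
    - by have := FG _ _ _ h1 h2.
    - rewrite -(odd_double_half i) -(odd_double_half j) (negbTE oi) (negbTE oj).
      by rewrite (tF _ _ Logic.I Logic.I (ex_intro _ x (conj h1 h2))).
  have mH n : measurable (H n) by rewrite /H; case: ifP.
  apply: le_trans (total_variation_ub lam mH tH HAB).
  rewrite -nneseriesD //.
  apply: lime_le; first by apply: is_cvg_nneseries => n _ _; rewrite adde_ge0.
  apply: nearW => n.
  have -> : \sum_(0 <= i < n) (a lam F i + a lam G i) =
            \sum_(0 <= i < n.*2) a lam H i.
    elim: n => [|n IH]; first by rewrite !big_geq.
    rewrite big_nat_recr //= IH doubleS !big_nat_recr //= -addeA; congr (_ + (_ + _)).
    - by rewrite /a /H odd_double doubleK.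
    - by rewrite /a /H /= odd_double /= uphalf_double.
  exact: nneseries_lim_ge.
(* The two suprema are taken one after the other; moving a summand across the inequality requires it
   to be finite. *)
have finAB := total_variation_fin_num lam (measurableU _ _ mA mB).
have finA := total_variation_fin_num lam mA.
rewrite addeC -leeBrDr //; apply: ge_ereal_sup => _ [G [mG tG GB] <-].
rewrite leeBrDr // addeC.
have Gfin : \sum_(0 <= n <oo) a lam G n \is a fin_num.
  rewrite ge0_fin_numE ?nneseries_ge0 //.
  apply: le_lt_trans (total_variation_ub lam mG tG GB) _.
  by rewrite -ge0_fin_numE ?total_variation_ge0 // total_variation_fin_num.
rewrite -leeBrDr //; apply: ge_ereal_sup => _ [F [mF tF FA] <-].
by rewrite leeBrDr //; exact: main.
Qed.

(** Every cell of a partition of [E] is cut along [A]. *)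
Lemma total_variation_subadd lam A E : measurable A -> measurable E ->
  total_variation lam E <=
  total_variation lam (E `&` A) + total_variation lam (E `\` A).
Proof.
move=> mA mE; apply: ge_ereal_sup => _ [F [mF tF FE] <-].
have tI B : trivIset setT (fun n => F n `&` B).
  by apply: trivIset_setIr.
have mI B : measurable B -> forall n, measurable (F n `&` B).
  by move=> mB n; exact: measurableI.
have UI B : \bigcup_n (F n `&` B) = E `&` B by rewrite -setI_bigcupl FE.
have h1 := total_variation_ub lam (mI _ mA) (tI A) (UI A).
have h2 := total_variation_ub lam (mI _ (measurableC mA)) (tI (~` A)) (UI (~` A)).
rewrite setDE; apply: le_trans (leeD h1 h2).
rewrite -nneseriesD; [|by move=> *; rewrite lee_fin cabs_ge0..].
apply: lee_nneseries => [n _ _|n _]; first by rewrite lee_fin cabs_ge0.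
rewrite -EFinD lee_fin (cm_valDI lam (mF n) mA) -setDE addrC.
exact: cabsD.
Qed.

Lemma le_total_variation lam A E : measurable A -> measurable E -> A `<=` E ->
  total_variation lam A <= total_variation lam E.
Proof.
move=> mA mE AE; have mD := measurableD mE mA.
have AD : A `&` (E `\` A) = set0 by rewrite -subset0 => x [Ax [_ nAx]].
have := total_variation_superadd lam mA mD AD.
rewrite setDUK //.
apply: le_trans; rewrite leeDl //; exact: total_variation_ge0.
Qed.

(** Each of the two charges has a positive and a negative part, and the mass of [E] under such a
    part is, up to sign, the value of the charge on [E] cut with a Hahn set, hence at most the total
    variation. The four parts account for the constant. *)
Lemma massr_le_total_variation lam E : measurable E ->
  (massr lam E)%:E <= 4%:E * total_variation lam E.
Proof.
move=> mE; rewrite -(fineK (total_variation_fin_num lam mE)) -EFinM lee_fin.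
set t := fine _.
have tb A : measurable A -> A `<=` E -> (cabs (cm_val lam A) <= t)%R.
  move=> mA AE; rewrite -lee_fin fineK ?total_variation_fin_num //.
  exact: cabs_le_total_variation.
have half (nu : {charge set T -> \bar R}) :
    (forall A, measurable A -> A `<=` E -> `|fine (nu A)| <= t)%R ->
    (fine (charge_variation (svalP (hahn_sets nu)) E) <= 2 * t)%R.
  move=> nut; have hd := svalP (hahn_sets nu).
  have [[mP _] [mN _] _ _] := hd.
  rewrite /charge_variation fineD ?fin_num_measure // mulrDl mul1r.
  rewrite jordan_posE cjordan_posE jordan_negE cjordan_negE /crestr0 !mem_set //.
  rewrite /crestr fineN; apply: lerD.
    apply: le_trans (ler_norm _) _.
    by apply: nut; [exact: measurableI|exact: subIsetl].
  apply: le_trans (ler_norm _) _; rewrite normrN.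
  by apply: nut; [exact: measurableI|exact: subIsetl].
rewrite massrE // (_ : 4 * t = 2 * t + 2 * t)%R; last by ring.
apply: lerD; apply: half => A mA AE; apply: le_trans (tb _ mA AE).
- exact: (le_Re_cabs (cm_val lam A)).
- exact: (le_Im_cabs (cm_val lam A)).
Qed.

End total_variation.

(** * Finite covers and Borel sets *)

(** The subcover comes as a sequence, on which the later constructions run by induction. *)
Lemma compact_finite_cover (Y : ptopologicalType) (I : choiceType)
    (D : set I) (f : I -> set Y) (A : set Y) :
  compact A -> (forall i, D i -> open (f i)) ->
  (forall x, A x -> exists2 i, D i & f i x) ->
  exists2 s : seq I, (forall i, i \in s -> D i) &
    forall x, A x -> exists2 i, i \in s & f i x.
Proof.
rewrite compact_cover => cA fo fA.
have [|D' D'D AD'] := cA I D f fo; first by move=> x /fA [i Di fx]; exists i.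
exists (finmap.enum_fset D') => [i iD'|x /AD' [i /= iD' fx]]; last by exists i.
by have := D'D i iD'; rewrite in_setE.
Qed.

Section borel.
Context (R : realType).
Implicit Types (Y : ptopologicalType).

Lemma borel_open Y (U : set Y) : open U -> measurable (U : set (borel Y)).
Proof. by move=> oU; exact: sub_sigma_algebra. Qed.

Lemma borel_closed Y (U : set Y) : closed U -> measurable (U : set (borel Y)).
Proof.
move=> cU; rewrite -[U]setCK; apply: measurableC; apply: borel_open.
exact: closed_openC.
Qed.

Lemma borel_compact Y (U : set Y) : hausdorff_space Y -> compact U ->
  measurable (U : set (borel Y)).
Proof. by move=> hY cU; apply: borel_closed; exact: compact_closed. Qed.

Lemma continuous_borel_fun Y Y' (f : Y -> Y') : continuous f ->
  measurable_fun setT (f : borel Y -> borel Y').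
Proof. by move=> cf _ A mA; rewrite setTI; exact: borel_continuous. Qed.

Lemma continuous_borel_real Y (f : Y -> R) : continuous f ->
  measurable_fun setT (f : borel Y -> R).
Proof.
move=> cf; apply: (measurability _ (RGenOInfty.measurableE R)).
move=> _ [_ [a ->] <-]; rewrite setTI; apply: borel_open.
by apply: open_comp => // x _; exact: cf.
Qed.

Lemma continuous_Re Y (f : Y -> Cplx R) : continuous f ->
  continuous (fun y => complex.Re (f y)).
Proof.
move=> cf y; apply/cvgrPdist_lt => e e0.
move/complex_cvgP : (cf y) => /(_ e e0); apply: filterS => x.
by apply: le_lt_trans; rewrite distrC -raddfB; exact: le_Re_cabs.
Qed.

Lemma continuous_Im Y (f : Y -> Cplx R) : continuous f ->
  continuous (fun y => complex.Im (f y)).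
Proof.
move=> cf y; apply/cvgrPdist_lt => e e0.
move/complex_cvgP : (cf y) => /(_ e e0); apply: filterS => x.
by apply: le_lt_trans; rewrite distrC -raddfB; exact: le_Im_cabs.
Qed.

Lemma continuous_bmeas Y (f : Y -> Cplx R) (b : R) : continuous f ->
  (forall y, cabs (f y) <= b) -> bmeas (f : borel Y -> Cplx R).
Proof.
move=> cf fb; split; split.
- exact: continuous_borel_real (continuous_Re cf).
- by exists b => y; exact: le_trans (le_Re_cabs _) (fb y).
- exact: continuous_borel_real (continuous_Im cf).
- by exists b => y; exact: le_trans (le_Im_cabs _) (fb y).
Qed.

End borel.

(** * Tightness, supports and images of Radon measures *)

Section radon.
Context (R : realType).
Implicit Types (Y : ptopologicalType).

(** Inner approximation is enough: a compact set that nearly fills the complement of [E] is closed,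
    and its complement is an open set around [E] with little excess. *)
Lemma radon_of_tight Y (lam : cmeasure (borel Y) R) : hausdorff_space Y ->
  (forall (E : set (borel Y)) (e : R), measurable E -> 0 < e ->
     exists C : set Y, [/\ compact C, C `<=` E &
       (total_variation lam (E `\` C) <= e%:E)%E]) ->
  radon lam.
Proof.
move=> hY tight; split.
  by rewrite -ge0_fin_numE ?total_variation_ge0 // total_variation_fin_num.
move=> E mE; split; apply/eqP; rewrite eq_le; apply/andP; split.
- apply/lee_addgt0Pr => e e0; have [C [cC CE h]] := tight E e mE e0.
  have mC := borel_compact hY cC.
  apply: le_trans (total_variation_subadd lam mC mE) _; apply: leeD => //.
  by apply: ereal_sup_ubound; exists C => //; rewrite setIidr.
- apply: ge_ereal_sup => _ [C [cC CE] <-].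
  by apply: le_total_variation => //; exact: borel_compact.
- apply: le_ereal_inf_tmp => _ [U [oU EU] <-].
  by apply: le_total_variation => //; exact: borel_open.
- apply/lee_addgt0Pr => e e0.
  have [C [cC CE h]] := tight (~` E) e (measurableC mE) e0.
  have oC : open (~` C) by apply: closed_openC; exact: compact_closed.
  have EC : E `<=` ~` C by move=> x Ex /CE.
  have mC := borel_open oC.
  apply: (@le_trans _ _ (total_variation lam (~` C))).
    by apply: ereal_inf_lbound; exists (~` C).
  apply: le_trans (total_variation_subadd lam mE mC) _.
  by rewrite setIidr // leeD2l // setDE setIC -setDE.
Qed.

Lemma radon_tight Y (lam : cmeasure (borel Y) R) (E : set (borel Y)) (e : R) :
  hausdorff_space Y -> radon lam -> measurable E -> 0 < e ->
  exists C : set Y, [/\ compact C, C `<=` E & massr lam (E `\` C) < e].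
Proof.
move=> hY [_ reg] mE e0; have [hsup _] := reg E mE.
have tfin := total_variation_fin_num lam mE.
(* This pays for the factor 4 of [massr_le_total_variation]. *)
have e4 : 0 < e / 4 by rewrite divr_gt0.
have sfin := tfin; rewrite hsup in sfin.
have [_ [C [cC CE] <-]] := ub_ereal_sup_adherent e4 sfin.
rewrite -hsup lteBlDr // => tvC; exists C; split => //.
have mC := borel_compact hY cC; have mD := measurableD mE mC.
have CD : C `&` (E `\` C) = set0 by rewrite -subset0 => x [Cx [_ nCx]].
have := total_variation_superadd lam mC mD CD; rewrite setDUK // => sup.
have := massr_le_total_variation lam mD.
have := total_variation_fin_num lam mC; have := total_variation_fin_num lam mD.
move: tvC sup tfin; rewrite /=.
case: (total_variation lam C) (total_variation lam E)
  (total_variation lam (E `\` C)) => [a| |] [b| |] [c| |] //=.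
rewrite -!EFinD -!EFinM !lee_fin lte_fin; lra.
Qed.

(** If a compact [C] exhausts the preimage of [E] up to small mass, its image under [pi] is compact
    and exhausts [E] up to small variation of [nu]. *)
Lemma radon_dominated Y Y' (pi : Y -> Y') (c : R)
    (lam : cmeasure (borel Y) R) (nu : cmeasure (borel Y') R) :
  hausdorff_space Y -> hausdorff_space Y' -> continuous pi -> 0 <= c ->
  (forall A : set (borel Y'), measurable A ->
    cabs (cm_val nu A) <= c * massr lam (pi @^-1` A)) ->
  radon lam -> radon nu.
Proof.
move=> hY hY' cpi c0 dom rl; apply: radon_of_tight => // E e mE e0.
have c1 : 0 < c + 1 by rewrite ltr_wpDl.
have e1 : 0 < e / (c + 1) by rewrite divr_gt0.
have mpE : measurable (pi @^-1` E : set (borel Y)) by exact: borel_continuous.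
have [C [cC CE mC]] := radon_tight hY rl mpE e1.
have cpC : compact (pi @` C).
  by apply: continuous_compact => //; exact: continuous_subspaceT.
have mpC := borel_compact hY' cpC.
exists (pi @` C); split => //; first by move=> _ [x Cx <-]; exact: CE.
have mD := measurableD mE mpC.
apply: le_trans (total_variation_le_dominated (continuous_borel_fun cpi) c0 dom mD) _.
rewrite lee_fin.
have : massr lam (pi @^-1` (E `\` pi @` C)) <= e / (c + 1).
  apply: le_trans (ltW mC); apply: le_massr.
  - exact: borel_continuous.
  - by apply: measurableD => //; exact: borel_compact.
  - by move=> x [Ex nx]; split => // Cx; apply: nx; exists x.
move=> h; apply: le_trans (ler_wpM2l c0 h) _.
rewrite mulrA ler_pdivrMr // mulrC ler_wpM2l ?ltW //; lra.
Qed.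

Lemma support_closed Y (lam : cmeasure (borel Y) R) : closed (support lam).
Proof.
rewrite -[support lam]setCK; apply: open_closedC; rewrite openE => y.
move=> /existsNP [U /not_implyP [oU /not_implyP [Uy nU]]].
have : nbhs y U by exact: open_nbhs_nbhs.
apply: filterS => x Ux.
by apply/existsNP; exists U; apply/not_implyP; split => //; apply/not_implyP.
Qed.

Lemma massr_null_cover Y (lam : cmeasure (borel Y) R) (s : seq (set Y))
    (E : set (borel Y)) :
  (forall U, U \in s -> open U /\ massr lam U = 0) -> measurable E ->
  (forall x, E x -> exists2 U, U \in s & U x) -> massr lam E = 0.
Proof.
elim: s E => [|U s IH] E sU mE Es.
  rewrite (_ : E = set0) ?massrE ?measure0 ?addr0 //.
  by rewrite -subset0 => x /Es [].
have [oU U0] := sU U (mem_head _ _); have mU := borel_open oU.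
rewrite -(massrD lam mE mU) (IH (E `\` U)) ?addr0.
- apply/eqP; rewrite eq_le massr_ge0 andbT -U0; apply: le_massr => //.
  exact: measurableI.
- by move=> V Vs; apply: sU; rewrite inE Vs orbT.
- exact: measurableD.
- move=> x [/Es [V]]; rewrite inE => /predU1P[->//|Vs Vx _]; by exists V.
Qed.

(** Inner regularity is what makes this hold: a union of arbitrarily many null open sets is handled
    through its compact subsets, each covered by finitely many of them. *)
Lemma massr_setC_support Y (lam : cmeasure (borel Y) R) :
  hausdorff_space Y -> radon lam -> massr lam (~` support lam) = 0.
Proof.
move=> hY rl; have oS := closed_openC (@support_closed _ lam).
have mS := borel_open oS; apply/eqP; rewrite eq_le massr_ge0 andbT.
apply/ler_addgt0Pr => e e0; rewrite add0r.
have [C [cC CS mC]] := radon_tight hY rl mS e0.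
have mC' := borel_compact hY cC.
rewrite -(massrD lam mS mC') (_ : massr lam (_ `&` C) = 0) ?add0r ?ltW //.
rewrite setIidr //.
have [||s sD Cs] := @compact_finite_cover Y (set Y)
  [set U | open U /\ massr lam U = 0] id C cC.
- by move=> U [].
- move=> x /CS /existsNP [U /not_implyP [oU /not_implyP [Ux nU]]].
  exists U => //; split => //; apply/eqP; rewrite eq_le massr_ge0 andbT.
  have mU := borel_open oU.
  rewrite -lee_fin; apply: le_trans (massr_le_total_variation lam mU) _.
  have -> : total_variation lam U = 0%E.
    by apply/eqP; rewrite eq_le total_variation_ge0 // andbT leNgt; apply/negP.
  by rewrite mule0.
exact: (massr_null_cover sD).
Qed.

(** The support of [nu] is closed and lies in the image of the support of [lam], because the
    preimage of the complement of that image is null. *)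
Lemma radon_compact_dominated Y Y' (pi : Y -> Y') (c : R)
    (lam : cmeasure (borel Y) R) (nu : cmeasure (borel Y') R) :
  hausdorff_space Y -> hausdorff_space Y' -> continuous pi -> 0 <= c ->
  (forall A : set (borel Y'), measurable A ->
    cabs (cm_val nu A) <= c * massr lam (pi @^-1` A)) ->
  radon_compact lam -> radon_compact nu.
Proof.
move=> hY hY' cpi c0 dom [rl cl]; split; first exact: (radon_dominated hY hY' cpi c0 dom).
have cS : compact (pi @` support lam).
  by apply: continuous_compact => //; exact: continuous_subspaceT.
apply: (subclosed_compact (@support_closed _ nu) cS) => y ny.
apply: contrapT => nSy.
have oU : open (~` (pi @` support lam)) by apply: closed_openC; exact: compact_closed.
have := ny _ oU nSy; have mU := borel_open oU.
apply/negP; rewrite -leNgt.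
apply: le_trans (total_variation_le_dominated (continuous_borel_fun cpi) c0 dom mU) _.
rewrite lee_fin -(mulr0 c) ler_wpM2l // -(massr_setC_support hY rl).
apply: le_massr.
- exact: borel_continuous.
- by apply: borel_open; apply: closed_openC; exact: support_closed.
- by move=> x nx sx; apply: nx; exists x.
Qed.

(** The finite, hence compact, part of [E] made of atoms carries all of the variation on [E]. *)
Lemma discrete_radon_compact Y (lam : cmeasure (borel Y) R) :
  hausdorff_space Y -> discrete_measure lam -> radon_compact lam.
Proof.
move=> hY [n [c [x lamE]]].
have fF : finite_set (range x) by apply: finite_image; exact: finite_finset.
have cF := finite_compact fF.
have mF := borel_compact hY cF.
have tv0 (E : set (borel Y)) : measurable E -> E `&` range x = set0 ->
    total_variation lam E = 0%E.
  move=> mE Ex; apply/eqP; rewrite eq_le total_variation_ge0 // andbT.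
  apply: ge_ereal_sup => _ [F [mF' tF FE] <-].
  rewrite eseries0 // => i _ _; rewrite lamE // big1 ?cabs0 // => j _.
  rewrite indicE memNset ?mulr0 // => Fx.
  have : (E `&` range x) (x j) by split; [rewrite -FE; exists i|exists j].
  by rewrite Ex.
split.
  apply: radon_of_tight => // E e mE e0.
  have cE : compact (E `&` range x).
    by apply: finite_compact; exact: finite_setIr.
  exists (E `&` range x); split => //.
  rewrite tv0 ?lee_fin ?ltW //; first by apply: measurableD => //; exact: borel_compact.
  by rewrite -subset0 => y [[Ey ny] ry]; apply: ny.
apply: (subclosed_compact (@support_closed _ lam) cF) => y sy.
apply: contrapT => ny; have oU : open (~` range x).
  by apply: closed_openC; exact: compact_closed.
have := sy _ oU ny; rewrite tv0 ?ltxx //; first exact: borel_open.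
by rewrite setICl.
Qed.

End radon.

(** * Positive semidefinite forms *)

Lemma conjC_sum (R : realType) (I : Type) (r : seq I) (P : pred I) (F : I -> Cplx R) :
  (\sum_(i <- r | P i) F i)^* = \sum_(i <- r | P i) (F i)^*.
Proof. exact: rmorph_sum. Qed.

Section combination_form.
Context (R : realType) (Y : choiceType).
Local Notation C := (Cplx R).
Implicit Types (K : Y -> Y -> C) (a b : seq (C * Y)).

(* [a] encodes the function [\sum_i c_i K(., x_i)], and [form] is the inner
   product of two such functions in the reproducing kernel Hilbert space. *)
Definition ev K a (y : Y) : C := \sum_(u <- a) u.1 * K y u.2.

Definition form K a b : C :=
  \sum_(u <- a) \sum_(v <- b) u.1 * (v.1)^* * K v.2 u.2.

Definition scalec (t : C) a := [seq (t * u.1, u.2) | u <- a].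

Definition psd K := forall a, 0 <= form K a a.

Lemma formE K a b : form K a b = \sum_(v <- b) (v.1)^* * ev K a v.2.
Proof.
rewrite /form exchange_big /=; apply: eq_bigr => v _.
by rewrite /ev big_distrr /=; apply: eq_bigr => u _; ring.
Qed.

Lemma ev_cat K a b y : ev K (a ++ b) y = ev K a y + ev K b y.
Proof. exact: big_cat. Qed.

Lemma ev_scale K t a y : ev K (scalec t a) y = t * ev K a y.
Proof.
by rewrite /ev big_map big_distrr /=; apply: eq_bigr => u _; rewrite mulrA.
Qed.

Lemma ev_single K y t : ev K [:: (1, y)] t = K t y.
Proof. by rewrite /ev big_seq1 mul1r. Qed.

Lemma form_catl K a b c : form K (a ++ b) c = form K a c + form K b c.
Proof. exact: big_cat. Qed.

Lemma form_catr K a b c : form K c (a ++ b) = form K c a + form K c b.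
Proof. by rewrite !formE big_cat. Qed.

Lemma form_scalel K t a c : form K (scalec t a) c = t * form K a c.
Proof.
by rewrite !formE big_distrr /=; apply: eq_bigr => u _; rewrite ev_scale; ring.
Qed.

Lemma form_scaler K t a c : form K c (scalec t a) = t^* * form K c a.
Proof.
rewrite !formE big_map big_distrr /=; apply: eq_bigr => u _.
by rewrite rmorphM mulrA.
Qed.

Lemma form_single K a y : form K a [:: (1, y)] = ev K a y.
Proof. by rewrite formE big_seq1 rmorph1 mul1r. Qed.

Lemma form_cst K y : form K [:: (1, y)] [:: (1, y)] = K y y.
Proof. by rewrite form_single ev_single. Qed.

Lemma psd_ge0 K x : psd K -> 0 <= K x x.
Proof. by move=> /(_ [:: (1, x)]); rewrite form_cst. Qed.

(** Positivity makes the form of the combination of [x] and [t] times [y] real for every [t]; the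
    choices [t = 1] and [t = 'i] determine [K y x]. *)
Lemma psd_herm K x y : psd K -> K y x = (K x y)^*.
Proof.
move=> pK.
have real (z : C) : 0 <= z -> z^* = z by move/ger0_real/conj_Creal.
have h t : t * (K y x)^* + t^* * (K x y)^* = t^* * K y x + t * K x y.
  have := real _ (pK ([:: (1, x)] ++ scalec t [:: (1, y)])).
  rewrite !form_catl !form_catr !form_scalel !form_scaler !form_single !ev_single.
  rewrite !conjCD !conjCM !conjCK !(real _ (psd_ge0 _ pK)) => e.
  have -> : t * (K y x)^* + t^* * (K x y)^* =
    (K x x + t * (K y x)^* + (t^* * (K x y)^* + t^* * (t * K y y))) -
    K x x - t^* * (t * K y y) by ring.
  by rewrite e; ring.
have := h 1; have := h 'i; rewrite conjCi rmorph1 !mul1r => e1 e2.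
have e3 : (K y x)^* - (K x y)^* = K x y - K y x.
  by apply: (mulfI (neq0Ci C)); rewrite !mulrBr; move: e1; rewrite !mulNr => ->; ring.
have e4 : 2 * K y x = 2 * (K x y)^*.
  have -> : 2 * (K x y)^* = ((K y x)^* + (K x y)^*) - ((K y x)^* - (K x y)^*) by ring.
  by rewrite e2 e3; ring.
by apply: (mulfI _ e4); rewrite pnatr_eq0.
Qed.

Lemma form_herm K a b : psd K -> form K b a = (form K a b)^*.
Proof.
move=> pK; rewrite /form exchange_big /= conjC_sum; apply: eq_bigr => u _.
rewrite conjC_sum; apply: eq_bigr => v _.
by rewrite !conjCM conjCK -psd_herm //; ring.
Qed.

Definition sqn K a : R := complex.Re (form K a a).

Lemma sqnE K a : psd K -> form K a a = (sqn K a)%:C.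
Proof. by move=> pK; exact: complex_ge0E. Qed.

Lemma sqn_ge0 K a : psd K -> 0 <= sqn K a.
Proof. by move=> pK; exact: Re_ge0. Qed.

(** Here [A] and [D] will be the squared norms of two vectors and [N] the squared modulus of their
    product, so that the quadratic is the squared norm of [a - s <a, b> b]. The value [s = 1 / D]
    minimises it; for [D = 0] it is affine in [s] and takes a negative value as soon as [N > 0]. *)
Lemma quadratic_discr (N A D : R) : 0 <= N -> 0 <= A -> 0 <= D ->
  (forall s, 0 <= A - 2 * s * N + s ^+ 2 * N * D) -> N <= A * D.
Proof.
move=> N0 A0 D0 h; have [D1|D1] := ltP 0 D.
  have := h D^-1.
  have -> : A - 2 * D^-1 * N + D^-1 ^+ 2 * N * D = A - N / D.
    by field; rewrite gt_eqF.
  by rewrite subr_ge0 ler_pdivrMr.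
have D2 : D = 0 by apply/eqP; rewrite eq_le D1.
rewrite D2 mulr0 leNgt; apply/negP => N1.
have := h ((A + 1) / N); rewrite D2 mulr0 addr0.
have -> : A - 2 * ((A + 1) / N) * N = - A - 2 by field; rewrite gt_eqF.
lra.
Qed.

Lemma form_cauchy_schwarz K a b : psd K ->
  cabs (form K a b) ^+ 2 <= sqn K a * sqn K b.
Proof.
move=> pK; apply: quadratic_discr; rewrite ?sqr_ge0 ?sqn_ge0 // => s.
have := pK (a ++ scalec (- s%:C * form K a b) b).
rewrite !form_catl !form_catr !form_scalel !form_scaler (form_herm a b pK).
rewrite !sqnE // conjCM conjCN conjC_real.
set B := form K a b; set z := (X in 0 <= X -> _).
have := cabs_sqr B; move: (cabs B ^+ 2) => N NE.
pose w := sqn K a - s * N - s * N + s * s * N * sqn K b.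
have -> : z = w%:C.
  by rewrite /z /w !(complexD, complexN, complexM) NE; ring.
rewrite real_complex_ge0 (_ : w = sqn K a - 2 * s * N + s ^+ 2 * N * sqn K b) //.
by rewrite /w; ring.
Qed.

Lemma ev_bound K a y : psd K ->
  cabs (ev K a y) ^+ 2 <= sqn K a * complex.Re (K y y).
Proof.
by move=> pK; have := form_cauchy_schwarz a [:: (1, y)] pK;
  rewrite form_single /sqn form_cst.
Qed.

Lemma psd_cauchy_schwarz K x y : psd K ->
  cabs (K x y) ^+ 2 <= complex.Re (K x x) * complex.Re (K y y).
Proof.
by move=> pK; have := ev_bound [:: (1, y)] x pK; rewrite ev_single /sqn form_cst mulrC.
Qed.

(** A point may occur several times in [a], and only the total weight of its occurrences is
    determined by the function. *)
Definition coefc a (y : Y) : C := \sum_(u <- a | u.2 == y) u.1.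

Lemma sum_coefc a (s : seq Y) (F : Y -> C) : uniq s ->
  (forall u, u \in a -> u.2 \in s) ->
  \sum_(u <- a) u.1 * F u.2 = \sum_(y <- s) coefc a y * F y.
Proof.
move=> us; rewrite /coefc; elim: a => [|v a IH] has.
  by rewrite big_nil big1_seq // => y _; rewrite big_nil mul0r.
rewrite big_cons IH => [|u ua]; last by apply: has; rewrite inE ua orbT.
under [RHS]eq_bigr do rewrite big_cons.
have vs : v.2 \in s by apply: has; rewrite mem_head.
rewrite (bigD1_seq v.2) //= [RHS](bigD1_seq v.2) //= eqxx mulrDl addrA.
by congr (_ + _); apply: eq_bigr => y /negPf; rewrite eq_sym => ->.
Qed.

End combination_form.

(** * Forms with repeated points and strict positivity *)

Section positive_definite.
Context (R : realType) (Y : ptopologicalType).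
Local Notation C := (Cplx R).
Implicit Types (K : Y -> Y -> C) (a : seq (C * Y)).

Let inj_tnth (s : seq Y) : uniq s -> injective (tnth (in_tuple s)).
Proof. by move=> us; apply/tuple_uniqP. Qed.

(** [kernel_form] attaches the unconjugated coefficient to the first argument of the kernel, [form]
    to the second; hence the conjugates. *)
Lemma form_coefc K a (s : seq Y) : uniq s -> (forall u, u \in a -> u.2 \in s) ->
  form K a a =
  kernel_form K (tnth (in_tuple s)) (fun i => (coefc a (tnth (in_tuple s) i))^*).
Proof.
move=> us has; rewrite formE /kernel_form.
have -> : \sum_(v <- a) (v.1)^* * ev K a v.2 =
    (\sum_(v <- a) v.1 * (ev K a v.2)^*)^*.
  by rewrite conjC_sum; apply: eq_bigr => v _; rewrite conjCM conjCK.
rewrite (sum_coefc (fun y => (ev K a y)^*) us has) big_tnth conjC_sum.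
apply: eq_bigr => i _; rewrite conjCM conjCK.
rewrite /ev (sum_coefc _ us has) big_tnth big_distrr /=.
by apply: eq_bigr => j _; rewrite conjCK mulrA.
Qed.

Lemma kernel_form_combination K n (x : 'I_n -> Y) (c : 'I_n -> C) :
  kernel_form K x c = form K [seq ((c i)^*, x i) | i <- enum 'I_n]
                             [seq ((c i)^*, x i) | i <- enum 'I_n].
Proof.
rewrite formE big_map big_enum /=; apply: eq_bigr => i _.
rewrite /ev big_map big_enum big_distrr /=; apply: eq_bigr => j _.
by rewrite conjCK mulrA.
Qed.

Lemma positive_definite_psd K : positive_definite K <-> psd K.
Proof.
split=> [pK a|pK n x c _]; last by rewrite kernel_form_combination.
have us := undup_uniq [seq u.2 | u <- a].
rewrite (form_coefc K us); last first.
  by move=> u ua; rewrite mem_undup; apply/mapP; exists u.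
exact: pK (inj_tnth us).
Qed.

Lemma SPD_coefc K a y : SPD K -> form K a a = 0 -> coefc a y = 0.
Proof.
(* Adding [y] to the list also covers points that do not occur in [a]. *)
move=> [_ sK]; have us := undup_uniq (y :: [seq u.2 | u <- a]).
rewrite (form_coefc K us); last first.
  by move=> u ua; rewrite mem_undup inE; apply/orP; right; apply/mapP; exists u.
move/(sK _ _ _ (inj_tnth us)) => h.
have : y \in in_tuple (undup (y :: [seq u.2 | u <- a])).
  by rewrite mem_undup mem_head.
by move/tnthP => [i ->]; rewrite -[LHS]conjCK h conjC0.
Qed.

Lemma SPD_of_coefc K : psd K -> (forall a, form K a a = 0 -> forall y, coefc a y = 0) ->
  SPD K.
Proof.
move=> pK sK; split; first exact/positive_definite_psd.
move=> n x c injx; rewrite kernel_form_combination => /sK /[swap] i /(_ (x i)).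
rewrite /coefc big_map big_enum_cond /= (eq_bigl (pred1 i)) => [|j].
  by rewrite big_pred1_eq => h; rewrite -[LHS]conjCK h conjC0.
by rewrite /= (inj_eq injx).
Qed.

End positive_definite.

(** * Schur complements and products of kernels *)

Section schur.
Context (R : realType) (X Z : choiceType).
Local Notation C := (Cplx R).
Implicit Types (p : X -> X -> C) (q : Z -> Z -> C).

(** What remains of [p] once the section at [a] is projected away, as in one step of Gaussian
    elimination. If [p a a = 0] the inverse is 0 by convention. *)
Definition schur_complement p (a x y : X) : C := p x y - p x a * p a y / p a a.

Lemma psd_eq0 p a x : psd p -> p a a = 0 -> p x a = 0 /\ p a x = 0.
Proof.
move=> pp aa.
have h : p x a = 0.
  have := psd_cauchy_schwarz x a pp; rewrite aa mulr0 => h.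
  by apply: cabs_eq0; apply/eqP; rewrite -sqrf_eq0 eq_le h sqr_ge0.
by split => //; rewrite (psd_herm x a pp) h conjC0.
Qed.

Lemma schur_complement_psd p a : psd p -> psd (schur_complement p a).
Proof.
move=> pp w; have [aa|aa] := eqVneq (p a a) 0.
  rewrite (_ : schur_complement p a = p) //; apply/funext => x; apply/funext => y.
  by rewrite /schur_complement aa invr0 mulr0 subr0.
(* With this coefficient the function of [w ++ scalec t [:: (1, a)]] vanishes at [a]: the projection
   onto the section at [a] has been subtracted. *)
pose t := - ev p w a / p a a.
have := pp (w ++ scalec t [:: (1, a)]).
rewrite !form_catl !form_catr !form_scalel !form_scaler !form_single ev_single.
rewrite (form_herm w [:: (1, a)] pp) form_single.
have -> : form (schur_complement p a) w w =
  form p w w - ev p w a * (ev p w a)^* / p a a.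
  rewrite !formE; transitivity (\sum_(v <- w) ((v.1)^* * ev p w v.2 -
      ev p w a / p a a * ((v.1)^* * p v.2 a))).
    apply: eq_bigr => v _; rewrite [_ / _ * _]mulrCA -mulrBr; congr (_ * _).
    rewrite /ev mulrAC mulr_suml mulr_suml -sumrB; apply: eq_bigr => u _.
    by rewrite /schur_complement; ring.
  rewrite sumrB -big_distrr /=; congr (_ - _); rewrite mulrAC; congr (_ * _ / _).
  rewrite /ev conjC_sum; apply: eq_bigr => v _.
  by rewrite conjCM -psd_herm.
have taa : (p a a)^* = p a a by rewrite conj_Creal // ger0_real // psd_ge0.
have -> : t^* = - (ev p w a)^* / p a a.
  by rewrite /t conjCM conjCN -[in RHS]taa; congr (_ * _); exact: fmorphV.
congr (0 <= _); rewrite /t; by field.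
Qed.

(** Schur's product theorem, by eliminating points of [X] one at a time. Each step writes [p] as its
    Schur complement plus a rank-one kernel, and a rank-one kernel times [q] yields a form of [q]
    with rescaled coefficients. The invariant in [main] is that the sections of [p] vanish at the
    points of [w] missing from [s], so nothing is left when [s] is empty. *)
Lemma form_tensor_ge0 p q (w : seq (C * (X * Z))) : psd p -> psd q ->
  0 <= form (fun s t => p s.1 t.1 * q s.2 t.2) w w.
Proof.
move=> pp pq.
suff main (s : seq X) : forall p, psd p ->
    (forall u, u \in w -> u.2.1 \notin s -> forall x, p x u.2.1 = 0) ->
    0 <= form (fun s t => p s.1 t.1 * q s.2 t.2) w w.
  refine (main [seq u.2.1 | u <- w] p pp _) => u uw.
  by move/negP; case; apply/mapP; exists u.
elim: s => [|a s IH] {pp}p pp ps.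
  rewrite /form big1_seq // => u uw; rewrite big1_seq // => v _.
  by rewrite ps ?mul0r ?mulr0.
pose b := [seq (u.1 * p a u.2.1, u.2.2) | u <- w].
have -> : form (fun s t => p s.1 t.1 * q s.2 t.2) w w =
    form (fun s t => schur_complement p a s.1 t.1 * q s.2 t.2) w w +
    form q b b / p a a.
  rewrite /form /b big_map mulr_suml -big_split; apply: eq_bigr => u _ /=.
  rewrite big_map mulr_suml -big_split; apply: eq_bigr => v _ /=.
  by rewrite conjCM -(psd_herm a v.2.1 pp) /schur_complement; ring.
apply: addr_ge0; last by apply: divr_ge0; [exact: pq|exact: psd_ge0].
apply: (IH (schur_complement p a)); first exact: schur_complement_psd.
move=> u uw us x; rewrite /schur_complement.
have [ua|ua] := eqVneq u.2.1 a; last first.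
  by rewrite !ps ?inE ?negb_or ?ua // mulr0 mul0r subr0.
rewrite ua; have [aa|aa] := eqVneq (p a a) 0; last by rewrite mulfK // subrr.
by rewrite (psd_eq0 x pp aa).1 !mul0r subr0.
Qed.

End schur.

(** * Vanishing of double integrals *)

Section continuous_kernel.
Context (R : realType) (Y : ptopologicalType).
Local Notation C := (Cplx R).
Implicit Types (K : Y -> Y -> C).

Lemma bounded_kernel_ge0 K : bounded_kernel K ->
  exists2 M : R, 0 <= M & forall x y, cabs (K x y) <= M.
Proof.
move=> [M KM]; exists M => //; apply: le_trans (KM point point); exact: cabs_ge0.
Qed.

Lemma continuous_kernel_comp (T : topologicalType) K (f g : T -> Y) :
  continuous_kernel K -> continuous f -> continuous g ->
  continuous (fun t => K (f t) (g t)).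
Proof.
move=> cK cf cg t.
have h : (fun t => (f t, g t)) @ t --> (f t, g t) by exact: cvg_pair (cf t) (cg t).
exact: (cvg_comp _ (fun xy : Y * Y => K xy.1 xy.2) h (cK (f t, g t))).
Qed.

Lemma continuous_kernell K y : continuous_kernel K -> continuous (K ^~ y).
Proof.
move=> cK; apply: (@continuous_kernel_comp Y K id (fun=> y) cK).
- by move=> x; exact: cvg_id.
- exact: cst_continuous.
Qed.

(** Cauchy-Schwarz for the difference of two sections; the first factor is its squared norm and does
    not depend on [t]. *)
Lemma kernel_diff_bound K x y t : psd K ->
  cabs (K t x - K t y) ^+ 2 <=
  complex.Re (K x x - K x y - (K y x - K y y)) * complex.Re (K t t).
Proof.
move=> pK; have := ev_bound ([:: (1, x)] ++ scalec (-1) [:: (1, y)]) t pK.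
rewrite ev_cat ev_scale !ev_single /sqn.
rewrite !form_catl !form_catr !form_scalel !form_scaler !form_single !ev_single.
rewrite conjCN rmorph1 !mulN1r; congr (_ <= complex.Re _ * _); ring.
Qed.

(** Continuity near the single point [(y, y)] of the diagonal makes the sections at [y] and [z]
    close in norm, and boundedness of the kernel turns this into closeness uniform in [t], without
    any compactness. *)
Lemma kernel_equicontinuous K y (e : R) :
  bounded_kernel K -> continuous_kernel K -> psd K -> 0 < e ->
  \forall z \near y, forall t, cabs (K t y - K t z) < e.
Proof.
move=> /bounded_kernel_ge0 [M M0 KM] cK pK e0.
(* The squared distance of the two sections is at most [3 * d], and [3 * d * M < e ^+ 2]; the [+ 1]
   covers [M = 0]. *)
pose d := e ^+ 2 / (3 * (M + 1)).
have M1 : 0 < 3 * (M + 1) by lra.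
have d0 : 0 < d by rewrite divr_gt0 // exprn_gt0.
have cc := @continuous_kernel_comp _ K _ _ cK.
have cid : continuous (id : Y -> Y) by move=> x; exact: cvg_id.
have ccst : continuous (fun _ : Y => y) by exact: cst_continuous.
have /complex_cvgP /(_ _ d0) h1 := cc _ _ _ cid cid y.
have /complex_cvgP /(_ _ d0) h2 := cc _ _ _ cid ccst y.
have /complex_cvgP /(_ _ d0) h3 := cc _ _ _ ccst cid y.
near=> z => t.
have g1 : cabs (K z z - K y y) < d by near: z.
have g2 : cabs (K z y - K y y) < d by near: z.
have g3 : cabs (K y z - K y y) < d by near: z.
have hd := kernel_diff_bound y z t pK.
rewrite -(ltr_pXn2r (n := 2)) ?nnegrE ?cabs_ge0 ?ltW //.
apply: le_lt_trans hd _.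
have r1 : complex.Re (K y y - K y z - (K z y - K z z)) <= 3 * d.
  apply: le_trans (ler_norm _) _; apply: le_trans (le_Re_cabs _) _.
  have -> : K y y - K y z - (K z y - K z z) =
    (K z z - K y y) - (K z y - K y y) - (K y z - K y y) by ring.
  apply: le_trans (cabsD _ _) _; rewrite cabsN.
  apply: le_trans (lerD (cabsD _ _) (lexx _)) _; rewrite cabsN; lra.
have r2 : complex.Re (K t t) <= M.
  by apply: le_trans (ler_norm _) _; apply: le_trans (le_Re_cabs _) _.
apply: (@le_lt_trans _ _ (3 * d * M)).
  apply: le_trans (ler_wpM2r _ r1) _; first exact: Re_ge0 (psd_ge0 _ pK).
  by apply: ler_wpM2l => //; lra.
have -> : e ^+ 2 = 3 * d * (M + 1) by rewrite /d; field; rewrite gt_eqF //; lra.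
by rewrite ltr_pM2l; lra.
Unshelve. all: by end_near. Qed.

Lemma kernel_equicontinuousl K y (e : R) :
  bounded_kernel K -> continuous_kernel K -> psd K -> 0 < e ->
  \forall z \near y, forall t, cabs (K y t - K z t) < e.
Proof.
move=> bK cK pK e0; have := kernel_equicontinuous y bK cK pK e0.
apply: filterS => z h t.
by rewrite (psd_herm t y pK) (psd_herm t z pK) -cabs_conj conjCD conjCN !conjCK.
Qed.

End continuous_kernel.

(** * Kernel means and their discretization *)

Section kernel_mean.
Context (R : realType) (Y : ptopologicalType).
Local Notation C := (Cplx R).
Variables (hY : hausdorff_space Y) (K : Y -> Y -> C).
Hypotheses (bK : bounded_kernel K) (cK : continuous_kernel K) (pK : psd K).
Variables (lam : cmeasure (borel Y) R) (rl : radon lam).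

Definition kernel_mean (y : Y) : C := cintegral lam (fun x : borel Y => K x y).

Lemma kernel_bmeasl y : bmeas (K ^~ y : borel Y -> C).
Proof.
have [M _ KM] := bounded_kernel_ge0 bK.
exact: (@continuous_bmeas R Y (K ^~ y) M (continuous_kernell (y := y) cK)).
Qed.

Lemma kernel_mean_bounded : exists2 b : R, 0 <= b & forall y, cabs (kernel_mean y) <= b.
Proof.
have [M M0 KM] := bounded_kernel_ge0 bK.
exists (2 * M * massr lam setT); first by rewrite !mulr_ge0 ?massr_ge0.
by move=> y; apply: cintegral_sup; [exact: kernel_bmeasl|].
Qed.

Lemma kernel_mean_continuous : continuous kernel_mean.
Proof.
move=> y; apply/complex_cvgP => e e0.
have m0 := massr_ge0 lam setT; have m1 : 0 < 2 * (massr lam setT + 1) by lra.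
have d0 : 0 < e / (2 * (massr lam setT + 1)) by rewrite divr_gt0.
apply: filterS (kernel_equicontinuous y bK cK pK d0) => z h.
rewrite cabsBC /kernel_mean -cintegralB; do ?exact: kernel_bmeasl.
have bB : bmeas (fun x : borel Y => K x y - K x z).
  have := bmeasD (kernel_bmeasl y) (bmeasM (bmeas_cst _ (-1 : C)) (kernel_bmeasl z)).
  by congr bmeas; apply/funext => x; rewrite mulN1r.
apply: le_lt_trans (cintegral_sup lam bB (fun x => ltW (h x))) _.
move: (massr lam setT) m0 m1 => m m0 m1.
have -> : 2 * (e / (2 * (m + 1))) * m = e * (m / (m + 1)).
  by field; rewrite ?mulf_neq0 ?pnatr_eq0 ?gt_eqF //; lra.
by rewrite gtr_pMr // ltr_pdivrMr ?mul1r; lra.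
Qed.

Lemma kernel_mean_bmeas : bmeas (kernel_mean : borel Y -> C).
Proof.
by have [b _ fb] := kernel_mean_bounded; exact: continuous_bmeas kernel_mean_continuous fb.
Qed.

(* Disjointifying a finite cover, by induction on its length. *)
Let step_approx (e : R) (l : seq Y) (U : Y -> set Y) (E : set (borel Y)) :
  0 <= e ->
  (forall x, open (U x)) -> (forall x z t, U x z -> cabs (K x t - K z t) <= e) ->
  measurable E -> (forall x, E x -> exists2 i, i \in l & U i x) ->
  exists s : seq (set (borel Y) * Y),
    [/\ forall u, u \in s -> measurable u.1,
        forall x t, E x -> cabs (K x t - \sum_(u <- s) \1_(u.1) x * K u.2 t) <= e,
        forall x t, ~ E x -> \sum_(u <- s) \1_(u.1) x * K u.2 t = 0 &
        \sum_(u <- s) massr lam u.1 <= massr lam E].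
Proof.
move=> e0 oU UK; elim: l E => [|i l IH] E mE El.
  exists [::]; split => // [x t /El []//|x t _|].
  - by rewrite big_nil.
  - by rewrite big_nil massr_ge0.
have mU := borel_open (oU i).
have [||s [ms s1 s2 s3]] := IH (E `\` U i).
- exact: measurableD.
- by move=> x [/El [j]]; rewrite inE => /predU1P[->//|jl Ux _]; exists j.
exists ((E `&` U i, i) :: s); split.
- by move=> u; rewrite inE => /predU1P[->|/ms//]; exact: measurableI.
- move=> x t Ex; rewrite big_cons /=; have [Ux|nUx] := pselect (U i x).
    rewrite s2 ?addr0; last by case.
    by rewrite indicE mem_set // mul1r cabsBC; exact: UK.
  by rewrite indicE memNset ?mul0r ?add0r; [exact: s1|case].
- move=> x t nEx; rewrite big_cons /= s2 ?addr0; last by case.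
  by rewrite indicE memNset ?mul0r //; case.
- by rewrite big_cons /= -(massrD lam mE mU) lerD2l.
Qed.

(** The nodes are centres of the covering neighbourhoods and the weights are values of [lam] on the
    pieces, conjugated because hermitian symmetry turns [K x t] into [(K t x)^*]. The weights add up
    to at most the mass of [lam], whatever [e] is; this is what lets the norm of [b] be
    estimated. *)
Let discretize (e : R) : 0 < e -> exists b : seq (C * Y),
  (forall t, cabs (kernel_mean t - (ev K b t)^*) <= e) /\
  \sum_(u <- b) cabs u.1 <= massr lam setT.
Proof.
move=> e0; have [M M0 KM] := bounded_kernel_ge0 bK.
have m0 := massr_ge0 lam setT.
(* Two contributions, from the pieces and from outside the compact set, each doubled by
   [cintegral_bound], explain the 4 here and in [r]; the [+ 1] keeps the denominators positive. *)
pose d := e / (4 * (massr lam setT + 1)).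
have d0 : 0 < d by rewrite divr_gt0 //; lra.
pose r := e / (4 * (M + 1)).
have r0 : 0 < r by rewrite divr_gt0 //; lra.
have [A [cA _ mA]] := radon_tight hY rl measurableT r0.
have bA := borel_compact hY cA.
pose U x := interior [set z | forall t, cabs (K x t - K z t) < d].
have [||l _ Al] := @compact_finite_cover Y Y setT U A cA.
- by move=> x _; exact: open_interior.
- by move=> x _; exists x => //; exact: kernel_equicontinuousl.
have [||s [ms s1 s2 s3]] := step_approx (ltW d0) _ _ bA Al.
- by move=> x; exact: open_interior.
- by move=> x z t /interior_subset /= h; exact/ltW.
exists [seq ((cm_val lam u.1)^*, u.2) | u <- s]; split; last first.
  rewrite big_map; apply: le_trans (le_trans s3 (le_massr _ bA measurableT _)) => //.
  rewrite big_seq [leRHS]big_seq; apply: ler_sum => u /ms mu.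
  by rewrite cabs_conj; exact: le_cm_val_massr.
move=> t.
have -> : (ev K [seq ((cm_val lam u.1)^*, u.2) | u <- s] t)^* =
    cintegral lam (fun x : borel Y => \sum_(u <- s) K u.2 t * \1_(u.1) x).
  have bs u : u \in s -> bmeas (fun x : borel Y => K u.2 t * \1_(u.1) x).
    by move=> us; apply: bmeasM; [exact: bmeas_cst|apply: bmeas_indic; exact: ms].
  rewrite cintegral_sum // /ev big_map conjC_sum; apply: eq_big_seq => u us.
  rewrite cintegralZ; last by apply: bmeas_indic; exact: ms.
  rewrite cintegral_indic; last exact: ms.
  by rewrite conjCM conjCK -(psd_herm _ _ pK) mulrC.
have bs : bmeas (fun x : borel Y => \sum_(u <- s) K u.2 t * \1_(u.1) x).
  apply: bmeas_sum => u us.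
  by apply: bmeasM; [exact: bmeas_cst|apply: bmeas_indic; exact: ms].
rewrite -cintegralB //; last exact: kernel_bmeasl.
have bB : bmeas (fun x : borel Y => K x t - \sum_(u <- s) K u.2 t * \1_(u.1) x).
  have := bmeasD (kernel_bmeasl t) (bmeasM (bmeas_cst _ (-1 : C)) bs).
  by congr bmeas; apply/funext => x; rewrite mulN1r.
have mA' : massr lam (~` A) <= r by move: mA; rewrite setTD => /ltW.
apply: le_trans (@cintegral_bound _ _ _ lam _ d M (~` A) bB _ _) _.
- exact: measurableC.
- move=> x; have sumC : \sum_(u <- s) K u.2 t * \1_(u.1) x =
      \sum_(u <- s) \1_(u.1) x * K u.2 t by apply: eq_bigr => u _; rewrite mulrC.
  rewrite sumC indicE in_setC; have [Ax|nAx] := pselect (A x).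
    by rewrite mem_set // mulr0 addr0; exact: s1.
  by rewrite memNset // s2 // subr0 mulr1; apply: le_trans (KM x t) _; rewrite lerDr ltW.
- have h1 : d * massr lam setT <= e / 4.
    rewrite /d; move: (massr lam setT) m0 => m m0.
    rewrite mulrAC ler_pdivrMr; last lra.
    by rewrite (_ : e / 4 * (4 * (m + 1)) = e * m + e); [lra|field].
  have h2 : M * massr lam (~` A) <= e / 4.
    apply: le_trans (ler_wpM2l M0 mA') _.
    rewrite /r mulrCA mulrA ler_pdivrMr; last lra.
    by rewrite (_ : e / 4 * (4 * (M + 1)) = e * M + e); [rewrite mulrC; lra|field].
  lra.
Qed.

(* The discretization turns the double integral into a Gram form, to which the
   Cauchy-Schwarz inequality applies. *)
Lemma double_integral_eq0 :
  double_integral (K : borel Y -> borel Y -> C) lam = 0 <->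
  forall y, kernel_mean y = 0.
Proof.
split=> [D0 y|k0]; last first.
  rewrite /double_integral (_ : (fun y => _) = (fun=> 0)) ?cintegral0 //.
  by apply/funext => y; exact: k0.
have [M M0 KM] := bounded_kernel_ge0 bK.
pose L := 2 * massr (cm_conj lam) setT + massr lam setT.
have m0 := massr_ge0 lam setT; have m0' := massr_ge0 (cm_conj lam) setT.
have L0 : 0 <= L by rewrite /L; lra.
(* The Gram form of [b] is compared with the double integral, which is 0. The errors in [D2] and
   [D1] add up to [e * L]. *)
have small (e : R) : 0 < e -> exists b : seq (C * Y),
    cabs (kernel_mean y - (ev K b y)^*) <= e /\ sqn K b <= e * L.
  move=> e0; have [b [hb sb]] := discretize e0; exists b; split => //.
  have bev : bmeas (fun t : borel Y => ev K b t).
    apply: bmeas_sum => u _; apply: bmeasM; first exact: bmeas_cst.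
    exact: kernel_bmeasl.
  (* The finite sum is taken under the integral; subtracting the vanishing double integral leaves an
     integrand of modulus at most [e]. *)
  have D1 : cabs (\sum_(u <- b) (u.1)^* * (kernel_mean u.2)^*) <=
      2 * e * massr (cm_conj lam) setT.
    have -> : \sum_(u <- b) (u.1)^* * (kernel_mean u.2)^* =
        cintegral (cm_conj lam) (fun t : borel Y => (ev K b t)^*).
      rewrite cintegral_conj; last exact: bmeas_conj.
      rewrite [X in cintegral lam X](_ : _ = (fun t : borel Y => ev K b t)); last first.
        by apply/funext => t; rewrite conjCK.
      rewrite cintegral_sum => [|u _].
        rewrite conjC_sum; apply: eq_bigr => u _.
        by rewrite cintegralZ ?conjCM //; exact: kernel_bmeasl.
      by apply: bmeasM; [exact: bmeas_cst|exact: kernel_bmeasl].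
    have <- : cintegral (cm_conj lam) (fun t : borel Y => (ev K b t)^* - kernel_mean t) =
        cintegral (cm_conj lam) (fun t : borel Y => (ev K b t)^*).
      rewrite cintegralB; [|exact: bmeas_conj|exact: kernel_mean_bmeas].
      by rewrite [X in _ - X](_ : _ = 0) ?subr0.
    apply: cintegral_sup => [|t]; last by rewrite cabsBC.
    have := bmeasD (bmeas_conj bev) (bmeasM (bmeas_cst _ (-1 : C)) kernel_mean_bmeas).
    by congr bmeas; apply/funext => x; rewrite mulN1r.
  have D2 : cabs (form K b b - \sum_(u <- b) (u.1)^* * (kernel_mean u.2)^*) <=
      e * massr lam setT.
    rewrite formE -sumrB; apply: le_trans (cabs_sum _ _ _) _.
    apply: le_trans (ler_wpM2l (ltW e0) sb); rewrite big_distrr /=.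
    apply: ler_sum => u _; rewrite -mulrBr cabsM cabs_conj mulrC ler_wpM2r ?cabs_ge0 //.
    by have := hb u.2; rewrite cabsBC -cabs_conj conjCD conjCN conjCK.
  have -> : sqn K b = cabs (form K b b).
    by rewrite (sqnE b pK) cabs_real ger0_norm // sqn_ge0.
  rewrite -[form K b b](subrK (\sum_(u <- b) (u.1)^* * (kernel_mean u.2)^*)).
  apply: le_trans (cabsD _ _) _; apply: le_trans (lerD D2 D1) _.
  by rewrite /L mulrDr addrC mulrAC mulrC mulrA [_ * 2]mulrC.
apply: contrapT => /eqP fy0.
have c0 : 0 < cabs (kernel_mean y).
  by rewrite lt_neqAle cabs_ge0 andbT eq_sym; apply: contra fy0 => /eqP/cabs_eq0 ->.
set k := cabs (kernel_mean y) in c0.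
(* Tuned so that [h6] and [h7] give [k <= k / 2 + k / 4], which is absurd for [k > 0]. *)
pose e1 := k / 4; pose e2 := k ^+ 2 / (4 * (L * M + 1)).
have LM : 0 <= L * M by rewrite mulr_ge0.
have e10 : 0 < e1 by rewrite divr_gt0.
have e20 : 0 < e2 by rewrite divr_gt0 ?exprn_gt0 //; lra.
have me : 0 < Num.min e1 e2 by rewrite lt_min e10.
have [b [h1 h2]] := small _ me.
have h3 := ev_bound b y pK.
have Ky : complex.Re (K y y) <= M.
  by apply: le_trans (ler_norm _) _; apply: le_trans (le_Re_cabs _) _.
have h4 : cabs (ev K b y) ^+ 2 <= e2 * (L * M).
  apply: le_trans h3 _; apply: le_trans (ler_wpM2r (Re_ge0 (psd_ge0 y pK)) h2) _.
  rewrite [e2 * _]mulrA; apply: ler_pM => //.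
  - by rewrite mulr_ge0 // ltW.
  - exact: Re_ge0 (psd_ge0 y pK).
  - by rewrite ler_wpM2r // ge_min lexx orbT.
have h5 : e2 * (L * M) <= (k / 2) ^+ 2.
  rewrite /e2 mulrAC ler_pdivrMr; last lra.
  have -> : (k / 2) ^+ 2 * (4 * (L * M + 1)) = k ^+ 2 * (L * M) + k ^+ 2 by field.
  by rewrite lerDl sqr_ge0.
have h6 : cabs (ev K b y) <= k / 2.
  rewrite -(ler_pXn2r (n := 2)) ?nnegrE ?cabs_ge0 //; first exact: le_trans h4 h5.
  by rewrite divr_ge0 // ltW.
have h7 : cabs (kernel_mean y - (ev K b y)^*) <= e1.
  by apply: le_trans h1 _; rewrite ge_min lexx.
have := cabsD (kernel_mean y - (ev K b y)^*) (ev K b y)^*.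
rewrite subrK cabs_conj -/k.
move: h6 h7; rewrite /e1; lra.
Qed.

End kernel_mean.

(** * Reproducing kernel Hilbert spaces *)

Section complex_sequences.
Context (R : realType).
Local Notation C := (Cplx R).
Implicit Types (u v : nat -> C).

Lemma complex_cvg_seqP u (l : C) :
  u @ \oo --> l <->
  forall e : R, 0 < e -> exists N, forall n, (N <= n)%N -> cabs (u n - l) < e.
Proof.
split.
  by move/complex_cvgP => h e /h [N _ hN]; exists N => n Nn; exact: hN.
move=> h; apply/complex_cvgP => e /h [N hN].
by exists N => // n /= Nn; exact: hN.
Qed.

Lemma complex_cvg_conj u (l : C) : u @ \oo --> l -> (u n)^* @[n --> \oo] --> l^*.
Proof.
move/complex_cvg_seqP => h; apply/complex_cvg_seqP => e /h [N hN].
by exists N => n /hN; rewrite -conjCN -conjCD cabs_conj.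
Qed.

Lemma complex_cvg_unique u (l l' : C) : u @ \oo --> l -> u @ \oo --> l' -> l = l'.
Proof. by move=> h h'; apply: (cvg_unique _ h h'); exact: norm_hausdorff. Qed.

Lemma real_cauchy_cvg (f : nat -> R) :
  (forall e : R, 0 < e -> exists N, forall m n, (N <= m)%N -> (N <= n)%N ->
     `|f m - f n| < e) -> exists l : R, f @ \oo --> l.
Proof.
move=> h; exists (lim (f @ \oo)); apply/cauchy_cvgP/cauchy_exP => e e0.
have [N hN] := h e e0; exists (f N); exists N => // n /= Nn.
by rewrite /ball /=; exact: hN.
Qed.

Lemma complex_cauchy_cvg u :
  (forall e : R, 0 < e -> exists N, forall m n, (N <= m)%N -> (N <= n)%N ->
     cabs (u m - u n) < e) -> exists l : C, u @ \oo --> l.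
Proof.
move=> h.
have [|a /cvgrPdist_lt ha] := @real_cauchy_cvg (fun n => complex.Re (u n)).
  move=> e /h [N hN]; exists N => m n Nm Nn.
  by apply: le_lt_trans (hN m n Nm Nn); rewrite -raddfB; exact: le_Re_cabs.
have [|b /cvgrPdist_lt hb] := @real_cauchy_cvg (fun n => complex.Im (u n)).
  move=> e /h [N hN]; exists N => m n Nm Nn.
  by apply: le_lt_trans (hN m n Nm Nn); rewrite -raddfB; exact: le_Im_cabs.
exists (Complex a b); apply/complex_cvg_seqP => e e0.
have e2 : 0 < e / 2 by rewrite divr_gt0.
have [N1 _ h1] := ha _ e2; have [N2 _ h2] := hb _ e2.
exists (maxn N1 N2) => n; rewrite geq_max => /andP[n1 n2].
apply: le_lt_trans (cabs_le_ReIm _) _; rewrite [ltRHS]splitr !raddfB /=.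
by apply: ltrD; rewrite distrC; [exact: h1|exact: h2].
Qed.

(** Being nonnegative in [C] includes being real, so the imaginary part of the limit has to be
    treated too. *)
Lemma complex_cvg_ge0 u (l : C) : u @ \oo --> l -> (forall n, 0 <= u n) -> 0 <= l.
Proof.
move=> /complex_cvg_seqP ul u0.
have -> : l = (complex.Re l)%:C.
  suff im0 : complex.Im l = 0 by rewrite {1}(complex_split l) im0 mulr0 addr0.
  apply/eqP; rewrite -normr_le0; apply/ler_addgt0Pr => e e0; rewrite add0r.
  have [N hN] := ul e e0; have := hN N (leqnn N).
  rewrite (complex_ge0E (u0 N)) => /ltW; apply: le_trans.
  by apply: le_trans (le_Im_cabs _); rewrite raddfB /= sub0r normrN.
rewrite real_complex_ge0; apply/ler_addgt0Pr => e e0.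
have [N hN] := ul e e0; have := le_lt_trans (le_Re_cabs _) (hN N (leqnn N)).
rewrite raddfB /= ltr_norml => /andP[_]; have := Re_ge0 (u0 N); lra.
Qed.

Lemma complex_cvg_le u (l : C) (b : R) : u @ \oo --> l ->
  (exists N, forall n, (N <= n)%N -> cabs (u n) <= b) -> cabs l <= b.
Proof.
move=> /complex_cvg_seqP ul [N ub]; apply/ler_addgt0Pr => e /ul [M hM].
have := hM _ (leq_maxr N M); have := ub _ (leq_maxl N M).
have := cabsD (u (maxn N M)) (l - u (maxn N M)).
by rewrite addrC subrK cabsBC; lra.
Qed.

End complex_sequences.

(** * Cauchy-Schwarz for semi-inner products of functions *)

Section semi_inner_product.
Context (R : realType) (Y : Type).
Local Notation C := (Cplx R).
Variables (H : set (Y -> C)) (ip : (Y -> C) -> (Y -> C) -> C).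
Hypothesis comb : forall (a : C) F G, H F -> H G -> H (fun y => a * F y + G y).
Hypothesis lin : forall (a : C) F G L, H F -> H G -> H L ->
  ip (fun y => a * F y + G y) L = a * ip F L + ip G L.
Hypothesis conj : forall F G, H F -> H G -> ip G F = (ip F G)^*.
Hypothesis ge0 : forall F, H F -> 0 <= ip F F.

Lemma semi_ip_combE (a : C) F G : H F -> H G ->
  ip (fun y => a * F y + G y) (fun y => a * F y + G y) =
  (cabs a ^+ 2)%:C * ip F F + a * ip F G + (a * ip F G)^* + ip G G.
Proof.
move=> HF HG; have HFG := comb a HF HG.
rewrite lin // (conj HFG HF) (conj HFG HG) !lin //.
rewrite !conjCD !conjCM -!conj // cabs_sqr; ring.
Qed.

(** The scalar [- s <F, G>^*] makes the cross terms real, which leaves the quadratic in [s] of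
    [quadratic_discr]. *)
Lemma semi_ip_cauchy_schwarz F G : H F -> H G ->
  cabs (ip F G) ^+ 2 <= complex.Re (ip F F) * complex.Re (ip G G).
Proof.
move=> HF HG; rewrite mulrC; apply: quadratic_discr; rewrite ?sqr_ge0 ?Re_ge0 ?ge0 // => s.
have := ge0 (comb (- s%:C * (ip F G)^*) HF HG); rewrite semi_ip_combE //.
rewrite (complex_ge0E (ge0 HF)) (complex_ge0E (ge0 HG)).
rewrite cabsM cabsN cabs_real cabs_conj exprMn.
rewrite (_ : - s%:C * (ip F G)^* * ip F G = - (s * cabs (ip F G) ^+ 2)%:C); last first.
  by rewrite complexM cabs_sqr; ring.
rewrite conjCN conjC_real -!complexN -!complexM -!complexD real_complex_ge0 /=.
rewrite real_normK ?num_real //; lra.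
Qed.

Lemma le_sqrt_sqr (a b : R) : 0 <= b -> a <= b ^+ 2 -> Num.sqrt a <= b.
Proof.
by move=> b0 ab; rewrite -(ger0_norm b0) -sqrtr_sqr ler_wsqrtr.
Qed.

Lemma ip_norm_comb (a : C) F G : H F -> H G ->
  Num.sqrt (complex.Re (ip (fun y => a * F y + G y) (fun y => a * F y + G y))) <=
  cabs a * Num.sqrt (complex.Re (ip F F)) + Num.sqrt (complex.Re (ip G G)).
Proof.
move=> HF HG; apply: le_sqrt_sqr.
  by rewrite addr_ge0 ?mulr_ge0 ?cabs_ge0 ?sqrtr_ge0.
have cs := semi_ip_cauchy_schwarz HF HG.
have f0 := Re_ge0 (ge0 HF); have g0 := Re_ge0 (ge0 HG).
rewrite semi_ip_combE // sqrrD exprMn !sqr_sqrtr //.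
have hB : cabs (ip F G) <= Num.sqrt (complex.Re (ip F F)) * Num.sqrt (complex.Re (ip G G)).
  rewrite -(ler_pXn2r (n := 2)) ?nnegrE ?cabs_ge0 ?mulr_ge0 ?sqrtr_ge0 //.
  by rewrite exprMn !sqr_sqrtr.
have hr : complex.Re (a * ip F G) <= cabs a *
    (Num.sqrt (complex.Re (ip F F)) * Num.sqrt (complex.Re (ip G G))).
  apply: le_trans (ler_norm _) _; apply: le_trans (le_Re_cabs _) _.
  by rewrite cabsM ler_wpM2l ?cabs_ge0.
have hc (z : C) : complex.Re (z^*) = complex.Re z by case: z.
rewrite (complex_ge0E (ge0 HF)) -complexM !raddfD /= hc.
by rewrite -mulrA mulr2n; lra.
Qed.

End semi_inner_product.

Section rkhs_facts.
Context (R : realType) (Y : ptopologicalType).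
Local Notation C := (Cplx R).
Variables (K : Y -> Y -> C) (H : set (Y -> C)) (ip : (Y -> C) -> (Y -> C) -> C).
Hypothesis hH : is_rkhs K H ip.

Lemma rkhs_bound F y : H F ->
  cabs (F y) <= ip_norm ip F * Num.sqrt (complex.Re (K y y)).
Proof.
move=> HF; have Hy := rkhs_section hH y.
rewrite -(ler_pXn2r (n := 2)) ?nnegrE ?cabs_ge0 ?mulr_ge0 ?sqrtr_ge0 //.
have Ky : ip (K ^~ y) (K ^~ y) = K y y by rewrite (rkhs_reproducing hH).
have K0 : 0 <= complex.Re (K y y) by rewrite -Ky; exact: Re_ge0 (rkhs_ip_ge0 hH Hy).
have F0 : 0 <= complex.Re (ip F F) by exact: Re_ge0 (rkhs_ip_ge0 hH HF).
rewrite exprMn !sqr_sqrtr //.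
rewrite -{1}(rkhs_reproducing hH y HF) -Ky.
exact: (semi_ip_cauchy_schwarz (rkhs_comb hH) (rkhs_ip_lin hH) (rkhs_ip_conj hH)
  (rkhs_ip_ge0 hH) HF Hy).
Qed.

Lemma rkhs_combination n (c : 'I_n -> C) (x : 'I_n -> Y) :
  H (fun y => \sum_(i < n) c i * K y (x i)).
Proof.
elim: n c x => [|n IH] c x.
  by under eq_fun do rewrite big_ord0; exact: rkhs_zero hH.
under eq_fun do rewrite big_ord_recl.
exact: (rkhs_comb hH) _ _ _ (rkhs_section hH _) (IH _ _).
Qed.

End rkhs_facts.

Lemma complex_cvg_sum (R : realType) (T I : Type) (F : set_system T) (r : seq I)
    (f : I -> T -> Cplx R) (l : I -> Cplx R) : Filter F ->
  (forall i, f i @ F --> l i) ->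
  (fun t => \sum_(i <- r) f i t) @ F --> \sum_(i <- r) l i.
Proof.
move=> FF fl; elim: r => [|i r IH].
  by rewrite big_nil; under eq_fun do rewrite big_nil; exact: cvg_cst.
by rewrite big_cons; under eq_fun do rewrite big_cons; exact: cvgD (fl i) IH.
Qed.

Lemma complex_cvg_lin (R : realType) (u v : nat -> Cplx R) (t l k : Cplx R) :
  u @ \oo --> l -> v @ \oo --> k ->
  (fun n => t * u n + v n) @ \oo --> t * l + k.
Proof.
move=> ul vk; apply: (cvgD _ vk).
exact: (cvgM (cvg_cst t) ul).
Qed.

Section rkhs_continuity.
Context (R : realType) (Y : ptopologicalType).
Local Notation C := (Cplx R).
Variables (K : Y -> Y -> C) (bK : bounded_kernel K).

(** For a bounded kernel the norm of the space dominates the sup norm up to the factor [Num.sqrt M],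
    so density of the span in norm becomes uniform approximation. *)
Lemma rkhs_uniform_approx H ip F (e : R) : is_rkhs K H ip -> H F -> 0 < e ->
  exists n (c : 'I_n -> C) (x : 'I_n -> Y),
    forall y, cabs (F y - \sum_(i < n) c i * K y (x i)) < e.
Proof.
move=> hH HF e0; have [M M0 KM] := bounded_kernel_ge0 bK.
have M1 : 0 < Num.sqrt M + 1 by rewrite ltr_wpDl ?sqrtr_ge0.
have [n [c [x h]]] := rkhs_dense hH HF (divr_gt0 e0 M1).
exists n, c, x => y.
have HG : H (fun y => F y - \sum_(i < n) c i * K y (x i)).
  have := rkhs_comb hH (-1) (rkhs_combination hH c x) HF.
  by congr H; apply/funext => z; rewrite mulN1r addrC.
apply: le_lt_trans (rkhs_bound hH y HG) _.
have sK : Num.sqrt (complex.Re (K y y)) <= Num.sqrt M.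
  rewrite ler_wsqrtr //; apply: le_trans (ler_norm _) _.
  exact: le_trans (le_Re_cabs _) (KM _ _).
apply: le_lt_trans (ler_pM (sqrtr_ge0 _) (sqrtr_ge0 _) (ltW h) sK) _.
rewrite -[ltRHS](divfK (lt0r_neq0 M1)) ltr_pM2l ?divr_gt0 //; lra.
Qed.

Lemma combination_continuous n (c : 'I_n -> C) (x : 'I_n -> Y) :
  continuous_kernel K -> continuous (fun y => \sum_(i < n) c i * K y (x i)).
Proof.
move=> cK y; apply: complex_cvg_sum => i; apply: cvgM; first exact: cvg_cst.
exact: continuous_kernell.
Qed.

Lemma continuous_rkhs_continuous : continuous_kernel K -> rkhs_continuous K.
Proof.
move=> cK F [H [ip [hH HF]]] y; apply/complex_cvgP => e e0.
have e3 : 0 < e / 3 by rewrite divr_gt0.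
have [n [c [x h]]] := rkhs_uniform_approx hH HF e3.
have /complex_cvgP /(_ _ e3) := @combination_continuous n c x cK y.
apply: filterS => z hz; have hz' := h z; have hy := h y; rewrite cabsBC in hy.
set g := fun y => \sum_(i < n) c i * K y (x i) in hz hz' hy *.
have -> : F z - F y = (F z - g z) + (g z - g y) + (g y - F y) by ring.
apply: le_lt_trans (cabsD _ _) _.
apply: le_lt_trans (lerD (cabsD _ _) (lexx _)) _; rewrite /g in hz hz' hy *; lra.
Qed.

End rkhs_continuity.

(** * The Moore-Aronszajn construction *)

Section moore_aronszajn.
Context (R : realType) (Y : ptopologicalType).
Local Notation C := (Cplx R).
Variables (K : Y -> Y -> C) (pK : psd K).
Implicit Types (a b : seq (C * Y)) (u v : nat -> seq (C * Y)) (F G : Y -> C).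

Definition diffc a b := a ++ scalec (-1) b.

Definition nrm a : R := Num.sqrt (sqn K a).

Lemma nrm_sqr a : nrm a ^+ 2 = sqn K a.
Proof. by rewrite sqr_sqrtr // sqn_ge0. Qed.

Lemma nrm_ge0 a : 0 <= nrm a. Proof. exact: sqrtr_ge0. Qed.

Lemma form_le_nrm a b : cabs (form K a b) <= nrm a * nrm b.
Proof.
rewrite -(ler_pXn2r (n := 2)) ?nnegrE ?cabs_ge0 ?mulr_ge0 ?nrm_ge0 //.
by rewrite exprMn !nrm_sqr; exact: form_cauchy_schwarz.
Qed.

Lemma form_diffl a b c : form K (diffc a b) c = form K a c - form K b c.
Proof. by rewrite form_catl form_scalel mulN1r. Qed.

Lemma form_diffr a b c : form K c (diffc a b) = form K c a - form K c b.
Proof. by rewrite form_catr form_scaler conjCN rmorph1 mulN1r. Qed.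

Lemma nrm_eq a b : form K a a = form K b b -> nrm a = nrm b.
Proof. by rewrite /nrm /sqn => ->. Qed.

Lemma nrm_cat a b : nrm (a ++ b) <= nrm a + nrm b.
Proof.
apply: le_sqrt_sqr; first by rewrite addr_ge0 ?nrm_ge0.
rewrite sqrrD !nrm_sqr /sqn !form_catl !form_catr (form_herm a b pK) !raddfD /=.
have hc (z : C) : complex.Re (z^*) = complex.Re z by case: z.
have := le_trans (ler_norm _) (le_trans (le_Re_cabs _) (form_le_nrm a b)).
by rewrite hc mulr2n; lra.
Qed.

Lemma nrm_scale t a : nrm (scalec t a) = cabs t * nrm a.
Proof.
rewrite /nrm /sqn form_scalel form_scaler mulrA -cabs_sqr (sqnE a pK) -complexM /=.
by rewrite sqrtrM ?sqr_ge0 // sqrtr_sqr ger0_norm ?cabs_ge0.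
Qed.

Lemma nrm_diff_trans b a c : nrm (diffc a c) <= nrm (diffc a b) + nrm (diffc b c).
Proof.
rewrite (_ : nrm (diffc a c) = nrm (diffc a b ++ diffc b c)) ?nrm_cat //.
apply: nrm_eq; rewrite /diffc !(form_catl, form_catr, form_scalel, form_scaler).
rewrite conjCN rmorph1; ring.
Qed.

Lemma ev_diff a b y : ev K (diffc a b) y = ev K a y - ev K b y.
Proof. by rewrite ev_cat ev_scale mulN1r. Qed.

Definition cauchy_comb u := forall e : R, 0 < e ->
  exists N, forall m n, (N <= m)%N -> (N <= n)%N -> nrm (diffc (u m) (u n)) < e.

(** The completion of the span is realised by functions instead of classes of Cauchy sequences: an
    element is the pointwise limit of a norm-Cauchy sequence. This loses nothing because, by
    [null_comb], such a sequence with pointwise limit 0 tends to 0 in norm. *)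
Definition represents u F :=
  cauchy_comb u /\ forall y, ev K (u n) y @[n --> \oo] --> F y.

Lemma cauchy_comb_bounded u : cauchy_comb u ->
  exists2 B : R, 0 < B & exists N, forall n, (N <= n)%N -> nrm (u n) <= B.
Proof.
move=> cu; have [N hN] := cu 1 ltr01; exists (nrm (u N) + 1).
  by rewrite ltr_wpDl ?nrm_ge0.
exists N => n Nn; have := nrm_diff_trans (u N) (u n) [::].
have nil a : nrm (diffc a [::]) = nrm a by rewrite /diffc cats0.
by rewrite !nil; have := hN n N Nn (leqnn N); lra.
Qed.

Lemma ev_le_nrm a y : cabs (ev K a y) <= nrm a * nrm [:: (1, y)].
Proof. by rewrite -form_single; exact: form_le_nrm. Qed.

Lemma cauchy_comb_represents u : cauchy_comb u -> exists F, represents u F.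
Proof.
move=> cu.
have /choice[F hF] : forall y, exists l : C, ev K (u n) y @[n --> \oo] --> l.
  move=> y; apply: complex_cauchy_cvg => e e0.
  have k1 : 0 < nrm [:: (1, y)] + 1 by rewrite ltr_wpDl ?nrm_ge0.
  have [N hN] := cu _ (divr_gt0 e0 k1); exists N => m n Nm Nn.
  rewrite -ev_diff; apply: le_lt_trans (ev_le_nrm _ _) _.
  have := hN m n Nm Nn; rewrite ltr_pdivlMr //; have := nrm_ge0 (diffc (u m) (u n)); lra.
by exists F.
Qed.

(* [x ^+ 2 <= e * x + e ^+ 2] forces [x <= 2 * e]. *)
Lemma null_comb u : represents u (fun=> 0) ->
  forall e : R, 0 < e -> exists N, forall n, (N <= n)%N -> nrm (u n) <= e.
Proof.
move=> [cu u0] e e0; pose d := e / 2; have d0 : 0 < d by rewrite divr_gt0.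
have [N hN] := cu d d0.
(* [u N] is a fixed finite combination, so pointwise convergence alone makes this pairing tend to
   0. *)
have : form K (u n) (u N) @[n --> \oo] --> \sum_(v <- u N) (v.1)^* * (0 : C).
  under eq_fun do rewrite formE.
  apply: complex_cvg_sum => v.
  by apply: cvgM; [exact: cvg_cst|exact: u0].
rewrite big1 => [|v _]; last by rewrite mulr0.
move/complex_cvg_seqP => /(_ _ (exprn_gt0 2 d0)) [N' hN'].
exists (maxn N N') => n; rewrite geq_max => /andP[n1 n2].
have h1 := hN n N n1 (leqnn N).
have h2 := hN' n n2; rewrite subr0 in h2.
have h3 : nrm (u n) ^+ 2 <= nrm (u n) * d + d ^+ 2.
  have -> : nrm (u n) ^+ 2 = cabs (form K (u n) (u n)).
    by rewrite nrm_sqr (sqnE _ pK) cabs_real ger0_norm // sqn_ge0.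
  have -> : form K (u n) (u n) = form K (u n) (diffc (u n) (u N)) + form K (u n) (u N).
    by rewrite form_diffr subrK.
  apply: le_trans (cabsD _ _) (lerD (le_trans (form_le_nrm _ _) _) (ltW h2)).
  by rewrite ler_wpM2l ?nrm_ge0 // ltW.
rewrite leNgt; apply/negP => h4; have e2 : e = 2 * d by rewrite /d; field.
by move: h3 h4; rewrite e2; have := nrm_ge0 (u n); nra.
Qed.

Lemma represents_comb t u v F G : represents u F -> represents v G ->
  represents (fun n => scalec t (u n) ++ v n) (fun y => t * F y + G y).
Proof.
move=> [cu uF] [cv vG]; split.
  move=> e e0; have t1 : 0 < 2 * (cabs t + 1) by have := cabs_ge0 t; lra.
  have e2 : 0 < e / 2 by rewrite divr_gt0.
  have [N1 h1] := cu _ (divr_gt0 e0 t1); have [N2 h2] := cv _ e2.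
  exists (maxn N1 N2) => m n; rewrite !geq_max => /andP[m1 m2] /andP[n1 n2].
  have -> : nrm (diffc (scalec t (u m) ++ v m) (scalec t (u n) ++ v n)) =
      nrm (scalec t (diffc (u m) (u n)) ++ diffc (v m) (v n)).
    apply: nrm_eq; rewrite /diffc !(form_catl, form_catr, form_scalel, form_scaler).
    by rewrite conjCN rmorph1; ring.
  apply: le_lt_trans (nrm_cat _ _) _; rewrite nrm_scale.
  have h2' := h2 m n m2 n2; have := h1 m n m1 n1; rewrite ltr_pdivlMr // => h1'.
  have := nrm_ge0 (diffc (u m) (u n)); move: h1' h2'.
  move: (nrm _) (nrm _) (cabs t) => x z k; lra.
move=> y; under eq_fun do rewrite ev_cat ev_scale.
exact: complex_cvg_lin (uF y) (vG y).
Qed.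

Lemma represents_cst a : represents (fun=> a) (ev K a).
Proof.
split=> [e e0|y]; last exact: cvg_cst.
exists 0%N => m n _ _; rewrite (_ : nrm _ = 0) //.
by rewrite /nrm /sqn form_diffl subrr /= sqrtr0.
Qed.

Lemma represents_diff u v F G : represents u F -> represents v G ->
  represents (fun n => diffc (u n) (v n)) (fun y => F y - G y).
Proof.
move=> hu hv; have := represents_comb (-1) hv hu.
rewrite (_ : (fun y => -1 * G y + F y) = (fun y => F y - G y)); last first.
  by apply/funext => y; rewrite mulN1r addrC.
move=> [ch eh]; split=> [e /ch [N hN]|y].
  exists N => m n Nm Nn; rewrite (_ : nrm _ = nrm (diffc
    (scalec (-1) (v m) ++ u m) (scalec (-1) (v n) ++ u n))); first exact: hN.
  apply: nrm_eq; rewrite /diffc !(form_catl, form_catr, form_scalel, form_scaler).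
  by rewrite conjCN rmorph1; ring.
by move: (eh y); under eq_fun do rewrite ev_cat addrC -ev_cat.
Qed.

Lemma represents_uniq_diff u u' F : represents u F -> represents u' F ->
  represents (fun n => diffc (u n) (u' n)) (fun=> 0).
Proof.
move=> hu hu'; have := represents_diff hu hu'.
by rewrite (_ : (fun y => F y - F y) = (fun=> 0)) //; apply/funext => y; rewrite subrr.
Qed.

Lemma form_cvg u v : cauchy_comb u -> cauchy_comb v ->
  exists l : C, form K (u n) (v n) @[n --> \oo] --> l.
Proof.
move=> cu cv; have [A A0 [N1 hA]] := cauchy_comb_bounded cu.
have [B B0 [N2 hB]] := cauchy_comb_bounded cv.
apply: complex_cauchy_cvg => e e0; have AB : 0 < A + B by rewrite addr_gt0.
have d0 := divr_gt0 e0 AB; have [N3 h3] := cu _ d0; have [N4 h4] := cv _ d0.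
exists (maxn (maxn N1 N2) (maxn N3 N4)) => m n.
rewrite !geq_max => /andP[/andP[m1 m2] /andP[m3 m4]] /andP[/andP[n1 n2] /andP[n3 n4]].
have -> : form K (u m) (v m) - form K (u n) (v n) =
    form K (diffc (u m) (u n)) (v m) + form K (u n) (diffc (v m) (v n)).
  by rewrite form_diffl form_diffr; ring.
apply: le_lt_trans (cabsD _ _) _.
apply: le_lt_trans (lerD (form_le_nrm _ _) (form_le_nrm _ _)) _.
have -> : e = B * (e / (A + B)) + A * (e / (A + B)) by field; rewrite gt_eqF.
apply: ler_ltD.
  by rewrite mulrC; apply: ler_pM; rewrite ?nrm_ge0 // ?hB // ltW // h3.
apply: (@le_lt_trans _ _ (A * nrm (diffc (v m) (v n)))).
  by apply: ler_wpM2r; rewrite ?nrm_ge0 // hA.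
by rewrite ltr_pM2l // h4.
Qed.

Lemma form_null u v : represents u (fun=> 0) -> cauchy_comb v ->
  form K (u n) (v n) @[n --> \oo] --> (0 : C).
Proof.
move=> u0 /cauchy_comb_bounded [B B0 [N hB]].
apply/complex_cvg_seqP => e e0.
have [N' hN'] := null_comb u0 (divr_gt0 e0 (mulr_gt0 (ltr0Sn R 1) B0)).
exists (maxn N N') => n; rewrite geq_max => /andP[n1 n2]; rewrite subr0.
apply: le_lt_trans (form_le_nrm _ _) _.
apply: le_lt_trans (ler_pM (nrm_ge0 _) (nrm_ge0 _) (hN' n n2) (hB n n1)) _.
rewrite (_ : _ * B = e / 2); first by rewrite gtr_pMr // invf_lt1 // ltr1n.
by field; rewrite gt_eqF.
Qed.

(** Rests on [<u', v'> = <u, v> + <u' - u, v> + <u', v' - v>], whose last two terms tend to 0 by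
    [form_null]. *)
Lemma form_lim_independent u u' v v' F G (l : C) :
  represents u F -> represents u' F -> represents v G -> represents v' G ->
  form K (u n) (v n) @[n --> \oo] --> l -> form K (u' n) (v' n) @[n --> \oo] --> l.
Proof.
move=> hu hu' hv hv' h.
have h1 := form_null (represents_uniq_diff hu' hu) hv.1.
have h2 := complex_cvg_conj (form_null (represents_uniq_diff hv' hv) hu'.1).
have := complex_cvg_lin (t := 1) h (complex_cvg_lin (t := 1) h1 h2).
rewrite conjC0 addr0 mulr0 addr0 mul1r.
rewrite (_ : (fun n => _) = (fun n => form K (u' n) (v' n))) //.
by apply/funext => n; rewrite -form_herm // form_diffl form_diffr; ring.
Qed.

Definition ma_space : set (Y -> C) := [set F | exists u, represents u F].

(** [xget] picks the limit along some pair of representing sequences; for functions of [ma_space]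
    the limit exists by [form_cvg] and does not depend on the pair. *)
Definition ma_ip F G : C :=
  xget 0 [set l : C | exists u v, [/\ represents u F, represents v G &
    form K (u n) (v n) @[n --> \oo] --> l]].

Lemma ma_ip_cvg u v F G : represents u F -> represents v G ->
  form K (u n) (v n) @[n --> \oo] --> ma_ip F G.
Proof.
move=> hu hv; have [l hl] := form_cvg hu.1 hv.1.
rewrite /ma_ip; case: xgetP => [_ -> [u' [v' [hu' hv' h']]]|/(_ l)].
  exact: form_lim_independent hu' hu hv' hv h'.
by case; exists u, v.
Qed.

Lemma ma_ip_eq u v F G (l : C) : represents u F -> represents v G ->
  form K (u n) (v n) @[n --> \oo] --> l -> ma_ip F G = l.
Proof. by move=> hu hv; apply: complex_cvg_unique; exact: ma_ip_cvg. Qed.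

Lemma ma_comb t F G : ma_space F -> ma_space G -> ma_space (fun y => t * F y + G y).
Proof.
by move=> [u hu] [v hv]; exists (fun n => scalec t (u n) ++ v n); exact: represents_comb.
Qed.

Lemma ma_lin t F G L : ma_space F -> ma_space G -> ma_space L ->
  ma_ip (fun y => t * F y + G y) L = t * ma_ip F L + ma_ip G L.
Proof.
move=> [u hu] [v hv] [w hw]; apply: (ma_ip_eq (represents_comb t hu hv) hw _).
under eq_fun do rewrite form_catl form_scalel.
exact: complex_cvg_lin (ma_ip_cvg hu hw) (ma_ip_cvg hv hw).
Qed.

Lemma ma_conj F G : ma_space F -> ma_space G -> ma_ip G F = (ma_ip F G)^*.
Proof.
move=> [u hu] [v hv]; apply: (ma_ip_eq hv hu _).
under eq_fun do rewrite form_herm //.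
exact: complex_cvg_conj (ma_ip_cvg hu hv).
Qed.

Lemma ma_ge0 F : ma_space F -> 0 <= ma_ip F F.
Proof.
by move=> [u hu]; apply: (complex_cvg_ge0 (ma_ip_cvg hu hu) _) => n; exact: pK.
Qed.

Lemma ma_norm_le u F (b : R) : represents u F -> 0 <= b ->
  (exists N, forall n, (N <= n)%N -> nrm (u n) <= b) -> ip_norm ma_ip F <= b.
Proof.
move=> hu b0 [N hN]; apply: le_sqrt_sqr => //.
apply: le_trans (ler_norm _) _; apply: le_trans (le_Re_cabs _) _.
apply: (complex_cvg_le (ma_ip_cvg hu hu) _); exists N => n /hN h.
apply: le_trans (form_le_nrm _ _) _; rewrite expr2.
by apply: ler_pM => //; exact: nrm_ge0.
Qed.

Lemma ma_norm_ev a : ip_norm ma_ip (ev K a) = nrm a.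
Proof.
rewrite /ip_norm (ma_ip_eq (represents_cst a) (represents_cst a) (l := form K a a)) //.
exact: cvg_cst.
Qed.

Lemma ma_norm_add F G : ma_space F -> ma_space G ->
  ip_norm ma_ip (fun y => F y + G y) <= ip_norm ma_ip F + ip_norm ma_ip G.
Proof.
move=> hF hG; have := ip_norm_comb ma_comb ma_lin ma_conj ma_ge0 1 hF hG.
rewrite cabs1 mul1r.
rewrite (_ : (fun y => 1 * F y + G y) = (fun y => F y + G y)) //.
by apply/funext => y; rewrite mul1r.
Qed.

Lemma ma_sub F G : ma_space F -> ma_space G -> ma_space (fun y => F y - G y).
Proof.
move=> hF hG; have := ma_comb (-1) hG hF; congr ma_space.
by apply/funext => y; rewrite mulN1r addrC.
Qed.

Lemma ma_norm_subC F G : ma_space F -> ma_space G ->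
  ip_norm ma_ip (fun y => F y - G y) = ip_norm ma_ip (fun y => G y - F y).
Proof.
move=> [u hu] [v hv]; have h := represents_diff hv hu; rewrite /ip_norm.
suff -> : ma_ip (fun y => F y - G y) (fun y => F y - G y) =
  ma_ip (fun y => G y - F y) (fun y => G y - F y) by [].
have hd := represents_diff hu hv; refine (ma_ip_eq hd hd _).
have := ma_ip_cvg h h.
rewrite (_ : (fun n => form K (diffc (v n) (u n)) (diffc (v n) (u n))) =
  (fun n => form K (diffc (u n) (v n)) (diffc (u n) (v n)))) //.
by apply/funext => n; rewrite !form_diffl !form_diffr; ring.
Qed.

Lemma ma_space_ev a : ma_space (ev K a).
Proof. by exists (fun=> a); exact: represents_cst. Qed.

Lemma ma_norm_sub_trans G F L : ma_space F -> ma_space G -> ma_space L ->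
  ip_norm ma_ip (fun y => F y - L y) <=
  ip_norm ma_ip (fun y => F y - G y) + ip_norm ma_ip (fun y => G y - L y).
Proof.
move=> hF hG hL; have := ma_norm_add (ma_sub hF hG) (ma_sub hG hL).
by under eq_fun do rewrite subrKA.
Qed.

Lemma ma_approx F (e : R) : ma_space F -> 0 < e ->
  exists a, ip_norm ma_ip (fun y => F y - ev K a y) < e.
Proof.
move=> [u hu] e0; have e2 : 0 < e / 2 by rewrite divr_gt0.
have [N hN] := hu.1 _ e2; exists (u N).
apply: (@le_lt_trans _ _ (e / 2)); last by rewrite gtr_pMr // invf_lt1 // ltr1n.
apply: (ma_norm_le (represents_diff hu (represents_cst (u N))) (ltW e2) _).
by exists N => n Nn; apply/ltW/hN.
Qed.

(** Each term is replaced by a combination within [1 / (n + 1)] of it. These combinations are again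
    Cauchy, and the function they represent is the limit. *)
Lemma ma_complete (U : nat -> Y -> C) : (forall n, ma_space (U n)) ->
  (forall e : R, 0 < e -> exists N, forall m n, (N <= m)%N -> (N <= n)%N ->
    ip_norm ma_ip (fun y => U m y - U n y) < e) ->
  exists F, ma_space F /\
    ip_norm ma_ip (fun y => U n y - F y) @[n --> \oo] --> (0 : R).
Proof.
move=> hU cU.
have /choice[a ha] : forall n, exists a,
    ip_norm ma_ip (fun y => U n y - ev K a y) < n.+1%:R^-1.
  by move=> n; apply: ma_approx.
have inv_small (e : R) : 0 < e -> exists N, forall n, (N <= n)%N -> n.+1%:R^-1 < e.
  move=> e0; exists (Num.bound e^-1) => n Nn.
  rewrite invf_plt ?posrE //; apply: lt_le_trans (archi_boundP _) _.
    by rewrite invr_ge0 ltW.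
  by rewrite ler_nat (leq_trans Nn).
have ca : cauchy_comb a.
  move=> e e0; have e3 : 0 < e / 3 by rewrite divr_gt0.
  have [N1 h1] := inv_small _ e3; have [N2 h2] := cU _ e3.
  exists (maxn N1 N2) => m n; rewrite !geq_max => /andP[m1 m2] /andP[n1 n2].
  rewrite -ma_norm_ev.
  rewrite (_ : ev K _ = (fun y => ev K (a m) y - ev K (a n) y)); last first.
    by apply/funext => y; exact: ev_diff.
  have t1 := ma_norm_sub_trans (ma_space_ev (a m)) (hU m) (ma_space_ev (a n)).
  rewrite (ma_norm_subC (ma_space_ev (a m)) (hU m)) in t1.
  have t2 := ma_norm_sub_trans (hU m) (hU n) (ma_space_ev (a n)).
  have t3 := lt_trans (ha m) (h1 m m1); have t4 := lt_trans (ha n) (h1 n n1).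
  apply: le_lt_trans t1 _; apply: le_lt_trans (lerD (lexx _) t2) _.
  have -> : e = e / 3 + (e / 3 + e / 3) by field.
  exact: ltrD t3 (ltrD (h2 m n m2 n2) t4).
have [F hF] := cauchy_comb_represents ca; exists F; split; first by exists a.
apply/cvgrPdist_lt => e e0; have e2 : 0 < e / 2 by rewrite divr_gt0.
have e4 : 0 < e / 4 by rewrite divr_gt0.
have [N1 h1] := inv_small _ e2; have [N2 h2] := ca _ e4.
exists (maxn N1 N2) => // n /=; rewrite geq_max => /andP[n1 n2].
rewrite sub0r normrN ger0_norm ?sqrtr_ge0 //.
have hF' : ma_space F by exists a.
apply: le_lt_trans (ma_norm_sub_trans (hU n) (ma_space_ev (a n)) hF') _.
have : ip_norm ma_ip (fun y => ev K (a n) y - F y) <= e / 4.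
  apply: (ma_norm_le (represents_diff (represents_cst (a n)) hF) (ltW e4) _).
  by exists N2 => m m2; apply/ltW/h2.
move=> t1; have t2 := lt_trans (ha n) (h1 n n1).
rewrite [ltRHS]splitr; apply: (ltr_leD t2); apply: le_trans t1 _.
by rewrite ler_wpM2l ?lef_pV2 ?posrE ?ler_nat // ltW.
Qed.

Theorem moore_aronszajn : exists ip, is_rkhs K ma_space ip.
Proof.
have sec y : represents (fun=> [:: (1, y)]) (K ^~ y).
  have := represents_cst [:: (1, y)]; congr represents.
  by apply/funext => t; exact: ev_single.
have rep F y : ma_space F -> ma_ip F (K ^~ y) = F y.
  move=> [u hu]; apply: (ma_ip_eq hu (sec y) _).
  by under eq_fun do rewrite form_single; exact: hu.2.
exists ma_ip; split.
- have := ma_space_ev [::]; congr ma_space.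
  by apply/funext => y; rewrite /ev big_nil.
- exact: ma_comb.
- exact: ma_lin.
- exact: ma_conj.
- exact: ma_ge0.
- move=> F hF F0 y; have hy : ma_space (K ^~ y) by exists (fun=> [:: (1, y)]).
  have := semi_ip_cauchy_schwarz ma_comb ma_lin ma_conj ma_ge0 hF hy.
  rewrite rep // F0 mul0r => h; apply: cabs_eq0; apply/eqP.
  by rewrite -sqrf_eq0 eq_le h sqr_ge0.
- exact: ma_complete.
- by move=> y; exists (fun=> [:: (1, y)]).
- by move=> F y; exact: rep.
- move=> F e hF e0; have [a ha] := ma_approx hF e0.
  exists (size a), (fun i => (tnth (in_tuple a) i).1), (fun i => (tnth (in_tuple a) i).2).
  rewrite (_ : (fun y => _) = (fun y => F y - ev K a y)) //.
  by apply/funext => y; congr (_ - _); rewrite /ev [RHS]big_tnth.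
Qed.

End moore_aronszajn.

(** * Universality and density of the span *)

Lemma hausdorff_prod (X Z : topologicalType) :
  hausdorff_space X -> hausdorff_space Z -> hausdorff_space (X * Z)%type.
Proof.
move=> hX hZ [x z] [x' z'] h.
have cf : continuous (fst : X * Z -> X) by move=> w; exact: cvg_fst.
have cs : continuous (snd : X * Z -> Z) by move=> w; exact: cvg_snd.
congr (_, _).
- apply: hX => A B nA nB.
  have [[a b] [/= Aa Ba]] := h _ _ (cf (x, z) A nA) (cf (x', z') B nB).
  by exists a.
- apply: hZ => A B nA nB.
  have [[a b] [/= Aa Ba]] := h _ _ (cs (x, z) A nA) (cs (x', z') B nB).
  by exists b.
Qed.

Lemma within_continuousP (R : realType) (Y : ptopologicalType) (A : set Y)
    (f : Y -> Cplx R) : {within A, continuous f} <->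
  forall x, A x -> forall e : R, 0 < e ->
    \forall y \near x, A y -> cabs (f y - f x) < e.
Proof.
split.
  move/subspace_continuousP => h x Ax e e0.
  by have /complex_cvgP /(_ e e0) := h x Ax; apply.
by move=> h; apply/subspace_continuousP => x Ax; apply/complex_cvgP => e e0; exact: h.
Qed.

Section span_dense.
Context (R : realType) (Y : ptopologicalType).
Local Notation C := (Cplx R).
Implicit Types (K : Y -> Y -> C).

(** Universality freed from the Hilbert space: approximation by finite combinations of sections
    only. *)
Definition span_dense K := forall (A : set Y) (f : Y -> C) (e : R),
  compact A -> {within A, continuous f} -> 0 < e ->
  exists a : seq (C * Y), forall x, A x -> cabs (ev K a x - f x) < e.

(** Forwards, the norm of the space controls the sup norm. Backwards, combinations of sections have
    to be members of [rkhs K], which [moore_aronszajn] provides. *)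
Lemma universal_span_dense K : bounded_kernel K -> continuous_kernel K -> psd K ->
  universal K <-> span_dense K.
Proof.
move=> bK cK pK; split.
  move=> [_ _ uK] A f e cA cf e0; have e2 : 0 < e / 2 by rewrite divr_gt0.
  have [F [H [ip [hH HF]]] hF] := uK A f _ cA cf e2.
  have [n [c [x h]]] := rkhs_uniform_approx bK hH HF e2.
  exists [seq (c i, x i) | i <- enum 'I_n] => y Ay.
  rewrite /ev big_map big_enum; apply: le_lt_trans (cabsB_trans (F y) _ _) _.
  by rewrite [ltRHS]splitr; apply: ltrD; [rewrite cabsBC|]; [exact: h|exact: hF].
move=> sK; split; first exact/positive_definite_psd.
  exact: continuous_rkhs_continuous.
move=> A f e cA cf e0; have [a ha] := sK A f e cA cf e0.
exists (ev K a) => //; have [ip hip] := moore_aronszajn pK.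
by exists (ma_space K), ip; split => //; exact: ma_space_ev.
Qed.

Lemma ev_continuous K a : continuous_kernel K -> continuous (ev K a).
Proof.
move=> cK y; apply: complex_cvg_sum => u; apply: cvgM; first exact: cvg_cst.
exact: continuous_kernell.
Qed.

(* Truncating a function of the span that approximates the indicator of [C']
   on [C' `|` D]. *)
Lemma span_dense_separation K (C' D : set Y) : hausdorff_space Y ->
  continuous_kernel K -> span_dense K -> compact C' -> compact D ->
  C' `&` D = set0 ->
  exists phi : Y -> R, [/\ continuous phi, forall y, 0 <= phi y <= 1,
    forall x, C' x -> \forall y \near x, phi y = 1 & forall x, D x -> phi x = 0].
Proof.
move=> hY cK sK cC cD CD.
have clC := compact_closed hY cC; have clD := compact_closed hY cD.
have cf : {within C' `|` D, continuous (\1_C' : Y -> C)}.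
  apply/within_continuousP => x [Cx|Dx] e e0.
  - have nDx : (~` D) x by move=> Dx; have : (C' `&` D) x by []; rewrite CD.
    have := open_nbhs_nbhs (conj (closed_openC clD) nDx); apply: filterS => y nDy [Cy|//].
    by rewrite !indicE !mem_set // subrr cabs0.
  - have nCx : (~` C') x by move=> Cx; have : (C' `&` D) x by []; rewrite CD.
    have := open_nbhs_nbhs (conj (closed_openC clC) nCx); apply: filterS => y nCy _.
    by rewrite !indicE !memNset // subrr cabs0.
have e4 : 0 < 4^-1 :> R by rewrite invr_gt0.
have [a ha] := sK _ _ _ (compactU cC cD) cf e4.
(* An approximation of the indicator within [1 / 4] has real part above [3 / 4] on [C'] and below
   [1 / 4] on [D]; this affine map sends these beyond 1 and below 0, so that truncation to [[0, 1]]
   is exact, even near the points of [C']. *)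
pose g y := complex.Re (ev K a y) * 2 - 2^-1.
have cg : continuous g.
  move=> y; apply: cvgB; last exact: cvg_cst.
  by apply: cvgMl; apply: continuous_Re; exact: ev_continuous.
have gC x : C' x -> 1 < g x.
  move=> Cx; have := le_lt_trans (le_Re_cabs _) (ha x (or_introl Cx)).
  by rewrite indicE mem_set // raddfB /= ltr_norml /g => /andP[]; lra.
have gD x : D x -> g x < 0.
  move=> Dx; have nCx : ~ C' x by move=> Cx; have : (C' `&` D) x by []; rewrite CD.
  have := le_lt_trans (le_Re_cabs _) (ha x (or_intror Dx)).
  by rewrite indicE memNset // raddfB /= ltr_norml /g => /andP[]; lra.
exists (fun y => Num.min 1 (Num.max 0 (g y))); split.
- move=> y; apply: (@continuous_min _ _ (fun=> 1) (fun y => Num.max 0 (g y))).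
    exact: cvg_cst.
  by apply: (@continuous_max _ _ (fun=> 0) g); [exact: cvg_cst|exact: cg].
- by move=> y; rewrite le_min ler01 le_max lexx /= ge_min lexx.
- move=> x Cx; have /cvgrPdist_lt := cg x.
  have g1 : 0 < g x - 1 by rewrite subr_gt0 gC.
  move=> /(_ _ g1); apply: filterS => y; rewrite ltr_norml => /andP[h1 h2].
  by rewrite max_r ?min_l //; lra.
- by move=> x /gD/ltW gx; rewrite max_l // min_r.
Qed.

(** By regularity a bump function replaces the indicator of [E], and on the compact support the bump
    is close to a combination of sections, whose integral is 0. Off the support that combination is
    uncontrolled but bounded, and the mass there is 0. *)
Lemma span_dense_null K (lam : cmeasure (borel Y) R) : hausdorff_space Y ->
  bounded_kernel K -> continuous_kernel K -> span_dense K -> radon_compact lam ->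
  (forall y, kernel_mean K lam y = 0) -> cm_null lam.
Proof.
move=> hY bK cK sK [rl cS] k0 E mE; apply: cabs_small0 => e e0.
have [M M0 KM] := bounded_kernel_ge0 bK.
have bk y := kernel_bmeasl bK cK y.
have bev a : bmeas (ev K a : borel Y -> C).
  by apply: bmeas_sum => u _; apply: bmeasM; [exact: bmeas_cst|exact: bk].
have int0 a : cintegral lam (ev K a : borel Y -> C) = 0.
  rewrite cintegral_sum => [|u _]; last by apply: bmeasM; [exact: bmeas_cst|exact: bk].
  by rewrite big1 // => u _; rewrite cintegralZ // [cintegral _ _]k0 mulr0.
have m0 := massr_ge0 lam setT.
(* Chosen so that the errors [4 * d] of [h1] and [2 * d * massr lam setT] of [h2] add up to [e]. *)
pose d := e / (2 * (2 + massr lam setT)).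
have d0 : 0 < d by rewrite divr_gt0 //; lra.
have [C' [cC CE mC]] := radon_tight hY rl mE d0.
have [D [cD DE mD]] := radon_tight hY rl (measurableC mE) d0.
have CD : C' `&` D = set0 by rewrite -subset0 => x [/CE Ex /DE].
have [phi [cphi phi01 phiC phiD]] := span_dense_separation hY cK sK cC cD CD.
pose f y : C := (phi y)%:C.
have cf : continuous f.
  move=> y; apply/complex_cvgP => r r0.
  move/cvgrPdist_lt : (cphi y) => /(_ r r0); apply: filterS => z.
  by rewrite /f -complexN -complexD cabs_real distrC.
have fb y : cabs (f y) <= 1.
  by rewrite cabs_real; have /andP[p0 p1] := phi01 y; rewrite ger0_norm.
have bf : bmeas (f : borel Y -> C) := continuous_bmeas cf fb.
have mC' := borel_compact hY cC; have mD' := borel_compact hY cD.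
have mEC := measurableD mE mC'; have mED := measurableD (measurableC mE) mD'.
have mN := measurableU _ _ mEC mED.
set N := (E `\` C') `|` (~` E `\` D) in mN.
have sub (g h : borel Y -> C) : bmeas g -> bmeas h -> bmeas (fun x => g x - h x).
  move=> bg bh; have := bmeasD bg (bmeasM (bmeas_cst _ (-1 : C)) bh).
  rewrite (_ : (fun x => g x + -1 * h x) = (fun x => g x - h x)) //.
  by apply/funext => x; rewrite mulN1r.
have h1 : cabs (cm_val lam E - cintegral lam (f : borel Y -> C)) <= 4 * d.
  rewrite -cintegral_indic // -cintegralB //; last exact: bmeas_indic.
  have bI := sub _ _ (bmeas_indic R mE) bf.
  apply: le_trans (@cintegral_bound _ _ _ lam _ 0 1 N bI mN _) _.
    move=> x; rewrite add0r mul1r; have := phi01 x => /andP[p0 p1].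
    have [Nx|nNx] := pselect (N x).
      rewrite [\1_N _]indicE mem_set // indic_real /f -complexN -complexD cabs_real indicE.
      by case: (x \in E); rewrite ler_norml /=; apply/andP; split; lra.
    rewrite [\1_N _]indicE memNset // indicE.
    have [Ex|nEx] := pselect (E x).
      have Cx : C' x by apply: contrapT => nC; apply: nNx; left.
      by rewrite mem_set // /f (nbhs_singleton (phiC x Cx)) subrr cabs0.
    have Dx : D x by apply: contrapT => nD; apply: nNx; right.
    by rewrite memNset // /f phiD // subrr cabs0.
  rewrite mul0r add0r mul1r.
  have : massr lam N <= massr lam (E `\` C') + massr lam (~` E `\` D).
    rewrite -(massrD lam mN mEC); apply: lerD; apply: le_massr => //.
    - exact: measurableI.
    - exact: measurableD.
    - by move=> x [[]].
  move: mC mD; lra.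
have [a ha] := sK _ _ _ cS (continuous_subspaceT cf (A := support lam)) d0.
have [B B0 hB] := bmeas_bounded (sub _ _ bf (bev a)).
have mS : measurable (~` support lam : set (borel Y)).
  by apply: borel_open; apply: closed_openC; exact: support_closed.
have h2 : cabs (cintegral lam (f : borel Y -> C)) <= 2 * d * massr lam setT.
  have <- : cintegral lam (fun x : borel Y => f x - ev K a x) =
      cintegral lam (f : borel Y -> C).
    by rewrite cintegralB // int0 subr0.
  apply: le_trans (@cintegral_bound _ _ _ lam _ d B _ (sub _ _ bf (bev a)) mS _) _.
    move=> x; have [Sx|nSx] := pselect (support lam x).
      rewrite cabsBC; apply: le_trans (ltW (ha x Sx)) _.
      by rewrite lerDl mulr_ge0 // indicE; case: (_ \in _).
    rewrite indicE mem_set // mulr1; apply: le_trans (hB x) _.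
    by rewrite lerDr ltW.
  by rewrite massr_setC_support // mulr0 addr0 mulrA.
rewrite -[cm_val lam E](subrK (cintegral lam (f : borel Y -> C))).
apply: le_trans (cabsD _ _) _; apply: le_trans (lerD h1 h2) _.
rewrite /d; move: (massr lam setT) m0 => m m0.
rewrite (_ : _ + _ = e) //; field; rewrite ?mulf_neq0 ?pnatr_eq0 ?gt_eqF //; lra.
Qed.

End span_dense.

(** * Tensor kernels *)

Section tensor.
Context (R : realType) (X Z : ptopologicalType).
Local Notation C := (Cplx R).
Variables (p : X -> X -> C) (q : Z -> Z -> C).

Lemma tensor_bounded : bounded_kernel p -> bounded_kernel q ->
  bounded_kernel (tensor_kernel p q).
Proof.
move=> [M pM] [N qN]; exists (M * N) => s t; rewrite cabsM.
by apply: ler_pM; rewrite ?cabs_ge0.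
Qed.

Lemma tensor_continuous : continuous_kernel p -> continuous_kernel q ->
  continuous_kernel (tensor_kernel p q).
Proof.
move=> cp cq [s t].
have c1 : continuous (fun w : (X * Z) * (X * Z) => w.1.1).
  by move=> w; apply: (cvg_comp fst fst); exact: cvg_fst.
have c2 : continuous (fun w : (X * Z) * (X * Z) => w.2.1).
  by move=> w; apply: (cvg_comp snd fst); [exact: cvg_snd|exact: cvg_fst].
have c3 : continuous (fun w : (X * Z) * (X * Z) => w.1.2).
  by move=> w; apply: (cvg_comp fst snd); [exact: cvg_fst|exact: cvg_snd].
have c4 : continuous (fun w : (X * Z) * (X * Z) => w.2.2).
  by move=> w; apply: (cvg_comp snd snd); exact: cvg_snd.
exact: (cvgM (continuous_kernel_comp cp c1 c2 (x := (s, t)))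
             (continuous_kernel_comp cq c3 c4 (x := (s, t)))).
Qed.

Lemma tensor_psd : psd p -> psd q -> psd (tensor_kernel p q).
Proof. by move=> pp pq w; exact: form_tensor_ge0. Qed.

(** The bound 1 on the factors is preserved by products and makes the error of a product of
    approximations explicit; scalars enter through the last constructor. *)
Inductive tensor_algebra : (X * Z -> C) -> Prop :=
| tensor_algebra0 : tensor_algebra (fun=> 0)
| tensor_algebra_elem phi psi : continuous phi -> continuous psi ->
    (forall x, cabs (phi x) <= 1) -> (forall z, cabs (psi z) <= 1) ->
    tensor_algebra (fun w => phi w.1 * psi w.2)
| tensor_algebraD t g h : tensor_algebra g -> tensor_algebra h ->
    tensor_algebra (fun w => t * g w + h w).

Lemma tensor_algebraM phi psi g : continuous phi -> continuous psi ->
  (forall x, cabs (phi x) <= 1) -> (forall z, cabs (psi z) <= 1) ->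
  tensor_algebra g -> tensor_algebra (fun w => phi w.1 * psi w.2 * g w).
Proof.
move=> cphi cpsi bphi bpsi; elim=> [|phi' psi' cphi' cpsi' bphi' bpsi'|t g1 g2 _ h1 _ h2].
- rewrite (_ : (fun w => _) = (fun=> 0)); first exact: tensor_algebra0.
  by apply/funext => w; rewrite mulr0.
- rewrite (_ : (fun w => _) =
    (fun w : X * Z => (phi w.1 * phi' w.1) * (psi w.2 * psi' w.2))); last first.
    by apply/funext => w; ring.
  apply: (tensor_algebra_elem (phi := fun x => phi x * phi' x)
    (psi := fun z => psi z * psi' z)).
  + by move=> x; exact: cvgM (cphi x) (cphi' x).
  + by move=> x; exact: cvgM (cpsi x) (cpsi' x).
  + by move=> x; rewrite cabsM mulr_ile1 ?cabs_ge0.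
  + by move=> x; rewrite cabsM mulr_ile1 ?cabs_ge0.
- rewrite (_ : (fun w => _) = (fun w : X * Z => t * (phi w.1 * psi w.2 * g1 w) +
    phi w.1 * psi w.2 * g2 w)); last by apply/funext => w; ring.
  exact: tensor_algebraD.
Qed.

Definition tensorc (a : seq (C * X)) (b : seq (C * Z)) : seq (C * (X * Z)) :=
  [seq (u.1 * v.1, (u.2, v.2)) | u <- a, v <- b].

Lemma ev_tensor a b w :
  ev (tensor_kernel p q) (tensorc a b) w = ev p a w.1 * ev q b w.2.
Proof.
rewrite /ev /tensorc big_allpairs_dep mulr_suml; apply: eq_bigr => u _.
by rewrite big_distrr /=; apply: eq_bigr => v _; rewrite /tensor_kernel /=; ring.
Qed.

Lemma tensor_algebra_approx (A : set (X * Z)) g : span_dense p -> span_dense q ->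
  compact A -> tensor_algebra g -> forall e : R, 0 < e ->
  exists a, forall w, A w -> cabs (ev (tensor_kernel p q) a w - g w) < e.
Proof.
move=> sp sq cA.
have cf : continuous (fst : X * Z -> X) by move=> w; exact: cvg_fst.
have cs : continuous (snd : X * Z -> Z) by move=> w; exact: cvg_snd.
have cA1 : compact (fst @` A).
  by apply: continuous_compact => //; exact: continuous_subspaceT.
have cA2 : compact (snd @` A).
  by apply: continuous_compact => //; exact: continuous_subspaceT.
elim=> [|phi psi cphi cpsi bphi bpsi|t g1 g2 _ h1 _ h2] e e0.
- by exists [::] => w _; rewrite /ev big_nil subr0 cabs0.
- pose d := Num.min 1 (e / 4).
  have d0 : 0 < d by rewrite lt_min ltr01 divr_gt0.
  have d1 : d <= 1 by rewrite ge_min lexx.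
  have d4 : d <= e / 4 by rewrite ge_min lexx orbT.
  have [a ha] := sp _ _ _ cA1 (continuous_subspaceT cphi (A := fst @` A)) d0.
  have [b hb] := sq _ _ _ cA2 (continuous_subspaceT cpsi (A := snd @` A)) d0.
  exists (tensorc a b) => w Aw; rewrite ev_tensor.
  have {}ha := ha w.1 (ex_intro2 _ _ w Aw erefl).
  have {}hb := hb w.2 (ex_intro2 _ _ w Aw erefl).
  have -> : ev p a w.1 * ev q b w.2 - phi w.1 * psi w.2 =
    (ev p a w.1 - phi w.1) * (ev q b w.2 - psi w.2) +
    (phi w.1 * (ev q b w.2 - psi w.2) + (ev p a w.1 - phi w.1) * psi w.2) by ring.
  apply: le_lt_trans (cabsD _ _) _.
  apply: le_lt_trans (lerD (lexx _) (cabsD _ _)) _; rewrite !cabsM.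
  have x1 := bphi w.1; have y1 := bpsi w.2.
  have x0 := cabs_ge0 (phi w.1); have y0 := cabs_ge0 (psi w.2).
  have s0 := cabs_ge0 (ev p a w.1 - phi w.1); have r0 := cabs_ge0 (ev q b w.2 - psi w.2).
  move: (cabs (phi w.1)) (cabs (psi w.2)) (cabs (ev p a w.1 - phi w.1))
    (cabs (ev q b w.2 - psi w.2)) ha hb x1 y1 x0 y0 s0 r0.
  move=> x y s r sd rd x1 y1 x0 y0 s0 r0.
  have : s * r <= 1 * r by rewrite ler_wpM2r // (le_trans (ltW sd)).
  have : x * r <= 1 * r by rewrite ler_wpM2r.
  have : s * y <= s * 1 by rewrite ler_wpM2l.
  lra.
- have t1 : 0 < 2 * (cabs t + 1) by have := cabs_ge0 t; lra.
  have e2 : 0 < e / 2 by rewrite divr_gt0.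
  have [a ha] := h1 _ (divr_gt0 e0 t1); have [b hb] := h2 _ e2.
  exists (scalec t a ++ b) => w Aw; rewrite ev_cat ev_scale.
  have -> : t * ev (tensor_kernel p q) a w + ev (tensor_kernel p q) b w - (t * g1 w + g2 w) =
    t * (ev (tensor_kernel p q) a w - g1 w) + (ev (tensor_kernel p q) b w - g2 w) by ring.
  apply: le_lt_trans (cabsD _ _) _; rewrite cabsM.
  have := ha w Aw; rewrite ltr_pdivlMr // => ha'; have hb' := hb w Aw.
  have := cabs_ge0 (ev (tensor_kernel p q) a w - g1 w).
  move: ha' hb'; move: (cabs _) (cabs _) (cabs _) => x y z; lra.
Qed.

(* With bumps [h_i] that are 1 near the points of a finite cover, the telescoping
   products [h_i * \prod_(j < i) (1 - h_j)] form a partition of unity on [A]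
   inside the tensor algebra. *)
Lemma tensor_span_dense : hausdorff_space X -> hausdorff_space Z ->
  continuous_kernel p -> continuous_kernel q -> span_dense p -> span_dense q ->
  span_dense (tensor_kernel p q).
Proof.
move=> hX hZ cp cq sp sq A f e cA /within_continuousP wf e0.
have cf : continuous (fst : X * Z -> X) by move=> w; exact: cvg_fst.
have cs : continuous (snd : X * Z -> Z) by move=> w; exact: cvg_snd.
have cA1 : compact (fst @` A).
  by apply: continuous_compact => //; exact: continuous_subspaceT.
have cA2 : compact (snd @` A).
  by apply: continuous_compact => //; exact: continuous_subspaceT.
have e2 : 0 < e / 2 by rewrite divr_gt0.
have /choice[B hB] : forall s : X * Z, exists b : (X -> R) * (Z -> R), A s ->
    [/\ continuous b.1 /\ continuous b.2,
      (forall x, 0 <= b.1 x <= 1) /\ (forall z, 0 <= b.2 z <= 1),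
      \forall w \near s, b.1 w.1 = 1 /\ b.2 w.2 = 1 &
      forall w, A w -> b.1 w.1 * b.2 w.2 != 0 -> cabs (f w - f s) <= e / 2].
  move=> [x z]; have [Axz|nA] := pselect (A (x, z)); last by exists (fun=> 0, fun=> 0).
  have [[U V] /= [nU nV] UV] := wf _ Axz _ e2.
  (* Only points of [A] matter, so the bumps need to vanish only on the parts of the compact
     projections of [A] outside the neighbourhoods. *)
  have cD1 : compact (fst @` A `\` U°).
    apply: (subclosed_compact _ cA1); last by move=> ? [].
    rewrite setDE; apply: closedI; first exact: compact_closed.
    by apply: open_closedC; exact: open_interior.
  have cD2 : compact (snd @` A `\` V°).
    apply: (subclosed_compact _ cA2); last by move=> ? [].
    rewrite setDE; apply: closedI; first exact: compact_closed.
    by apply: open_closedC; exact: open_interior.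
  have [|phi [cphi phi01 phi1 phi0]] :=
    @span_dense_separation R X p [set x] (fst @` A `\` U°) hX cp sp (@compact_set1 _ x) cD1.
    by rewrite -subset0 => y [-> [_ nUx]]; apply: nUx; exact: nU.
  have [|psi [cpsi psi01 psi1 psi0]] :=
    @span_dense_separation R Z q [set z] (snd @` A `\` V°) hZ cq sq (@compact_set1 _ z) cD2.
    by rewrite -subset0 => y [-> [_ nVz]]; apply: nVz; exact: nV.
  exists (phi, psi) => _; split => //=.
  - exists ([set x | phi x = 1], [set z | psi z = 1]) => //=.
    by split; [exact: phi1|exact: psi1].
  - move=> w Aw; rewrite mulf_eq0 negb_or => /andP[h1 h2].
    apply/ltW; apply: (UV w) => //; split.
      apply: interior_subset; apply: contrapT => nU1; move/eqP: h1; apply.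
      by apply: phi0; split => //; exists w.
    apply: interior_subset; apply: contrapT => nV1; move/eqP: h2; apply.
    by apply: psi0; split => //; exists w.
have [||l lA Al] := @compact_finite_cover _ _ A
  (fun s => interior [set w | (B s).1 w.1 = 1 /\ (B s).2 w.2 = 1]) A cA.
- by move=> s _; exact: open_interior.
- by move=> s As; exists s => //; have [_ _ + _] := hB s As.
pose h s w := (B s).1 w.1 * (B s).2 w.2.
(* With [h s w] in [[0, 1]] this is a convex combination of [f s] and the value for the rest of the
   list. *)
pose F := fix F l w : C := if l is s :: l' then
  f s * (h s w)%:C + (F l' w - (h s w)%:C * F l' w) else 0.
have FT m : (forall s, s \in m -> A s) -> tensor_algebra (F m).
  elim: m => [_|s m IH mA]; first exact: tensor_algebra0.
  have [[c1 c2] [b1 b2] _ _] := hB s (mA s (mem_head _ _)).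
  have cc (T : ptopologicalType) (u : T -> R) : continuous u ->
      continuous (fun x => (u x)%:C : C).
    move=> cu y; apply/complex_cvgP => r r0.
    move/cvgrPdist_lt : (cu y) => /(_ r r0); apply: filterS => y'.
    by rewrite -complexN -complexD cabs_real distrC.
  have bb (T : Type) (u : T -> R) : (forall x, 0 <= u x <= 1) ->
      forall x, cabs ((u x)%:C : C) <= 1.
    by move=> u01 x; rewrite cabs_real; have /andP[u0 u1] := u01 x; rewrite ger0_norm.
  have Fm : tensor_algebra (F m).
    by apply: IH => t tm; apply: mA; rewrite inE tm orbT.
  have Fh := tensor_algebraM (cc _ _ c1) (cc _ _ c2) (bb _ _ b1) (bb _ _ b2) Fm.
  have hh := tensor_algebra_elem (cc _ _ c1) (cc _ _ c2) (bb _ _ b1) (bb _ _ b2).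
  have := tensor_algebraD (f s) hh (tensor_algebraD (-1) Fh Fm).
  rewrite (_ : (fun w => _) = F (s :: m)) //; apply/funext => w /=.
  by rewrite /h complexM; ring.
(* A bump equal to 1 at [w] cuts off the rest of the list, and with it the final 0; every value
   [f s] given positive weight is within [e / 2] of [f w]. *)
have Fe m w : (forall s, s \in m -> A s) -> A w ->
    (exists2 s, s \in m & h s w = 1) -> cabs (F m w - f w) <= e / 2.
  move=> + Aw; elim: m => [_ []//|s m IH mA cov] /=.
  have As := mA s (mem_head _ _); have [_ [b1 b2] _ hs] := hB s As.
  have sw : h s w != 0 -> cabs (f s - f w) <= e / 2.
    by move=> h0; rewrite cabsBC; exact: hs.
  have [h1|h1] := eqVneq (h s w) 1.
    rewrite h1 mulr1 mul1r subrr addr0; apply: sw; rewrite h1; exact: oner_neq0.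
  have cov' : exists2 s, s \in m & h s w = 1.
    by case: cov => t; rewrite inE => /predU1P[-> /eqP|tm ht]; [rewrite (negPf h1)|exists t].
  have {}IH := IH (fun t tm => mA t (mem_behead (s := s :: m) tm)) cov'.
  have [h00 h11] : 0 <= h s w /\ h s w <= 1.
    have /andP[x0 x1] := b1 w.1; have /andP[y0 y1] := b2 w.2.
    by rewrite mulr_ge0 // mulr_ile1.
  have -> : f s * (h s w)%:C + (F m w - (h s w)%:C * F m w) - f w =
    (h s w)%:C * (f s - f w) + (1 - h s w)%:C * (F m w - f w).
    by rewrite complexD complexN; ring.
  apply: le_trans (cabsD _ _) _; rewrite !cabsM !cabs_real !ger0_norm ?subr_ge0 //.
  have h2 : h s w * cabs (f s - f w) <= h s w * (e / 2).
    have [->|h0] := eqVneq (h s w) 0; first by rewrite !mul0r.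
    by rewrite ler_wpM2l // sw.
  have h3 : (1 - h s w) * cabs (F m w - f w) <= (1 - h s w) * (e / 2).
    by rewrite ler_wpM2l // subr_ge0.
  by apply: le_trans (lerD h2 h3) _; rewrite -mulrDl addrC subrK mul1r.
have [a ha] := tensor_algebra_approx sp sq cA (FT l lA) e2.
exists a => w Aw; apply: le_lt_trans (cabsB_trans (F l w) _ _) _.
rewrite [ltRHS]splitr; apply: ltr_leD; first exact: ha.
apply: Fe => //; have [s sl /interior_subset [w1 w2]] := Al w Aw.
by exists s; rewrite // /h w1 w2 mulr1.
Qed.

(** On the product of [A] with one point, a combination for the tensor kernel is one for [p], with
    the values of [q] absorbed into the coefficients. *)
Lemma span_dense_tensorl : span_dense (tensor_kernel p q) -> span_dense p.
Proof.
move=> s A f e cA /within_continuousP wf e0.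
have cAz := compact_setX cA (@compact_set1 _ (point : Z)).
have wg : {within A `*` [set point], continuous (fun w : X * Z => f w.1)}.
  apply/within_continuousP => -[x z] [/= Ax _] r r0.
  have cf : continuous (fst : X * Z -> X) by move=> w; exact: cvg_fst.
  have h0 : \forall w \near (x, z), A w.1 -> cabs (f w.1 - f x) < r.
    exact: (cf (x, z) _ (wf x Ax r r0)).
  by apply: filterS h0 => w h [/= Aw _]; exact: h.
have [a ha] := s _ _ _ cAz wg e0.
exists [seq (u.1 * q point u.2.2, u.2.1) | u <- a] => x Ax.
have := ha (x, point) (conj Ax erefl); rewrite /= /ev big_map.
rewrite (eq_bigr (fun u => u.1 * q point u.2.2 * p x u.2.1)) // => u _.
by rewrite /tensor_kernel /=; ring.
Qed.

Lemma span_dense_tensorr : span_dense (tensor_kernel p q) -> span_dense q.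
Proof.
move=> s A f e cA /within_continuousP wf e0.
have cAz := compact_setX (@compact_set1 _ (point : X)) cA.
have wg : {within [set point] `*` A, continuous (fun w : X * Z => f w.2)}.
  apply/within_continuousP => -[x z] [/= _ Az] r r0.
  have cf : continuous (snd : X * Z -> Z) by move=> w; exact: cvg_snd.
  have h0 : \forall w \near (x, z), A w.2 -> cabs (f w.2 - f z) < r.
    exact: (cf (x, z) _ (wf z Az r r0)).
  by apply: filterS h0 => w h [/= _ Aw]; exact: h.
have [a ha] := s _ _ _ cAz wg e0.
exists [seq (u.1 * p point u.2.1, u.2.2) | u <- a] => z Az.
have := ha (point, z) (conj erefl Az); rewrite /= /ev big_map.
rewrite (eq_bigr (fun u => u.1 * p point u.2.1 * q z u.2.2)) // => u _.
by rewrite /tensor_kernel /=; ring.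
Qed.

End tensor.

(** * Discrete measures and slices *)

Section discrete.
Context (R : realType) (Y : ptopologicalType).
Local Notation C := (Cplx R).
Implicit Types (K : Y -> Y -> C) (lam : cmeasure (borel Y) R).

Lemma discrete_cintegral lam n (c : 'I_n -> C) (x : 'I_n -> Y) :
  (forall E : set (borel Y), measurable E ->
    cm_val lam E = \sum_(i < n) c i * \1_E (x i)) ->
  forall f : borel Y -> C, bmeas f -> cintegral lam f = \sum_(i < n) c i * f (x i).
Proof.
move=> lamE; apply: (@cintegral_unique _ _ _ lam (fun f => \sum_(i < n) c i * f (x i))
  (\sum_(i < n) cabs (c i))) => [a f g bf bg|E mE|f b bf b0 fb].
- by rewrite big_distrr -big_split; apply: eq_bigr => i _ /=; ring.
- by rewrite lamE.
- apply: le_trans (cabs_sum _ _ _) _; rewrite mulr_suml; apply: ler_sum => i _.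
  by rewrite cabsM ler_wpM2l ?cabs_ge0.
Qed.

(** With conjugated weights, [ev K a] is the conjugate of the kernel mean and vanishes. The atoms
    may be listed with repetitions, so only merged coefficients are known to be 0, which suffices
    for the values of [lam]. *)
Lemma SPD_discrete_null K lam : hausdorff_space Y ->
  bounded_kernel K -> continuous_kernel K -> psd K -> SPD K ->
  discrete_measure lam -> double_integral (K : borel Y -> borel Y -> C) lam = 0 ->
  cm_null lam.
Proof.
move=> hY bK cK pK sK dl; have rl := (discrete_radon_compact hY dl).1.
have [n [c [x lamE]]] := dl.
move/(double_integral_eq0 hY bK cK pK rl) => k0 E mE.
pose a := [seq ((c i)^*, x i) | i <- enum 'I_n].
have ev0 y : ev K a y = 0.
  rewrite -[LHS]conjCK -[RHS]conjC0 -(k0 y); congr (_^*).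
  rewrite /kernel_mean (discrete_cintegral lamE (kernel_bmeasl bK cK y)).
  rewrite /ev big_map big_enum conjC_sum; apply: eq_bigr => i _.
  by rewrite conjCM conjCK -(psd_herm _ _ pK).
have form0 : form K a a = 0.
  by rewrite formE big1 // => u _; rewrite ev0 mulr0.
have sa := @sum_coefc _ _ a (undup [seq u.2 | u <- a]) (fun y => \1_E y) (undup_uniq _).
rewrite lamE // -[LHS]conjCK conjC_sum.
have -> : \sum_(i < n) (c i * \1_E (x i))^* = \sum_(u <- a) u.1 * \1_E u.2.
  rewrite /a big_map big_enum; apply: eq_bigr => i _; rewrite conjCM; congr (_ * _).
  by rewrite indic_real conjC_real.
rewrite sa => [|u ua]; last by rewrite mem_undup; apply/mapP; exists u.
by rewrite big1 ?conjC0 // => y _; rewrite (SPD_coefc y sK form0) mul0r.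
Qed.

End discrete.

(** * Slices, and measures vanishing on rectangles *)

Section slices.
Context (R : realType) (X Z : ptopologicalType).
Local Notation C := (Cplx R).
Variable lam : cmeasure (borel (X * Z)%type) R.

Lemma fst_continuous : continuous (fst : X * Z -> X).
Proof. by move=> w; exact: cvg_fst. Qed.

Lemma snd_continuous : continuous (snd : X * Z -> Z).
Proof. by move=> w; exact: cvg_snd. Qed.

(** The factor 1 brings the bound into the form that [radon_dominated] takes. *)
Lemma slice_dominated (A : set (borel X)) (mA : measurable A) (B : set (borel Z)) :
  measurable B ->
  cabs (cm_val (slice lam mA) B) <= 1 * massr lam ((snd : X * Z -> Z) @^-1` B).
Proof.
move=> mB; have mAB := borel_setX mA mB; rewrite mul1r.
apply: le_trans (le_cm_val_massr lam mAB) _; apply: le_massr => //.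
- exact: borel_continuous snd_continuous mB.
- by move=> w [].
Qed.

Lemma slice_cintegral (A : set (borel X)) (mA : measurable A) (f : borel Z -> C) :
  bmeas f -> cintegral (slice lam mA) f =
  cintegral lam (fun w : borel (X * Z)%type => \1_A w.1 * f w.2).
Proof.
have bA : bmeas (fun w : borel (X * Z)%type => \1_A w.1 : C).
  exact: (bmeas_comp (continuous_borel_fun fst_continuous) (bmeas_indic R mA)).
have bs (g : borel Z -> C) : bmeas g -> bmeas (fun w : borel (X * Z)%type => g w.2).
  by move=> bg; exact: (bmeas_comp (continuous_borel_fun snd_continuous) bg).
apply: (@cintegral_unique _ _ _ (slice lam mA) (fun f : borel Z -> C =>
    cintegral lam (fun w : borel (X * Z)%type => \1_A w.1 * f w.2))
    (2 * massr lam setT)) => [a g h bg bh|B mB|g b bg b0 gb].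
- rewrite -cintegral_lin; do ?[exact: bmeasM bA (bs _ _)].
  by congr cintegral; apply/funext => w; ring.
- have -> : cm_val (slice lam mA) B = cm_val lam (A `*` B) by [].
  rewrite -cintegral_indic; last exact: borel_setX.
  congr cintegral; apply/funext => w; rewrite !indicE in_setX.
  by case: (_ \in A); case: (_ \in B); rewrite ?mul1r ?mul0r.
- rewrite mulrAC; apply: cintegral_sup; first exact: bmeasM bA (bs _ bg).
  move=> w; rewrite cabsM indicE.
  by case: (_ \in A); rewrite ?cabs1 ?mul1r ?cabs0 ?mul0r.
Qed.

Lemma slice_discrete (A : set (borel X)) (mA : measurable A) :
  discrete_measure lam -> discrete_measure (slice lam mA).
Proof.
move=> [n [c [x lamE]]].
exists n, (fun i => c i * \1_A (x i).1), (fun i => (x i).2) => B mB.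
have -> : cm_val (slice lam mA) B = cm_val lam (A `*` B) by [].
rewrite lamE; last exact: borel_setX.
apply: eq_bigr => i _; rewrite -mulrA !indicE in_setX.
by case: (_ \in A); case: (_ \in B); rewrite ?mul1r ?mul0r.
Qed.

(** Rectangles are stable under intersection. Splitting along the first box [b] leaves a rectangle
    inside [b]; the part outside is the difference of two sets of the same kind for the shorter
    list, one of them inside the smaller rectangle. Hence the induction for all [A] and [B] at
    once. *)
Lemma setX_union_null (l : seq (set X * set Z)) (A : set (borel X)) (B : set (borel Z)) :
  (forall (A : set (borel X)) (B : set (borel Z)), measurable A -> measurable B ->
     cm_val lam (A `*` B) = 0) ->
  (forall b, b \in l -> open b.1 /\ open b.2) -> measurable A -> measurable B ->
  let W := [set w | exists2 b, b \in l & (b.1 `*` b.2) w] in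
  measurable (W : set (borel (X * Z)%type)) /\ cm_val lam ((A `*` B) `&` W) = 0.
Proof.
move=> box0; elim: l A B => [|b l IH] A B bl mA mB W.
  rewrite (_ : W = set0); last by rewrite -subset0 => w [].
  by rewrite setI0 cm_val0; split.
have [ob1 ob2] := bl b (mem_head _ _).
have mb1 := borel_open ob1; have mb2 := borel_open ob2.
have bl' b' : b' \in l -> open b'.1 /\ open b'.2.
  by move=> b'l; apply: bl; rewrite inE b'l orbT.
pose V : set (borel (X * Z)%type) := [set w | exists2 b, b \in l & (b.1 `*` b.2) w].
have [mV AV] := IH A B bl' mA mB.
have [_ AbV] := IH (A `&` b.1) (B `&` b.2) bl' (measurableI _ _ mA mb1) (measurableI _ _ mB mb2).
have mb := borel_setX mb1 mb2; have mAB := borel_setX mA mB.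
have WE : W = (b.1 `*` b.2) `|` V.
  apply/seteqP; split => [w [b']|w [bw|[b' b'l b'w]]].
  - by rewrite inE => /predU1P[->|b'l b'w]; [left|right; exists b'].
  - by exists b; rewrite ?mem_head.
  - by exists b'; rewrite // inE b'l orbT.
have mW : measurable (W : set (borel (X * Z)%type)) by rewrite WE; exact: measurableU.
split => //; have mP := measurableI _ _ mAB mW.
rewrite (cm_valDI lam mP mb).
have -> : A `*` B `&` W `&` b.1 `*` b.2 = (A `&` b.1) `*` (B `&` b.2).
  rewrite WE; apply/seteqP; split => [[x z] [[[/= Ax Bz] _] [/= bx bz]]|[x z] [/= [Ax bx] [Bz bz]]].
    by split.
  by split; [split => //; left|].
rewrite box0 ?addr0; [|exact: measurableI|exact: measurableI].
have mAV := measurableI _ _ mAB mV.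
have := cm_valDI lam mAV mb; rewrite AV.
have -> : A `*` B `&` V `&` b.1 `*` b.2 = (A `&` b.1) `*` (B `&` b.2) `&` V.
  apply/seteqP; split => [[x z] [[[/= Ax Bz] Vw] [/= bx bz]]|[x z] [[/= [Ax bx] [Bz bz]] Vw]].
    by split.
  by split; [split|].
rewrite AbV addr0 => h; rewrite [RHS]h; congr (cm_val lam _).
rewrite WE; apply/seteqP; split => [w [[ABw [bw|Vw]] nbw]|w [[ABw Vw] nbw]] //.
by split => //; split => //; right.
Qed.

(* The Borel sets of the product need not be generated by rectangles, but a
   compact set is separated from a disjoint one by a finite union of them. *)
Lemma rectangles_null : hausdorff_space X -> hausdorff_space Z -> radon lam ->
  (forall (A : set (borel X)) (B : set (borel Z)), measurable A -> measurable B ->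
     cm_val lam (A `*` B) = 0) -> cm_null lam.
Proof.
move=> hX hZ rl box0 E mE; have hXZ := hausdorff_prod hX hZ.
apply: cabs_small0 => e e0; have e2 : 0 < e / 2 by rewrite divr_gt0.
have [C' [cC CE mC]] := radon_tight hXZ rl mE e2.
have [D [cD DE mD]] := radon_tight hXZ rl (measurableC mE) e2.
have [||l lb Cl] := @compact_finite_cover _ (set X * set Z)%type
  [set b | [/\ open b.1, open b.2 & b.1 `*` b.2 `<=` ~` D]]
  (fun b => b.1 `*` b.2) C' cC.
- move=> [U V] [/= oU oV _].
  have := openI (open_comp (fun w _ => fst_continuous (x := w)) oU)
                (open_comp (fun w _ => snd_continuous (x := w)) oV).
  by congr open.
- move=> [x z] Cxz; have nD : (~` D) (x, z) by move/DE; apply; exact: CE.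
  have [[U V] /= [nU nV] UV] := open_nbhs_nbhs (conj (closed_openC (compact_closed hXZ cD)) nD).
  exists (U°, V°) => //; split; try exact: open_interior.
  by move=> w [/= /interior_subset Uw /interior_subset Vw]; exact: UV.
have lb' b : b \in l -> open b.1 /\ open b.2 by move/lb => [].
have [mW] := setX_union_null box0 lb' (@measurableT _ (borel X)) (@measurableT _ (borel Z)).
set W := [set w | _] in mW *; rewrite setXTT setTI => W0.
have mC' := borel_compact hXZ cC; have mD' := borel_compact hXZ cD.
have CW w : C' w -> W w by move=> /Cl [b bl bw]; exists b.
have WD w : W w -> ~ D w by move=> [b /lb [_ _ bD] bw]; exact: bD.
have h1 : cabs (cm_val lam (E `\` W)) <= e / 2.
  apply: le_trans (le_cm_val_massr lam (measurableD mE mW)) _.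
  apply: le_trans (ltW mC); apply: le_massr; [exact: measurableD|exact: measurableD|].
  by move=> w [Ew nW]; split => // /CW.
have h2 : cabs (cm_val lam (W `\` E)) <= e / 2.
  apply: le_trans (le_cm_val_massr lam (measurableD mW mE)) _.
  apply: le_trans (ltW mD); apply: le_massr; [exact: measurableD| |].
    by apply: measurableD => //; exact: measurableC.
  by move=> w [/WD nD nE].
(* [lam] is 0 on [W], so its value on the common part of [E] and [W] is minus its value on the rest
   of [W]. *)
have := cm_valDI lam mE mW; have := cm_valDI lam mW mE.
rewrite W0 setIC => w1 w2.
have -> : cm_val lam E = cm_val lam (E `\` W) - cm_val lam (W `\` E).
  by rewrite w2; congr (_ + _); apply/eqP; rewrite -addr_eq0 addrC -w1.
by apply: le_trans (cabsD _ _) _; rewrite cabsN [leRHS]splitr; exact: lerD.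
Qed.

End slices.

(** * Weighted marginals and the tensor kernel *)

Section tensor_integral.
Context (R : realType) (X Z : ptopologicalType).
Local Notation C := (Cplx R).
Variables (hX : hausdorff_space X) (hZ : hausdorff_space Z).
Variables (p : X -> X -> C) (q : Z -> Z -> C).
Hypotheses (bp : bounded_kernel p) (cp : continuous_kernel p) (pp : psd p).
Hypotheses (bq : bounded_kernel q) (cq : continuous_kernel q) (pq : psd q).

Let hXZ := hausdorff_prod hX hZ.
Let bK := tensor_bounded bp bq.
Let cK := tensor_continuous cp cq.
Let pK := tensor_psd pp pq.

Let bmeas_q (v : Z) : bmeas (fun w : borel (X * Z)%type => q w.2 v).
Proof.
exact: (bmeas_comp (continuous_borel_fun (@snd_continuous X Z)) (kernel_bmeasl bq cq v)).
Qed.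

(** A predicate, since image measures are only obtained existentially. The domination clause carries
    the Radon property and compact support from [lam] to [nu]. *)
Definition weighted_marginal (lam : cmeasure (borel (X * Z)%type) R) (v : Z)
    (nu : cmeasure (borel X) R) :=
  (forall A : set (borel X), measurable A ->
     cm_val nu A = cintegral lam (fun w : borel (X * Z)%type => q w.2 v * \1_A w.1)) /\
  exists2 c : R, 0 <= c & forall A : set (borel X), measurable A ->
     cabs (cm_val nu A) <= c * massr lam ((fst : X * Z -> X) @^-1` A).

(* The double integral vanishes iff [\int p(x, y) q(u, v) d lam(x, u) = 0] for
   all [y] and [v], i.e. iff all the weighted marginals are orthogonal to [p]. *)
Lemma tensor_double_integral_eq0 (lam : cmeasure (borel (X * Z)%type) R) :
  radon lam ->
  (forall v nu, weighted_marginal lam v nu ->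
     double_integral (p : borel X -> borel X -> C) nu = 0 -> cm_null nu) ->
  double_integral (T := borel (X * Z)%type) (tensor_kernel p q) lam = 0 <->
  forall (A : set (borel X)) (mA : measurable A),
    double_integral (T := borel Z) q (slice lam mA) = 0.
Proof.
move=> rl inj.
have sr (A : set (borel X)) (mA : measurable A) : radon (slice lam mA).
  exact: (radon_dominated hXZ hZ (@snd_continuous X Z) ler01
    (fun B mB => slice_dominated lam mA mB) rl).
have ex v : exists nu, [/\ weighted_marginal lam v nu, radon nu &
    forall y, kernel_mean p nu y = kernel_mean (tensor_kernel p q) lam (y, v)].
  have [nu [nuE nuI [c c0 nuc]]] :=
    image_cmeasure lam (continuous_borel_fun (@fst_continuous X Z)) (bmeas_q v).
  exists nu; split; first by split => //; exists c.
    exact: (radon_dominated hXZ hX (@fst_continuous X Z) c0 nuc rl).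
  move=> y; rewrite /kernel_mean (nuI _ (kernel_bmeasl bp cp y)).
  by congr cintegral; apply/funext => w; rewrite /tensor_kernel mulrC.
have sliceE v nu (A : set (borel X)) (mA : measurable A) :
    weighted_marginal lam v nu -> kernel_mean q (slice lam mA) v = cm_val nu A.
  move=> [nuE _]; rewrite /kernel_mean slice_cintegral ?nuE //.
    by congr cintegral; apply/funext => w; rewrite mulrC.
  exact: kernel_bmeasl.
split=> [/(double_integral_eq0 hXZ bK cK pK rl) k0 A mA|s0].
  apply/(double_integral_eq0 hZ bq cq pq (sr A mA)) => v.
  have [nu [wnu rnu nuk]] := ex v; rewrite (sliceE v nu) //.
  apply: (inj v nu wnu) => //.
  by apply/(double_integral_eq0 hX bp cp pp rnu) => y; rewrite nuk k0.
apply/(double_integral_eq0 hXZ bK cK pK rl) => -[y v].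
have [nu [wnu rnu nuk]] := ex v; rewrite -nuk.
have nu0 : cm_null nu.
  move=> A mA; rewrite -(sliceE v nu A mA wnu).
  by have /(double_integral_eq0 hZ bq cq pq (sr A mA)) -> := s0 A mA.
exact: cintegral_null nu0 (kernel_bmeasl bp cp y).
Qed.

Lemma weighted_marginal_radon lam v nu : weighted_marginal lam v nu ->
  radon lam -> radon nu.
Proof.
by move=> [_ [c c0 dom]]; exact: radon_dominated hXZ hX (@fst_continuous X Z) c0 dom.
Qed.

Lemma weighted_marginal_radon_compact lam v nu : weighted_marginal lam v nu ->
  radon_compact lam -> radon_compact nu.
Proof.
by move=> [_ [c c0 dom]];
  exact: radon_compact_dominated hXZ hX (@fst_continuous X Z) c0 dom.
Qed.

Lemma weighted_marginal_discrete lam v nu : weighted_marginal lam v nu ->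
  discrete_measure lam -> discrete_measure nu.
Proof.
move=> [nuE _] [n [c [x lamE]]].
exists n, (fun i => c i * q (x i).2 v), (fun i => (x i).1) => A mA.
rewrite nuE // (discrete_cintegral lamE).
  by apply: eq_bigr => i _; rewrite mulrA.
apply: bmeasM (bmeas_q v) _.
exact: (bmeas_comp (continuous_borel_fun (@fst_continuous X Z)) (bmeas_indic R mA)).
Qed.

(** No measures are involved: strictness of [p] isolates the fibre of a combination over each point
    of [X], and strictness of [q] kills the coefficients in that fibre. *)
Lemma SPD_tensor : SPD (tensor_kernel p q) <-> SPD p /\ SPD q.
Proof.
split=> [sK|[sp sq]].
  split; apply: SPD_of_coefc => // a a0 y.
  (* The tensor form of [w] is the form of [a] times [q point point], hence 0. *)
  - pose w := [seq (u.1, (u.2, point : Z)) | u <- a].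
    have w0 : form (tensor_kernel p q) w w = 0.
      rewrite -[RHS](mul0r (q point point)) -a0 /form big_map mulr_suml.
      apply: eq_bigr => u _; rewrite big_map mulr_suml.
      by apply: eq_bigr => v _; rewrite /tensor_kernel mulrA.
    rewrite -(SPD_coefc (y, point) sK w0) /coefc big_map.
    by apply: eq_bigl => u; rewrite xpair_eqE eqxx andbT.
  - pose w := [seq (u.1, (point : X, u.2)) | u <- a].
    have w0 : form (tensor_kernel p q) w w = 0.
      rewrite -[RHS](mulr0 (p point point)) -a0 /form big_map big_distrr.
      apply: eq_bigr => u _; rewrite big_map big_distrr.
      by apply: eq_bigr => v _; rewrite /tensor_kernel /=; ring.
    rewrite -(SPD_coefc (point, y) sK w0) /coefc big_map.
    by apply: eq_bigl => u; rewrite xpair_eqE eqxx.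
apply: SPD_of_coefc pK _ => w w0 [x z].
have evw0 s : ev (tensor_kernel p q) w s = 0.
  have := ev_bound w s pK; rewrite /sqn w0 mul0r => h; apply: cabs_eq0.
  by apply/eqP; rewrite -sqrf_eq0 eq_le h sqr_ge0.
have form0 (Y : choiceType) (k : Y -> Y -> C) b : (forall y, ev k b y = 0) ->
    form k b b = 0.
  by move=> b0; rewrite formE big1 // => u _; rewrite b0 mulr0.
(* Freezing the second argument at [v] turns [w] into a combination for [p]. *)
pose a v := [seq (u.1 * q v u.2.2, u.2.1) | u <- w].
have a0 v : coefc (a v) x = 0.
  apply: (SPD_coefc _ sp); apply: form0 => y; rewrite -(evw0 (y, v)) /ev big_map.
  by apply: eq_bigr => u _; rewrite /tensor_kernel /=; ring.
(* The function of the fibre of [w] over [x] takes at [v] the value [coefc (a v) x]. *)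
pose b := [seq (u.1, u.2.2) | u <- w & u.2.1 == x].
have b0 : coefc b z = 0.
  apply: (SPD_coefc _ sq); apply: form0 => v; rewrite -(a0 v) /ev /coefc !big_map.
  by rewrite big_filter.
rewrite -b0 /coefc big_map big_filter_cond; apply: eq_bigl => u.
by rewrite -pair_eqE.
Qed.

Lemma universal_tensor : universal (tensor_kernel p q) <-> universal p /\ universal q.
Proof.
rewrite (universal_span_dense bK cK pK) (universal_span_dense bp cp pp).
rewrite (universal_span_dense bq cq pq); split=> [sK|[sp sq]].
  by split; [exact: span_dense_tensorl sK|exact: span_dense_tensorr sK].
exact: tensor_span_dense.
Qed.

(* Pushing a measure on the factor [Y] forward along the embedding [i] only
   multiplies its integral against the kernel by [t w]. *)
Let ISPD_factor (Y : ptopologicalType) (k : Y -> Y -> C) (i : Y -> X * Z)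
    (pr : X * Z -> Y) (t : X * Z -> C) :
  hausdorff_space Y -> bounded_kernel k -> continuous_kernel k -> psd k ->
  continuous i -> continuous pr -> cancel i pr ->
  (forall y w, tensor_kernel p q (i y) w = k y (pr w) * t w) ->
  ISPD (tensor_kernel p q) -> ISPD k.
Proof.
move=> hY bk ck pk ci cpr ipr kE [_ _ _ inj]; split => //.
- exact/positive_definite_psd.
- exact: continuous_rkhs_continuous.
move=> lam rl /(double_integral_eq0 hY bk ck pk rl) k0.
have [nu [nuE nuI [c c0 nuc]]] :=
  image_cmeasure lam (continuous_borel_fun ci) (bmeas_cst (borel Y) (1 : C)).
have rnu := radon_dominated hY hXZ ci c0 nuc rl.
have nu0 : cm_null nu.
  apply: inj => //; apply/(double_integral_eq0 hXZ bK cK pK rnu) => w.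
  rewrite /kernel_mean (nuI _ (kernel_bmeasl bK cK w)).
  rewrite (_ : (fun x => _) = (fun y : borel Y => t w * k y (pr w))); last first.
    by apply/funext => y; rewrite mul1r kE mulrC.
  by rewrite cintegralZ; [rewrite [cintegral _ _]k0 mulr0|exact: kernel_bmeasl].
move=> E mE; have mpE := borel_continuous cpr mE.
have := nu0 _ mpE; rewrite nuE // -cintegral_indic //; congr (cintegral lam _ = _).
apply/funext => y; rewrite mul1r !indicE.
by have -> : (i y \in pr @^-1` E) = (y \in E) by apply/idP/idP; rewrite !inE /= ipr.
Qed.

(** For the converse, the equivalence on measures and strictness of [q] make every slice null, so
    that [lam] vanishes on rectangles; regularity extends this to all Borel sets. *)
Lemma ISPD_tensor : ISPD (tensor_kernel p q) <-> ISPD p /\ ISPD q.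
Proof.
split=> [iK|[[_ _ _ ip] [_ _ _ iq]]].
  split.
  - apply: (ISPD_factor (i := fun x => (x, point)) (pr := fst)
      (t := fun w => q point w.2)) iK => //; last exact: fst_continuous.
    by move=> x; apply: cvg_pair; [exact: cvg_id|exact: cvg_cst].
  - apply: (ISPD_factor (i := fun z => (point, z)) (pr := snd)
      (t := fun w => p point w.1)) iK => //; last by move=> z w; rewrite mulrC.
      by move=> x; apply: cvg_pair; [exact: cvg_cst|exact: cvg_id].
    exact: snd_continuous.
split => //.
- exact/positive_definite_psd.
- exact: continuous_rkhs_continuous.
move=> lam rl D0; apply: rectangles_null => // A B mA mB.
have inj v nu : weighted_marginal lam v nu ->
    double_integral (p : borel X -> borel X -> C) nu = 0 -> cm_null nu.
  by move=> wnu; apply: ip; exact: weighted_marginal_radon wnu rl.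
have sr : radon (slice lam mA).
  exact: (radon_dominated hXZ hZ (@snd_continuous X Z) ler01
    (fun B mB => slice_dominated lam mA mB) rl).
have s0 := (tensor_double_integral_eq0 rl inj).1 D0 A mA.
exact: iq sr s0 B mB.
Qed.

End tensor_integral.

Theorem lemma7p7 (R : realType) (X Z : ptopologicalType)
    (hX : hausdorff_space X) (hZ : hausdorff_space Z)
    (p : X -> X -> Cplx R) (q : Z -> Z -> Cplx R)
    (bp : bounded_kernel p) (cp : continuous_kernel p)
    (pp : positive_definite p)
    (bq : bounded_kernel q) (cq : continuous_kernel q)
    (pq : positive_definite q) :
  (SPD p ->
     forall lam : cmeasure (borel (X * Z)%type) R, discrete_measure lam ->
       (forall (A : set (borel X)) (mA : measurable A),
          discrete_measure (slice lam mA)) /\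
       (double_integral (T := borel (X * Z)%type) (tensor_kernel p q) lam = 0
        <-> forall (A : set (borel X)) (mA : measurable A),
              double_integral (T := borel Z) q (slice lam mA) = 0)) /\
  (universal p ->
     forall lam : cmeasure (borel (X * Z)%type) R, radon_compact lam ->
       (forall (A : set (borel X)) (mA : measurable A),
          radon_compact (slice lam mA)) /\
       (double_integral (T := borel (X * Z)%type) (tensor_kernel p q) lam = 0
        <-> forall (A : set (borel X)) (mA : measurable A),
              double_integral (T := borel Z) q (slice lam mA) = 0)) /\
  (ISPD p ->
     forall lam : cmeasure (borel (X * Z)%type) R, radon lam ->
       (forall (A : set (borel X)) (mA : measurable A),
          radon (slice lam mA)) /\
       (double_integral (T := borel (X * Z)%type) (tensor_kernel p q) lam = 0
        <-> forall (A : set (borel X)) (mA : measurable A),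
              double_integral (T := borel Z) q (slice lam mA) = 0)) /\
  (SPD (tensor_kernel p q) <-> SPD p /\ SPD q) /\
  (universal (tensor_kernel p q) <-> universal p /\ universal q) /\
  (ISPD (tensor_kernel p q) <-> ISPD p /\ ISPD q).
Proof.
have pp' := (positive_definite_psd p).1 pp; have pq' := (positive_definite_psd q).1 pq.
have hXZ := hausdorff_prod hX hZ.
split; [|split; [|split; [|split; [|split]]]].
- move=> sp lam dl; split=> [A mA|]; first exact: slice_discrete.
  apply: tensor_double_integral_eq0 => //; first exact: (discrete_radon_compact hXZ dl).1.
  (* Strictness of [p] is needed only for weighted marginals, and these stay in the class of [lam],
     here that of discrete measures. *)
  move=> v nu wnu; apply: SPD_discrete_null => //.
  exact: (weighted_marginal_discrete bq cq wnu dl).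
- move=> up lam cl; split=> [A mA|].
    exact: (radon_compact_dominated hXZ hZ (@snd_continuous X Z) ler01
      (fun B mB => slice_dominated lam mA mB) cl).
  apply: tensor_double_integral_eq0 => //; first exact: cl.1.
  move=> v nu wnu; have cnu := weighted_marginal_radon_compact hX hZ wnu cl.
  move/(double_integral_eq0 hX bp cp pp' cnu.1); apply: span_dense_null => //.
  exact/(universal_span_dense bp cp pp').
- move=> [_ _ _ ip] lam rl; split=> [A mA|].
    exact: (radon_dominated hXZ hZ (@snd_continuous X Z) ler01
      (fun B mB => slice_dominated lam mA mB) rl).
  apply: tensor_double_integral_eq0 => // v nu wnu; apply: ip.
  exact: (weighted_marginal_radon hX hZ wnu rl).
- exact: SPD_tensor.
- exact: universal_tensor.
- exact: ISPD_tensor.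
Qed.
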